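(* There is a randomized local algorithm (called ParESP) which takes as input query access to an undirected graph $G=(V,E)$ with $n$ vertices (it may query the degree and the neighbours of any vertex), a starting vertex $v\in V$, a target conductance $\phi\in(0,1)$, a target size $\gamma$, and a parameter $0<\epsilon<1$, and which, in a given run, outputs a set $S\subseteq V$ with expected work per volume ratio $O(\gamma^{\epsilon}\phi^{-1/2}\log^2 n)$. Moreover, if $U\subseteq V$ is a set of vertices with $\phi(U)\le\phi$ and $\mu(U)\le\gamma$, then there is a subset $U'\subseteq U$ with $\mu(U')\ge \mu(U)/2$ such that, whenever $v\in U'$, with probability at least some absolute constant $c_0>0$ the output $S$ satisfies (1) $\phi(S)=O(\sqrt{\phi/\epsilon})$, and (2) $\mu(S)=O(\gamma^{1+\epsilon})$. All $O(\cdot)$ hide absolute constants.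
   Context: For an undirected graph $G=(V,E)$, $d(v)$ is the degree of $v$, and for $S\subseteq V$ the volume is $\mu(S)=\sum_{v\in S}d(v)$. $\partial(S)$ is the number of edges with exactly one endpoint in $S$, and the conductance of $S$ is $\phi(S)=\partial(S)/\mu(S)$. The work per volume ratio of a run of the algorithm is $W/\mu(S)$, where $W$ is the running time (number of operations) of that run and $S$ is the output set; the expected work per volume ratio is its expectation over the algorithm's randomness. *)

(* Defs.v *)
From HB Require Import structures.
From mathcomp Require Import all_boot all_order all_algebra.
From mathcomp Require Import all_classical all_reals all_analysis.

Set Implicit Arguments.
Unset Strict Implicit.
Unset Printing Implicit Defensive.

Import Order.TTheory GRing.Theory Num.Theory.

Local Open Scope ring_scope.

(** * Graphs *)

Record sgraph (n : nat) := SGraph {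
  edge :> rel 'I_n;
  edge_sym : symmetric edge;
  edge_irr : irreflexive edge }.

Definition deg n (G : sgraph n) (u : 'I_n) : nat := #|[set w | G u w]|.

Definition edges n (G : sgraph n) : {set {set 'I_n}} :=
  [set [set p.1; p.2] | p : 'I_n * 'I_n & G p.1 p.2].

Definition vol n (G : sgraph n) (S : {set 'I_n}) : nat :=
  (\sum_(u in S) deg G u)%N.

Definition boundary n (G : sgraph n) (S : {set 'I_n}) : nat :=
  #|[set A in edges G | #|A :&: S| == 1%N]|.

(* As [x / 0 = 0] in MathComp, this is the conductance only if [0 < vol G S]. *)
Definition conductance (R : realType) n (G : sgraph n) (S : {set 'I_n}) : R :=
  (boundary G S)%:R / (vol G S)%:R.

(** * Query access *)

(* The neighbours of each vertex are listed in an arbitrary order. *)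
Definition adjacency_lists n (G : sgraph n) (L : 'I_n -> seq 'I_n) : Prop :=
  forall u, uniq (L u) /\ forall w, (w \in L u) = G u w.

Record oracle := Oracle {
  degree_query : nat -> nat;
  neighbour_query : nat -> nat -> nat }.

(* Vertices are named by their index.  Queries that make no sense (not a vertex,
   or no [i]-th neighbour) are answered by 0. *)
Definition graph_oracle n (L : 'I_n -> seq 'I_n) : oracle :=
  Oracle
    (fun u => if insub u is Some u' then size (L u') else 0%N)
    (fun u i => if insub u is Some u'
                then nth 0%N [seq val w | w <- L u'] i else 0%N).

(** * Randomized algorithms: a unit-cost real RAM with graph queries

   The memory consists of arrays of natural numbers and of arrays of reals;
   [NGet a e] and [RGet a e] denote the cell number [e] of array [a].  The names
   of arrays are part of the program text, the indices are computed.  The syntax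
   does not depend on the graph nor on the other inputs, so that a program is a
   single uniform algorithm. *)

Inductive nexp :=
| NConst of nat
| NGet of nat & nexp
| NAdd of nexp & nexp
| NSub of nexp & nexp
| NMul of nexp & nexp
| NDiv of nexp & nexp
| NMod of nexp & nexp.

Inductive rexp :=
| ROfNat of nexp
| RGet of nat & nexp
| RAdd of rexp & rexp
| RSub of rexp & rexp
| RMul of rexp & rexp
| RDiv of rexp & rexp
| RExp of rexp
| RLn of rexp.

Inductive test :=
| NLe of nexp & nexp
| RLe of rexp & rexp
| Not of test
| And of test & test.

Inductive cmd :=
| Skip
| NSet of nat & nexp & nexp          (* NSet a i e : a[i] := e *)
| RSet of nat & nexp & rexp
| Rand of nat & nexp & nexp          (* Rand a i k : a[i] := uniform in [0, k) *)
| Degree of nat & nexp & nexp        (* Degree a i u : a[i] := degree of u *)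
| Neighbour of nat & nexp & nexp & nexp
                      (* Neighbour a i u j : a[i] := j-th neighbour of u *)
| Emit of nexp                       (* append a vertex to the output *)
| Seq of cmd & cmd
| If of test & cmd & cmd
| While of test & cmd.

Record state (R : realType) := State {
  nmem : nat -> nat -> nat;
  rmem : nat -> nat -> R;
  emitted : seq nat }.

Definition upd (X : Type) (m : nat -> nat -> X) (a i : nat) (x : X) :
    nat -> nat -> X :=
  fun a' i' => if (a' == a) && (i' == i) then x else m a' i'.

Definition nset (R : realType) (s : state R) (a i k : nat) : state R :=
  State (upd (nmem s) a i k) (rmem s) (emitted s).

Definition rset (R : realType) (s : state R) (a i : nat) (x : R) : state R :=
  State (nmem s) (upd (rmem s) a i x) (emitted s).

Definition emit (R : realType) (s : state R) (u : nat) : state R :=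
  State (nmem s) (rmem s) (rcons (emitted s) u).

Fixpoint neval (R : realType) (s : state R) (e : nexp) : nat :=
  match e with
  | NConst k => k
  | NGet a i => nmem s a (neval s i)
  | NAdd e1 e2 => (neval s e1 + neval s e2)%N
  | NSub e1 e2 => (neval s e1 - neval s e2)%N
  | NMul e1 e2 => (neval s e1 * neval s e2)%N
  | NDiv e1 e2 => (neval s e1 %/ neval s e2)%N
  | NMod e1 e2 => (neval s e1 %% neval s e2)%N
  end.

Fixpoint reval (R : realType) (s : state R) (e : rexp) : R :=
  match e with
  | ROfNat k => (neval s k)%:R
  | RGet a i => rmem s a (neval s i)
  | RAdd e1 e2 => reval s e1 + reval s e2
  | RSub e1 e2 => reval s e1 - reval s e2
  | RMul e1 e2 => reval s e1 * reval s e2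
  | RDiv e1 e2 => reval s e1 / reval s e2
  | RExp e1 => expR (reval s e1)
  | RLn e1 => ln (reval s e1)
  end.

Fixpoint teval (R : realType) (s : state R) (b : test) : bool :=
  match b with
  | NLe e1 e2 => (neval s e1 <= neval s e2)%N
  | RLe e1 e2 => reval s e1 <= reval s e2
  | Not b1 => ~~ teval s b1
  | And b1 b2 => teval s b1 && teval s b2
  end.

(* The commands that remain to be executed, and the current state. *)
Definition config (R : realType) : Type := (seq cmd * state R)%type.

(* One operation of the machine: the list of the possible next configurations,
   which are equiprobable (there is only one, except for [Rand]).  A step
   evaluates boundedly many arithmetic operations, since the expressions that
   occur in a given program are fixed; counting steps is thus counting operations
   up to a constant factor that depends on the program only. *)
Definition step (R : realType) (O : oracle) (c : config R) : seq (config R) :=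
  let s := c.2 in
  match c.1 with
  | [::] => [::]
  | Skip :: k => [:: (k, s)]
  | NSet a i e :: k => [:: (k, nset s a (neval s i) (neval s e))]
  | RSet a i e :: k => [:: (k, rset s a (neval s i) (reval s e))]
  | Rand a i e :: k =>
      [seq (k, nset s a (neval s i) j) | j <- iota 0 (maxn 1 (neval s e))]
  | Degree a i u :: k =>
      [:: (k, nset s a (neval s i) (degree_query O (neval s u)))]
  | Neighbour a i u j :: k =>
      [:: (k, nset s a (neval s i)
                (neighbour_query O (neval s u) (neval s j)))]
  | Emit u :: k => [:: (k, emit s (neval s u))]
  | Seq p q :: k => [:: (p :: q :: k, s)]
  | If b p q :: k => [:: ((if teval s b then p else q) :: k, s)]
  | While b p :: k => [:: (if teval s b then p :: While b p :: k else k, s)]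
  end.

(* Expectation of [f W out], where [W] is the total number of steps and [out] the
   output, restricted to the event that the machine halts within [t] steps from
   the configuration [c], [w] steps having been executed before reaching [c]. *)
Fixpoint expect_within (R : realType) (O : oracle) (f : nat -> seq nat -> R)
    (t w : nat) (c : config R) {struct t} : R :=
  if c.1 is [::] then f w (emitted c.2) else
  if t is t'.+1 then
    (\sum_(c' <- step O c) expect_within O f t' w.+1 c')
      / (size (step O c))%:R
  else 0.

(* Inputs: the vertex in cell 0 of the [nat] array 0, the reals [phi], [gamma]
   and [eps] in cells 0, 1, 2 of the real array 0.  The remaining memory is zero;
   in particular, the number of vertices is not given to the program. *)
Definition init_state (R : realType) (v : nat) (phi gamma eps : R) : state R :=
  State (upd (fun _ _ => 0%N) 0 0 v)
        (fun a i => if a == 0%N then nth 0 [:: phi; gamma; eps] i else 0)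
        [::].

Definition output_set n (out : seq nat) : {set 'I_n} :=
  [set u : 'I_n | val u \in out].

(* Expectation, over the random choices of program [p], of [f W S], where [W] is
   the running time and [S] the output set, for a nonnegative [f].  The runs that
   do not halt count as 0, so that this is the expectation of [f W S] only if
   the program halts with probability 1. *)
Definition expectation_run (R : realType) n (L : 'I_n -> seq 'I_n) (p : cmd)
    (v : 'I_n) (phi gamma eps : R) (f : nat -> {set 'I_n} -> R) : \bar R :=
  ereal_sup (range (fun t : nat =>
    (expect_within (graph_oracle L) (fun w out => f w (output_set n out))
       t 0 ([:: p], init_state v phi gamma eps))%:E)).

(* Probability that the program halts with an output [S] satisfying [A]. *)
Definition probability_run (R : realType) n (L : 'I_n -> seq 'I_n) (p : cmd)
    (v : 'I_n) (phi gamma eps : R) (A : {set 'I_n} -> bool) : \bar R :=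
  expectation_run L p v phi gamma eps (fun _ S => (A S)%:R).

(* Main.v *)
(* Volume-biased evolving sets from v: a lazy walk x is run together with a set
   S containing x; given the new position y, the next set is {u : Q(u, S) > theta}
   for theta uniform in [0, Q(y, S)] (Diaconis-Fill coupling).  Averaged over the
   walk, this is the evolving set process reweighted by volume.  Until a set of
   conductance at most th = 100 sqrt(phi / eps) appears, the potential
   log (1 / vol S) moves by cond(S)^2 per step, so that the process stops soon and
   its expected work per volume is O((log n) / th).  If the walk is likely to stay
   in U, then so is a random point of S, which forces S to be small when the
   process stops: one copy succeeds with probability about gamma^(-eps / 2) as soon
   as v lies in the set U' of vertices from which the walk stays in U for
   T ~ eps log(gamma) / phi steps with at least that probability.

   Round i runs N ~ gamma^(eps / 2) copies, each aborted when its work exceeds the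
   budget B_i = D (i + 1) 2^i.  A copy is accepted in round i only if its work lies
   in (B_(i-1), B_i]: this bounds the work of the whole run by the work of the
   accepted copy, up to the factor N, hence the ratio in expectation.  As the
   windows partition the budgets up to B_I, with 2^I about the size limit cap, the
   N copies of rounds 0..I have together the chance of N copies run with the single
   budget B_I.  A round without accepted copy ends with a search of the component
   of v up to volume 2^i: it provides an output (the component, or the volume
   limit 2^i >= cap is exceeded) whose volume is large enough to pay for the work, or
   else shows that the component has volume above 2^i, whence O(log n) rounds. *)
Require Import Defs.
From HB Require Import structures.
From mathcomp Require Import all_boot all_order all_algebra.
From mathcomp Require Import all_classical all_reals all_analysis.
From mathcomp Require Import zify ring lra.

Set Implicit Arguments.
Unset Strict Implicit.
Unset Printing Implicit Defensive.

Import Order.TTheory GRing.Theory Num.Theory.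

Local Open Scope ring_scope.

(** * Program logic for lower and upper bounds *)

(** The obstacle behind [U'] is the length of the walk. The linear escape bound [t * boundary / 2]
    is void beyond time about [1 / phi], while halting may take time of order
    [eps * ln gamma / phi]. The walk killed outside [U] is self-adjoint for the degree inner
    product; for a set [A] with half the volume of [U], the moment [m(t)] of returning to [A]
    therefore satisfies [m(t)^2 <= m(0) * m(2t)]. A share 1/8 at time about [1 / (2 phi)] thus
    becomes [8^(-2^j)] at [2^j] times that time, and [2^j] about [eps * ln gamma / 6] keeps it above
    [1 / (8h)], where [h = gamma^(eps/2)].

    The constants leave room for three losses of at most [1 / (32h)] each: the size limit
    [32 * gamma * h], the horizon and the budget. A copy succeeds with probability at least
    [1/(8h) - 3/(32h) = 1/(32h)], and more than [h] copies give the absolute constant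
    [1 - exp(-1/32)].

    The machine only draws integers. Thresholds are therefore multiples of [1/K], with [K] kept
    divisible by the degrees that matter, so the program simulates the process exactly and no error
    terms arise. *)

Section Semantics.
Variables (R : realType) (O : oracle) (f : nat -> seq nat -> R).
Hypothesis f_ge0 : forall w out, 0 <= f w out.

Lemma expect_within_ge0 t w c : 0 <= expect_within O f t w c.
Proof.
elim: t w c => [|t IH] w [[|p k] s] //=.
by rewrite divr_ge0 // sumr_ge0.
Qed.

Lemma expect_within_le t t' w c : (t <= t')%N ->
  expect_within O f t w c <= expect_within O f t' w c.
Proof.
elim: t t' w c => [|t IH] [|t'] w [[|p k] s] //= le_tt'.
  exact: (expect_within_ge0 t'.+1 w (p :: k, s)).
by rewrite ler_wpM2r ?invr_ge0 // ler_sum // => c' _; apply: IH.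
Qed.

(** The expectation is a supremum over the number of steps allowed: an upper bound must hold for
    every [t], a lower bound is witnessed by one [t]. *)
Definition ub w c b := forall t, expect_within O f t w c <= b.
Definition lb w c b := exists t, b <= expect_within O f t w c.

(* Both [ub] and [lb] have this property: the execution of the program is analysed
   once, for an arbitrary step-closed [P]. *)
Definition step_closed (P : nat -> config R -> R -> Prop) :=
  forall w c (x : nat -> R), c.1 <> [::] -> (0 < size (step O c))%N ->
    (forall i, (i < size (step O c))%N -> P w.+1 (nth c (step O c) i) (x i)) ->
    P w c ((\sum_(0 <= i < size (step O c)) x i) / (size (step O c))%:R).

Lemma ub_closed : step_closed ub.
Proof.
move=> w c x c_run sz0 ubx [|t].
  (* With no step left the truncated expectation is 0, so the bound itself must be nonnegative; this
     comes from the successors and [f_ge0]. *)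
  have: 0 <= \sum_(0 <= i < size (step O c)) x i.
    rewrite big_nat sumr_ge0 // => i /andP[_ lt_i].
    exact: le_trans (expect_within_ge0 0 _ _) (ubx i lt_i 0).
  by case: c c_run {sz0 ubx} => [[|p k] s] //= _ ?; rewrite divr_ge0.
have -> : expect_within O f t.+1 w c =
  (\sum_(c' <- step O c) expect_within O f t w.+1 c') / (size (step O c))%:R.
  by case: c c_run {sz0 ubx} => [[|p k] s].
rewrite ler_wpM2r ?invr_ge0 // (big_nth c) !big_nat ler_sum // => i /andP[_ lt_i].
exact: ubx.
Qed.

(** A configuration has finitely many successors, so the largest of their step bounds serves all of
    them, by monotonicity. *)
Lemma lb_closed : step_closed lb.
Proof.
move=> w c x c_run sz0 lbx.
have /choice [t tP] : forall i : nat, exists t, (i < size (step O c))%N ->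
    x i <= expect_within O f t w.+1 (nth c (step O c) i).
  move=> i; case: (ltnP i (size (step O c))) => [/lbx [t ?]|_]; last by exists 0.
  by exists t.
exists (\max_(i < size (step O c)) t i).+1.
have -> m : expect_within O f m.+1 w c =
  (\sum_(c' <- step O c) expect_within O f m w.+1 c') / (size (step O c))%:R.
  by case: c c_run {sz0 lbx tP} => [[|p k] s].
rewrite ler_wpM2r ?invr_ge0 // (big_nth c) !big_nat ler_sum // => i /andP[_ lt_i].
apply: le_trans (tP i lt_i) (expect_within_le _ _ _).
exact: (@leq_bigmax_cond _ _ (fun j : 'I_(size (step O c)) => t j) (Ordinal lt_i)).
Qed.

Lemma ub_halt w s b : f w (emitted s) <= b -> ub w ([::], s) b.
Proof. by move=> le_b [|t]. Qed.

Lemma lb_halt w s b : b <= f w (emitted s) -> lb w ([::], s) b.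
Proof. by exists 0. Qed.

Lemma ub_weaken w c b b' : b <= b' -> ub w c b -> ub w c b'.
Proof. by move=> le_b ubb t; apply: le_trans le_b. Qed.

Lemma lb_weaken w c b b' : b' <= b -> lb w c b -> lb w c b'.
Proof. by move=> le_b [t ?]; exists t; apply: le_trans le_b _. Qed.

Variable P : nat -> config R -> R -> Prop.
Hypothesis clP : step_closed P.

Lemma closed_step1 w c c' x : c.1 <> [::] -> step O c = [:: c'] ->
  P w.+1 c' x -> P w c x.
Proof.
move=> c_run stepc Px.
have := @clP w c (fun=> x) c_run; rewrite stepc /= => /(_ isT).
by rewrite big_nat1 divr1; apply => -[].
Qed.

Lemma closed_rand w a i e k s (x : nat -> R) :
  let m := neval s e in (0 < m)%N ->
  (forall j, (j < m)%N -> P w.+1 (k, nset s a (neval s i) j) (x j)) ->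
  P w (Rand a i e :: k, s) ((\sum_(0 <= j < m) x j) / m%:R).
Proof.
move=> m m_gt0 Px.
have stepE : step O (Rand a i e :: k, s) =
    [seq (k, nset s a (neval s i) j) | j <- iota 0 m].
  by congr [seq _ | _ <- iota 0 _]; apply/maxn_idPr.
have := @clP w (Rand a i e :: k, s) x.
rewrite stepE size_map size_iota; apply => // j lt_jm.
have sz : (j < size (iota 0 m))%N by rewrite size_iota.
by rewrite (nth_map 0%N _ _ sz) nth_iota // add0n; apply: Px.
Qed.

End Semantics.

(** * Deterministic fragments and their running time *)

Section BigStep.
Variables (R : realType) (O : oracle).
Implicit Types (p q : cmd) (s : state R) (b : test).

(** There is no rule for [Rand]: a deterministic fragment has a single run, whose exact length is
    recorded, and [closed_bigstep] crosses it without splitting the value. *)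
Inductive bigstep : cmd -> state R -> nat -> state R -> Prop :=
| BSkip s : bigstep Skip s 1 s
| BNSet s a i e : bigstep (NSet a i e) s 1 (nset s a (neval s i) (neval s e))
| BRSet s a i e : bigstep (RSet a i e) s 1 (rset s a (neval s i) (reval s e))
| BDegree s a i u : bigstep (Degree a i u) s 1
    (nset s a (neval s i) (degree_query O (neval s u)))
| BNeighbour s a i u j : bigstep (Neighbour a i u j) s 1
    (nset s a (neval s i) (neighbour_query O (neval s u) (neval s j)))
| BEmit s u : bigstep (Emit u) s 1 (emit s (neval s u))
| BSeq p q s n s1 m s2 : bigstep p s n s1 -> bigstep q s1 m s2 ->
    bigstep (Seq p q) s (n + m).+1 s2
| BIf b p q s n s' : bigstep (if teval s b then p else q) s n s' ->
    bigstep (If b p q) s n.+1 s'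
| BWhileF b p s : ~~ teval s b -> bigstep (While b p) s 1 s
| BWhileT b p s n s1 m s2 : teval s b -> bigstep p s n s1 ->
    bigstep (While b p) s1 m s2 -> bigstep (While b p) s (n + m).+1 s2.

Lemma closed_bigstep P p s n s' k w x : @step_closed R O P -> bigstep p s n s' ->
  P (w + n)%N (k, s') x -> P w (p :: k, s) x.
Proof.
move=> clP bs; elim: bs k w x => {p s n s'}.
- by move=> s k w x; rewrite addn1 => Px; apply: (closed_step1 clP _ _ Px).
- by move=> s a i e k w x; rewrite addn1 => Px; apply: (closed_step1 clP _ _ Px).
- by move=> s a i e k w x; rewrite addn1 => Px; apply: (closed_step1 clP _ _ Px).
- by move=> s a i e k w x; rewrite addn1 => Px; apply: (closed_step1 clP _ _ Px).
- by move=> s a i e j k w x; rewrite addn1 => Px; apply: (closed_step1 clP _ _ Px).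
- by move=> s e k w x; rewrite addn1 => Px; apply: (closed_step1 clP _ _ Px).
- move=> p q s n s1 m s2 _ IHp _ IHq k w x Px.
  apply: (@closed_step1 _ _ _ clP _ _ (p :: q :: k, s)) => //.
  by apply: IHp; apply: IHq; rewrite addSn -addnS -addnA.
- move=> b p q s n s' _ IH k w x Px.
  apply: (@closed_step1 _ _ _ clP _ _ ((if teval s b then p else q) :: k, s)) => //.
  by apply: IH; rewrite addSnnS.
- move=> b p s /negbTE bF k w x; rewrite addn1 => Px.
  apply: (closed_step1 clP _ _ Px) => //.
  by rewrite /step /= bF.
- move=> b p s n s1 m s2 bT _ IHp _ IHw k w x Px.
  apply: (@closed_step1 _ _ _ clP _ _ (p :: While b p :: k, s)) => //; first by rewrite /step /= bT.
  by apply: IHp; apply: IHw; rewrite addSn -addnS -addnA.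
Qed.

Definition wp p s (Q : nat -> state R -> Prop) :=
  exists n s', bigstep p s n s' /\ Q n s'.

Lemma wp_conseq p s (Q Q' : nat -> state R -> Prop) :
  (forall n s', Q n s' -> Q' n s') -> wp p s Q -> wp p s Q'.
Proof. by move=> QQ' [n [s' [bs /QQ' q]]]; exists n, s'. Qed.

Lemma wp_skip s Q : Q 1%N s -> wp Skip s Q.
Proof. by move=> q; exists 1%N, s; split=> //; constructor. Qed.

Lemma wp_nset s a i e Q :
  Q 1%N (nset s a (neval s i) (neval s e)) -> wp (NSet a i e) s Q.
Proof. by move=> q; do 2!eexists; split; [constructor|]. Qed.

Lemma wp_rset s a i e Q :
  Q 1%N (rset s a (neval s i) (reval s e)) -> wp (RSet a i e) s Q.
Proof. by move=> q; do 2!eexists; split; [constructor|]. Qed.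

Lemma wp_degree s a i u Q :
  Q 1%N (nset s a (neval s i) (degree_query O (neval s u))) ->
  wp (Degree a i u) s Q.
Proof. by move=> q; do 2!eexists; split; [constructor|]. Qed.

Lemma wp_neighbour s a i u j Q :
  Q 1%N (nset s a (neval s i) (neighbour_query O (neval s u) (neval s j))) ->
  wp (Neighbour a i u j) s Q.
Proof. by move=> q; do 2!eexists; split; [constructor|]. Qed.

Lemma wp_emit s u Q : Q 1%N (emit s (neval s u)) -> wp (Emit u) s Q.
Proof. by move=> q; do 2!eexists; split; [constructor|]. Qed.

Lemma wp_seq p q s Q :
  wp p s (fun n s1 => wp q s1 (fun m s2 => Q (n + m).+1 s2)) ->
  wp (Seq p q) s Q.
Proof.
move=> [n [s1 [bp [m [s2 [bq q12]]]]]].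
by exists (n + m).+1, s2; split=> //; apply: BSeq bp bq.
Qed.

Lemma wp_if b p q s Q :
  (teval s b -> wp p s (fun n s' => Q n.+1 s')) ->
  (~~ teval s b -> wp q s (fun n s' => Q n.+1 s')) -> wp (If b p q) s Q.
Proof.
case E: (teval s b) => wpT wpF.
- have [n [s' [bs qn]]] := wpT isT.
  by exists n.+1, s'; split=> //; constructor; rewrite E.
- have [n [s' [bs qn]]] := wpF isT.
  by exists n.+1, s'; split=> //; constructor; rewrite E.
Qed.

(** The number given to [I] counts the steps since the loop was entered, so that time bounds are
    part of the invariant. *)
Lemma wp_while (I : nat -> state R -> Prop) (meas : state R -> nat) b p s Q :
  I 0%N s ->
  (forall n s, I n s -> teval s b ->
     wp p s (fun m s' => I (n + m).+1 s' /\ (meas s' < meas s)%N)) ->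
  (forall n s, I n s -> ~~ teval s b -> Q n.+1 s) ->
  wp (While b p) s Q.
Proof.
move=> I0 Istep Iend.
have: forall n s1, I n s1 ->
    wp (While b p) s1 (fun m s2 => Q (n + m)%N s2).
  move=> n s1; have [k] := ubnP (meas s1); elim: k n s1 => // k IH n s1 le_k In.
  case bT: (teval s1 b).
    have [m [s2 [bs [Im lt_m]]]] := Istep n s1 In bT.
    have [m' [s3 [bs' qm']]] := IH _ s2 (leq_trans lt_m le_k) Im.
    exists (m + m').+1, s3; split; first exact: BWhileT bs bs'.
    by rewrite addnS addnA.
  exists 1%N, s1; split; first by constructor; rewrite bT.
  by rewrite addn1; apply: Iend; rewrite ?bT.
by move=> /(_ 0%N s I0).
Qed.

End BigStep.

(** * Evolving sets *)

Section Graph.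
Variables (n : nat) (G : sgraph n).
Implicit Types (S T A B : {set 'I_n}) (u w : 'I_n).

Definition nbr u S : nat := #|[set w in S | G u w]|.
(** Twice the ergodic flow of the lazy walk between [S] and [u]: [att S u / (2 * deg G u)] is the
    probability that a lazy step from [u] lands in [S]. *)
Definition att S u : nat := nbr u S + (u \in S) * deg G u.

Lemma nbrE u S : nbr u S = (\sum_(w in S) G u w)%N.
Proof.
rewrite /nbr -sum1_card big_mkcond [RHS]big_mkcond /=.
by apply: eq_bigr => w _; rewrite inE; case: (w \in S); case: (G u w).
Qed.

Lemma degE u : deg G u = (\sum_w G u w)%N.
Proof.
rewrite /deg -sum1_card big_mkcond /=.
by apply: eq_bigr => w _; rewrite inE; case: (G u w).
Qed.

Lemma nbr_setC u S : (nbr u S + nbr u (~: S) = deg G u)%N.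
Proof.
rewrite !nbrE degE [RHS](bigID (mem S)) /=; congr addn.
by apply: eq_bigl => w; rewrite inE.
Qed.

Lemma nbr_le_deg u S : (nbr u S <= deg G u)%N.
Proof. by rewrite -(nbr_setC u S) leq_addr. Qed.

Lemma sum_nbr_sym A B : (\sum_(u in A) nbr u B = \sum_(u in B) nbr u A)%N.
Proof.
under eq_bigr do rewrite nbrE.
under [RHS]eq_bigr do rewrite nbrE.
rewrite exchange_big; apply: eq_bigr => w _; apply: eq_bigr => u _.
by rewrite edge_sym.
Qed.

(** Ordered pairs with first point in [S] and second outside map injectively to edges, since only
    one end of such an edge lies in [S]. *)
Lemma boundaryE S : boundary G S = (\sum_(u in S) nbr u (~: S))%N.
Proof.
pose X := [set p : 'I_n * 'I_n | [&& p.1 \in S, p.2 \notin S & G p.1 p.2]].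
have cardX : #|X| = (\sum_(u in S) nbr u (~: S))%N.
  under eq_bigr do rewrite nbrE.
  rewrite pair_big_dep /= -sum1_card big_mkcond [RHS]big_mkcond /=.
  apply: eq_bigr => -[u w] _; rewrite !inE /=.
  by case: (u \in S); case: (w \in S); case: (G u w).
have : #|[set [set p.1; p.2] | p in X]| = #|X|.
  apply: card_in_imset => -[a b] [c d]; rewrite !inE /= => /and3P[aS bS _] /and3P[cS dS _] E.
  have : a \in [set c; d] by rewrite -E !inE eqxx.
  have : b \in [set c; d] by rewrite -E !inE eqxx orbT.
  rewrite !inE => /orP[/eqP eb|/eqP ->] /orP[/eqP ->|/eqP ea] //.
  - by move: bS; rewrite eb cS.
  - by move: bS; rewrite eb cS.
  - by move: dS; rewrite -ea aS.
rewrite cardX => <-; rewrite /boundary.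
apply: eq_card => A; rewrite !inE; apply/andP/imsetP.
- case=> /imsetP[[a b] /=]; rewrite inE /= => Gab ->.
  have ab : a != b by apply/eqP => ab; move: Gab; rewrite ab edge_irr.
  have -> : [set a; b] :&: S = [set c in [set a; b] | c \in S] by apply/setP => c; rewrite !inE.
  case aS: (a \in S); case bS: (b \in S) => card1.
  + move: card1; have -> : [set c in [set a; b] | c \in S] = [set a; b].
      apply/setP => c; rewrite !inE.
      by case: eqP => [->|_]; case: eqP => [->|_]; rewrite ?aS ?bS.
    by rewrite cards2 ab.
  + by exists (a, b) => //; rewrite inE /= aS bS.
  + by exists (b, a); rewrite ?inE /= ?aS ?bS 1?edge_sym //= finset.setUC.
  + move: card1; have -> : [set c in [set a; b] | c \in S] = finset.set0.
      apply/setP => c; rewrite finset.in_set0 finset.in_set; apply/negP => /andP[].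
      by rewrite in_set2 => /orP[]/eqP ->; rewrite ?aS ?bS.
    by rewrite cards0.
- case=> -[a b]; rewrite inE /= => /and3P[aS bS Gab] ->; split.
    by apply/imsetP; exists (a, b); rewrite ?inE.
  apply/cards1P; exists a; apply/setP => c; rewrite !inE.
  case: eqP => [->|_] /=; first by rewrite aS.
  by case: eqP => [->|_] //=; rewrite (negbTE bS).
Qed.

Lemma boundaryCE S : boundary G S = (\sum_(u in ~: S) nbr u S)%N.
Proof. by rewrite boundaryE sum_nbr_sym. Qed.

Lemma boundary_le_vol S : (boundary G S <= vol G S)%N.
Proof. by rewrite boundaryE leq_sum // => u _; apply: nbr_le_deg. Qed.

Lemma att_le S u : (att S u <= 2 * deg G u)%N.
Proof.
by rewrite /att mul2n -addnn leq_add ?nbr_le_deg //; case: (u \in S); rewrite ?mul1n.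
Qed.

Lemma att_in S u : u \in S -> att S u = (nbr u S + deg G u)%N.
Proof. by rewrite /att => ->; rewrite mul1n. Qed.

Lemma att_notin S u : u \notin S -> att S u = nbr u S.
Proof. by rewrite /att => /negbTE ->; rewrite addn0. Qed.

(* Thresholds are discretised: as every [2 * deg G u] that matters divides [K],
   an integer [z] uniform below [K] is as good as a real threshold [z / K]. *)
Definition lev K S z : {set 'I_n} := [set u | (z * (2 * deg G u) < K * att S u)%N].

(** Only vertices that may belong to the next set are constrained; a condition on all degrees would
    make the program read the whole graph. *)
Definition valid K S := (0 < K)%N /\
  forall u, (0 < att S u)%N -> (2 * deg G u %| K)%N.

Definition sdiff S T := (S :\: T) :|: (T :\: S).

(** The factor that [K] receives while the vertices of [sdiff S T] are toggled, one factor for each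
    neighbour of a toggled vertex. *)
Definition touch S T : nat := (\prod_(u in sdiff S T) \prod_(w | G u w) (2 * deg G w))%N.

Lemma deg_gt0 u w : G u w -> (0 < deg G u)%N.
Proof. by move=> Guw; apply/card_gt0P; exists w; rewrite inE. Qed.

Lemma nbr_gt0 u S : (0 < nbr u S)%N -> exists2 w, w \in S & G u w.
Proof. by move=> /card_gt0P[w]; rewrite inE => /andP[? ?]; exists w. Qed.

Lemma touch_gt0 S T : (0 < touch S T)%N.
Proof.
apply: prodn_gt0 => u; apply: prodn_cond_gt0 => w Guw.
by rewrite muln_gt0 /=; apply: (@deg_gt0 w u); rewrite edge_sym.
Qed.

Lemma lev_att K S z u : u \in lev K S z -> (0 < att S u)%N.
Proof. by rewrite inE => lt; case: (att S u) lt => //; rewrite muln0. Qed.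

(** A member of the next set was already attached to [S]. A nonmember with a neighbour [w] in the
    next set either was attached to [S] through [w], or [w] has just entered and [touch] contains
    the missing factor. *)
Lemma valid_lev K S z : valid K S -> valid (K * touch S (lev K S z)) (lev K S z).
Proof.
move=> [K0 vK]; split=> [|u]; first by rewrite muln_gt0 K0 touch_gt0.
have [uT|uT] := boolP (u \in lev K S z).
  by move=> _; rewrite dvdn_mulr // vK //; apply: lev_att uT.
rewrite att_notin // => /nbr_gt0[w wT Guw].
have [wS|wS] := boolP (w \in S).
  rewrite dvdn_mulr // vK // (leq_trans _ (leq_addr _ _)) //.
  by apply/card_gt0P; exists w; rewrite inE wS.
rewrite dvdn_mull // /touch (bigD1 w) /=; last by rewrite finset.in_setU !finset.in_setD (negbTE wS) wT orbT.
by rewrite dvdn_mulr // (bigD1 u) /=; [exact: dvdn_mulr|rewrite edge_sym].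
Qed.

(** The threshold 1/2 is then an integer, at which [sum_sqrt_lev] cuts the range. *)
Lemma valid_half K S u : valid K S -> u \in S -> (0 < deg G u)%N -> K = (K./2).*2.
Proof.
move=> [_ vK] uS du.
have : (2 %| K)%N.
  by apply: dvdn_trans (vK u _); [exact: dvdn_mulr|rewrite att_in // addn_gt0 du orbT].
by rewrite dvdn2 => /negbTE; rewrite -{2}[K]odd_double_half => ->.
Qed.

(** Divisibility makes the cut-off an exact integer, so the fraction of thresholds that select [u]
    is exactly the one-step probability of landing in [S]. *)
Lemma lev_ub K S u : valid K S -> exists2 m, (K * att S u = m * (2 * deg G u))%N
   & (m <= K)%N /\ forall z, (u \in lev K S z) = (z < m)%N.
Proof.
move=> [K0 vK]; have [a0|a0] := posnP (att S u).
  by exists 0%N; rewrite ?a0 ?muln0 //; split=> // z; rewrite inE a0 muln0.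
have d0 : (0 < 2 * deg G u)%N by apply: leq_trans a0 (att_le _ _).
have /dvdnP[q qE] := vK u a0.
exists (q * att S u)%N; first by rewrite {1}qE mulnAC.
split=> [|z]; first by rewrite qE leq_mul2l att_le orbT.
by rewrite inE {1}qE mulnAC ltn_mul2r d0.
Qed.

Lemma card_lev K S u : valid K S ->
  (2 * deg G u * \sum_(0 <= z < K) (u \in lev K S z) = K * att S u)%N.
Proof.
move=> /(lev_ub u)[m -> [mK levE]]; rewrite mulnC; congr muln.
under eq_bigr do rewrite levE.
rewrite (big_cat_nat (leq0n m) mK) //= [X in (_ + X)%N]big_nat [X in (_ + X)%N]big1 ?addn0; last first.
  by move=> z /andP[mz _]; rewrite ltnNge mz.
rewrite big_nat (eq_bigr (fun=> 1%N)); last by move=> z /andP[_ ->].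
by rewrite -big_nat sum_nat_const_nat subn0 muln1.
Qed.

Lemma vol_gt0 S : (0 < vol G S)%N -> exists2 u, u \in S & (0 < deg G u)%N.
Proof.
rewrite lt0n sum_nat_eq0 negb_forall => /existsP[u].
by rewrite negb_imply -lt0n => /andP[? ?]; exists u.
Qed.

End Graph.

(** * Averages over the threshold *)

Section Steps.
Variables (R : realType) (n : nat) (G : sgraph n).
Implicit Types (S T U : {set 'I_n}) (u x y : 'I_n) (K t c : nat).

Local Notation d u := ((deg G u)%:R : R).
Local Notation mu S := ((vol G S)%:R : R).

(** The lazy walk operator. At an isolated vertex the quotient is 0, and the weight [d x] makes
    [deg_wstep] hold there too. *)
Definition wstep (F : 'I_n -> R) x : R :=
  F x / 2 + (\sum_(y | G x y) F y) / (2 * d x).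

Lemma deg_wstep F x : d x * wstep F x = (d x * F x + \sum_(y | G x y) F y) / 2.
Proof.
have [d0|d0] := eqVneq (deg G x) 0%N.
  rewrite d0 !mul0r add0r big_pred0 ?mul0r // => y.
  by apply/negP => /deg_gt0; rewrite d0.
rewrite /wstep; have ? : d x != 0 by rewrite pnatr_eq0.
by field.
Qed.

Lemma sum_lazy S (F : 'I_n -> R) :
  \sum_(x in S) d x * wstep F x = (\sum_y (att G S y)%:R * F y) / 2.
Proof.
rewrite (eq_bigr (fun x => (d x * F x + \sum_(y | G x y) F y) / 2)); last first.
  by move=> x _; apply: deg_wstep.
rewrite -mulr_suml big_split /=; congr (_ / 2).
under [RHS]eq_bigr do rewrite /att natrD mulrDl.
rewrite big_split /= addrC; congr (_ + _).
  rewrite (exchange_big_dep predT) //=; apply: eq_bigr => y _.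
  rewrite nbrE natr_sum mulr_suml [RHS]big_mkcond [LHS]big_mkcond /=.
  apply: eq_bigr => x _; rewrite edge_sym.
  by case: (x \in S); case: (G y x); rewrite ?mul1r ?mul0r.
rewrite big_mkcond /=; apply: eq_bigr => x _.
by case: (x \in S); rewrite ?mul1n ?mul0n ?mul0r.
Qed.

Lemma muE S : mu S = \sum_(u in S) d u.
Proof. by rewrite natr_sum. Qed.

(** The duality between evolving sets and the walk: averaging over [z] replaces membership in the
    next set by the probability [att / (2 * deg)]. *)
Lemma sum_lev K S (g : 'I_n -> R) : valid G K S ->
  \sum_(0 <= z < K) \sum_(u in lev G K S z) d u * g u
    = K%:R * (\sum_u (att G S u)%:R * g u) / 2.
Proof.
move=> vK.
under eq_bigr do rewrite big_mkcond /=.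
rewrite exchange_big /= -mulrA mulr_suml mulr_sumr; apply: eq_bigr => u _.
transitivity (d u * (\sum_(0 <= z < K) (u \in lev G K S z))%N%:R * g u).
  rewrite natr_sum mulr_sumr mulr_suml; apply: eq_bigr => z _.
  by case: (u \in _); rewrite ?mulr1 ?mulr0 ?mul0r.
rewrite !mulrA -(natrM R K) -(card_lev _ vK) !natrM.
by field.
Qed.

(** The volume is a martingale, so weighting by it defines a probability in [Ehat]. *)
Lemma sum_mu_lev K S : valid G K S ->
  \sum_(0 <= z < K) mu (lev G K S z) = K%:R * mu S.
Proof.
move=> vK; transitivity (\sum_(0 <= z < K) \sum_(u in lev G K S z) d u * 1).
  by apply: eq_bigr => z _; rewrite muE; apply: eq_bigr => u _; rewrite mulr1.
rewrite sum_lev // -mulrA; congr (_ * _).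
rewrite -sum_lazy muE; apply: eq_bigr => x _.
rewrite deg_wstep sumr_const.
have -> : #|[pred y | G x y]| = deg G x by rewrite /deg; apply: eq_card => y; rewrite !inE.
by field.
Qed.

Lemma bdE S : (boundary G S)%:R = \sum_(u in S) (d u - (nbr G u S)%:R) :> R.
Proof.
rewrite boundaryE natr_sum; apply: eq_bigr => u _.
by rewrite -(nbr_setC G u S) natrD addrAC subrr add0r.
Qed.

Lemma bdCE S : (boundary G S)%:R = \sum_(u in ~: S) (nbr G u S)%:R :> R.
Proof. by rewrite boundaryCE natr_sum. Qed.

(** On average the vertices that leave [S] and those that enter it each account for half of the
    boundary. *)
Lemma sum_sdiff_lev K S : valid G K S ->
  \sum_(0 <= z < K) mu (sdiff S (lev G K S z)) = K%:R * (boundary G S)%:R.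
Proof.
move=> vK.
have -> : K%:R * (boundary G S)%:R =
   \sum_(u in S) (d u *+ K - K%:R * (att G S u)%:R / 2) +
   \sum_(u in ~: S) K%:R * (att G S u)%:R / 2 :> R.
  transitivity (K%:R * (boundary G S)%:R / 2 + K%:R * (boundary G S)%:R / 2 : R).
    by field.
  congr (_ + _).
    rewrite bdE mulr_sumr mulr_suml; apply: eq_bigr => u uS.
    by rewrite att_in // natrD -mulr_natr; field.
  rewrite bdCE mulr_sumr mulr_suml; apply: eq_bigr => u; rewrite inE => uS.
  by rewrite att_notin.
have lvE u : K%:R * (att G S u)%:R / 2 = \sum_(0 <= z < K) (if u \in lev G K S z then d u else 0).
  rewrite -natrM -(card_lev _ vK) !natrM natr_sum.
  have E (a : R) : 2 * d u * a / 2 = d u * a by field.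
  by rewrite E mulr_sumr; apply: eq_bigr => z _; case: ifP; rewrite ?mulr1 ?mulr0.
rewrite (eq_bigr (fun z => \sum_(u in S) (d u - (if u \in lev G K S z then d u else 0)) +
   \sum_(u in ~: S) (if u \in lev G K S z then d u else 0))); last first.
  move=> z _; rewrite muE (bigID (mem S)) /=; congr (_ + _).
    rewrite big_mkcond [RHS]big_mkcond; apply: eq_bigr => u _ /=; rewrite !inE.
    by case: (u \in S); case: (_ < _)%N; rewrite /= ?subrr ?subr0.
  rewrite big_mkcond [RHS]big_mkcond; apply: eq_bigr => u _ /=; rewrite !inE.
  by case: (u \in S); case: (_ < _)%N.
rewrite big_split /= exchange_big /= [X in _ + X]exchange_big /=.
congr (_ + _); apply: eq_bigr => u _; last by rewrite lvE.
by rewrite lvE sumrB sumr_const_nat subn0.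
Qed.

Lemma sum_sqrt_le (I : nat) (F : nat -> R) : (forall i, 0 <= F i) -> (0 < I)%N ->
  \sum_(0 <= i < I) Num.sqrt (F i) <= I%:R * Num.sqrt ((\sum_(0 <= i < I) F i) / I%:R).
Proof.
move=> F0 I0; set a := (\sum_(_ <= _ < _) F _) / _.
have a0 : 0 <= a by rewrite divr_ge0 // sumr_ge0.
have I0' : 0 < I%:R :> R by rewrite ltr0n.
have aE : \sum_(0 <= i < I) F i = I%:R * a by rewrite /a; field; rewrite gt_eqF.
have [a_eq0|a_neq0] := eqVneq a 0.
  rewrite a_eq0 sqrtr0 mulr0 big1_seq // => i /andP[_ iI].
  move: aE; rewrite a_eq0 mulr0 => /eqP; rewrite psumr_eq0 // => /allP/(_ i iI)/=/eqP ->.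
  exact: sqrtr0.
have s0 : 0 < Num.sqrt a by rewrite sqrtr_gt0 lt_def a_neq0.
have le i : Num.sqrt (F i) <= (F i + a) / (2 * Num.sqrt a).
  rewrite ler_pdivlMr ?mulr_gt0 // -[X in X + _]sqr_sqrtr // -[X in _ + X]sqr_sqrtr //.
  by have := sqr_ge0 (Num.sqrt (F i) - Num.sqrt a); rewrite sqrrB; lra.
apply: le_trans (ler_sum _ (fun i _ => le i)) _.
rewrite -mulr_suml big_split /= sumr_const_nat subn0 aE -mulr_natl.
rewrite ler_pdivrMr ?mulr_gt0 // -mulrA mulrCA mulrA.
have := sqr_sqrtr a0; rewrite expr2 => E; rewrite -{1 2}E; lra.
Qed.

Lemma sqrt_half_sum (p : R) : 0 <= p <= 1 ->
  Num.sqrt (1 + p) + Num.sqrt (1 - p) <= 2 * (1 - p ^+ 2 / 8).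
Proof.
move=> /andP[p0 p1].
have p2 : p ^+ 2 <= 1 by rewrite expr2; nra.
rewrite -ler_sqr ?nnegrE ?addr_ge0 ?sqrtr_ge0 //; last by lra.
rewrite sqrrD !sqr_sqrtr; [|lra|lra].
rewrite -sqrtrM; last by lra.
have : Num.sqrt ((1 + p) * (1 - p)) <= 1 - p ^+ 2 / 2.
  rewrite -ler_sqr ?nnegrE ?sqrtr_ge0 //; last by lra.
  rewrite sqr_sqrtr; last by nra.
  have := sqr_ge0 (p ^+ 2); nra.
have := sqr_ge0 (p ^+ 2); nra.
Qed.

(** By laziness, the mean of the next volume is [(1 + p) * mu S] over thresholds below 1/2 and
    [(1 - p) * mu S] over the others, where [p] is the conductance. Jensen applies to each half, and
    [sqrt_half_sum] combines them. *)
Lemma sum_sqrt_lev K S : valid G K S -> (0 < vol G S)%N ->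
  \sum_(0 <= z < K) Num.sqrt (mu (lev G K S z)) <=
  K%:R * (1 - conductance R G S ^+ 2 / 8) * Num.sqrt (mu S).
Proof.
move=> vK vS; have [u0 u0S du0] := vol_gt0 vS.
have KE := valid_half vK u0S du0; set H := K./2 in KE.
have H0 : (0 < H)%N by move: (vK.1); rewrite KE double_gt0.
have HK : (H <= K)%N by rewrite KE -addnn leq_addr.
have mu0 : 0 < mu S by rewrite ltr0n.
have HR : 0 < H%:R :> R by rewrite ltr0n.
have KR : K%:R = 2 * H%:R :> R by rewrite KE -muln2 natrM mulrC.
have total : \sum_(0 <= z < H) mu (lev G K S z) + \sum_(H <= z < K) mu (lev G K S z) = K%:R * mu S.
  by rewrite -big_cat_nat //= sum_mu_lev.
(* In the lower half every vertex of [S] of positive degree stays. An outside vertex has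
   [att <= deg], so all the thresholds that select it lie in this half. *)
have low : \sum_(0 <= z < H) mu (lev G K S z) = H%:R * (mu S + (boundary G S)%:R).
  rewrite mulrDr bdCE muE !mulr_sumr.
  transitivity (\sum_(0 <= z < H) (\sum_(u in S) d u +
      \sum_(u in ~: S) (if u \in lev G K S z then d u else 0))).
    apply: eq_big_nat => z /andP[_ zH].
    rewrite muE (bigID (mem S)) /=; congr (_ + _).
      rewrite big_mkcond [RHS]big_mkcond; apply: eq_bigr => u _ /=.
      case uS: (u \in S); rewrite ?andbF //= andbT.
      rewrite inE att_in //; have [du|du] := posnP (deg G u); first by rewrite du if_same.
      by rewrite (_ : (_ < _)%N) // KE -muln2; nia.
    rewrite big_mkcond [RHS]big_mkcond; apply: eq_bigr => u _ /=; rewrite [u \in ~: S]finset.in_setC.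
    by case: (u \in S); rewrite ?andbF ?andbT.
  rewrite big_split /= sumr_const_nat subn0 -[X in X + _]mulr_natl mulr_sumr.
  congr (_ + _); rewrite exchange_big /=; apply: eq_bigr => u; rewrite inE => uS.
  have [m mE [mK levE]] := lev_ub u vK.
  have mH : (d u != 0) -> (m <= H)%N.
    rewrite pnatr_eq0 => du; have := nbr_le_deg G u S; rewrite att_notin // KE -muln2 in mE.
    have : (0 < deg G u)%N by rewrite lt0n.
    nia.
  have [d0|d0] := eqVneq (deg G u) 0%N.
    have := nbr_le_deg G u S; rewrite d0 leqn0 => /eqP ->.
    by rewrite mulr0 big1 // => z _; rewrite if_same.
  have {}mH : (m <= H)%N by apply: mH; rewrite pnatr_eq0.
  under eq_bigr do rewrite levE.
  rewrite (big_cat_nat (leq0n m) mH) //= [X in _ + X]big_nat [X in _ + X]big1 ?addr0; last first.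
    by move=> z /andP[mz _]; rewrite ltnNge mz.
  rewrite big_nat (eq_bigr (fun=> d u)); last by move=> z /andP[_ ->].
  rewrite -big_nat sumr_const_nat subn0 -[LHS]mulr_natl.
  move: mE; rewrite att_notin // KE -muln2 => mE.
  have : (m * deg G u = H * nbr G u S)%N by nia.
  by move=> /(congr1 (fun k => k%:R : R)); rewrite !natrM.
have high : \sum_(H <= z < K) mu (lev G K S z) = H%:R * (mu S - (boundary G S)%:R).
  by move: total; rewrite low KR; lra.
rewrite (big_cat_nat (leq0n H) HK) //=.
set p := conductance R G S.
have pE : (boundary G S)%:R = p * mu S by rewrite /p /conductance divfK // gt_eqF.
have p01 : 0 <= p <= 1.
  rewrite /p /conductance divr_ge0 //= ler_pdivrMr // mul1r ler_nat boundary_le_vol //.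
have A1 : \sum_(0 <= z < H) Num.sqrt (mu (lev G K S z)) <= H%:R * (Num.sqrt (1 + p) * Num.sqrt (mu S)).
  apply: le_trans (sum_sqrt_le (F := fun z => mu (lev G K S z)) _ H0) _ => //.
  rewrite low pE -sqrtrM; last by lra.
  by rewrite (_ : H%:R * (mu S + p * mu S) / H%:R = (1 + p) * mu S) //; field; rewrite gt_eqF.
have A2 : \sum_(H <= z < K) Num.sqrt (mu (lev G K S z)) <= H%:R * (Num.sqrt (1 - p) * Num.sqrt (mu S)).
  have KH : (K - H = H)%N by rewrite KE -addnn addnK.
  have shift (F : nat -> R) : \sum_(H <= z < K) F z = \sum_(0 <= i < H) F (i + H)%N.
    by have := big_addn 0 K H xpredT F; rewrite add0n KH.
  rewrite shift.
  apply: le_trans (sum_sqrt_le (F := fun z => mu (lev G K S (z + H))) _ H0) _ => //.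
  rewrite -(shift (fun z => mu (lev G K S z))) high pE -sqrtrM; last by lra.
  by rewrite (_ : H%:R * (mu S - p * mu S) / H%:R = (1 - p) * mu S) //; field; rewrite gt_eqF.
apply: le_trans (lerD A1 A2) _; rewrite -mulrDr -mulrDl KR.
have := sqrt_half_sum p01; have := sqrtr_ge0 (mu S); set sm := Num.sqrt (mu S) => sm0 hs.
have -> : 2 * H%:R * (1 - p ^+ 2 / 8) * sm = H%:R * (2 * (1 - p ^+ 2 / 8) * sm) by ring.
by rewrite ler_wpM2l ?ler0n // ler_wpM2r.
Qed.

End Steps.

(** * The volume-biased process and its potential *)

Section Process.
Variables (R : realType) (n : nat) (G : sgraph n).
Implicit Types (S T U : {set 'I_n}) (u x y : 'I_n) (K t c : nat).

Local Notation d u := ((deg G u)%:R : R).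
Local Notation mu S := ((vol G S)%:R : R).
Local Notation bd S := ((boundary G S)%:R : R).
Local Notation cond := (conductance R G).

(** One step of the evolving set process after the Doob transform by the volume; sets of volume 0
    have weight 0. *)
Definition Ehat K S (f : {set 'I_n} -> R) : R :=
  (\sum_(0 <= z < K) mu (lev G K S z) / mu S * f (lev G K S z)) / K%:R.

Section OneStep.
Variables (K : nat) (S : {set 'I_n}).
Hypotheses (vK : valid G K S) (vS : (0 < vol G S)%N).

Let K0 : 0 < K%:R :> R. Proof. by rewrite ltr0n vK.1. Qed.
Let mu0 : 0 < mu S. Proof. by rewrite ltr0n. Qed.

Lemma Ehat_lin (a b : R) f g :
  Ehat K S (fun T => a * f T + b * g T) = a * Ehat K S f + b * Ehat K S g.
Proof.
rewrite /Ehat !mulrA -mulrDl; congr (_ / _).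
by rewrite !mulr_sumr -big_split /=; apply: eq_bigr => z _; ring.
Qed.

Lemma Ehat_cst (a : R) : Ehat K S (fun=> a) = a.
Proof.
rewrite /Ehat -mulr_suml -mulr_suml sum_mu_lev //.
by field; rewrite !gt_eqF.
Qed.

Lemma Ehat_le f g :
  (forall z, (0 < vol G (lev G K S z))%N -> f (lev G K S z) <= g (lev G K S z)) ->
  Ehat K S f <= Ehat K S g.
Proof.
move=> fg; rewrite /Ehat ler_wpM2r ?invr_ge0 // ler_sum // => z _.
have [->|v0] := posnP (vol G (lev G K S z)); first by rewrite !mul0r.
by rewrite ler_wpM2l ?divr_ge0 // fg.
Qed.

Lemma eq_Ehat f g :
  (forall z, (0 < vol G (lev G K S z))%N -> f (lev G K S z) = g (lev G K S z)) ->
  Ehat K S f = Ehat K S g.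
Proof. by move=> fg; apply/le_anti; rewrite !Ehat_le // => z /fg ->. Qed.

Lemma cond_bd : bd S = cond S * mu S.
Proof. by rewrite /conductance divfK // gt_eqF. Qed.

Lemma Ehat_sdiff : Ehat K S (fun T => mu (sdiff S T) / mu T) <= cond S.
Proof.
rewrite ler_pdivrMr //.
apply: (@le_trans _ _ ((\sum_(0 <= z < K) mu (sdiff S (lev G K S z))) / mu S)).
  rewrite mulr_suml ler_sum // => z _.
  have [->|v0] := posnP (vol G (lev G K S z)); first by rewrite !mul0r divr_ge0.
  have m0 : 0 < mu (lev G K S z) by rewrite ltr0n.
  by rewrite le_eqVlt; apply/orP; left; apply/eqP; field; rewrite !gt_eqF.
by rewrite sum_sdiff_lev // cond_bd mulrA mulfK ?gt_eqF // mulrC.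
Qed.

(** The weight cancels the inverse volume; the bound is strict when some threshold yields a set of
    volume 0. *)
Lemma Ehat_inv : Ehat K S (fun T => (mu T)^-1) <= (mu S)^-1.
Proof.
rewrite ler_pdivrMr //.
apply: (@le_trans _ _ (\sum_(0 <= z < K) (mu S)^-1)); last first.
  by rewrite sumr_const_nat subn0 mulr_natr.
apply: ler_sum => z _.
have [->|v0] := posnP (vol G (lev G K S z)); first by rewrite !mul0r invr_ge0.
by rewrite mulrAC mulfV ?mul1r // gt_eqF // ltr0n.
Qed.

Lemma Ehat_sqrt (a : R) : 0 <= a -> Ehat K S (fun T => Num.sqrt (a / mu T)) <=
  (1 - cond S ^+ 2 / 8) * Num.sqrt (a / mu S).
Proof.
move=> a0; rewrite ler_pdivrMr //.
have sE T : mu T / mu S * Num.sqrt (a / mu T) = Num.sqrt (mu T) * (Num.sqrt a / mu S).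
  have [->|v0] := posnP (vol G T); first by rewrite sqrtr0 !mul0r.
  have m0 : 0 < mu T by rewrite ltr0n.
  rewrite sqrtrM // sqrtrV ?ltW // -{1}[mu T]sqr_sqrtr ?ltW //.
  by field; rewrite !gt_eqF // sqrtr_gt0.
under eq_bigr do rewrite sE.
have c0 : 0 <= Num.sqrt a / mu S by rewrite divr_ge0 ?sqrtr_ge0 // ltW.
rewrite -mulr_suml; apply: le_trans (ler_wpM2r c0 (@sum_sqrt_lev R n G K S vK vS)) _.
have -> : Num.sqrt (a / mu S) = Num.sqrt (mu S) * (Num.sqrt a / mu S).
  rewrite sqrtrM // sqrtrV ?ltW //; have := sqr_sqrtr (ltW mu0).
  have s0 : 0 < Num.sqrt (mu S) by rewrite sqrtr_gt0.
  by set s := Num.sqrt (mu S) in s0 * => <-; field; rewrite gt_eqF.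
rewrite le_eqVlt; apply/orP; left; apply/eqP; ring.
Qed.

Lemma Ehat_weight (g : 'I_n -> R) :
  Ehat K S (fun T => (\sum_(u in T) d u * g u) / mu T) =
  (\sum_(x in S) d x * wstep G g x) / mu S.
Proof.
rewrite /Ehat sum_lazy.
transitivity ((\sum_(0 <= z < K) \sum_(u in lev G K S z) d u * g u) / mu S / K%:R).
  congr (_ / _); rewrite mulr_suml; apply: eq_bigr => z _.
  have [v0|v0] := posnP (vol G (lev G K S z)).
    rewrite v0 !mul0r big1 ?mul0r // => u uT.
    have : vol G (lev G K S z) == 0%N by rewrite v0.
    by rewrite sum_nat_eq0 => /forallP/(_ u)/implyP/(_ uT)/eqP ->; rewrite mul0r.
  have m0 : 0 < mu (lev G K S z) by rewrite ltr0n.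
  by field; rewrite !gt_eqF.
by rewrite sum_lev //; field; rewrite !gt_eqF.
Qed.

End OneStep.

(** The logarithm [2 + 2 * ln v], continued below 1 by its tangent [2 * v]: it stays concave, and
    nonnegative when the volume jumps above [capA]. *)
Definition logpot (v : R) : R := if 1 <= v then 2 + 2 * ln v else 2 * v.

Lemma ln_le_sub1 (x : R) : 0 < x -> ln x <= x - 1.
Proof.
by move=> x0; have := @le_ln1Dx R (x - 1); rewrite addrCA subrr addr0; apply; lra.
Qed.

Lemma logpot_tangent (v v' : R) : 1 <= v -> 0 <= v' ->
  logpot v' <= logpot v + 2 * (v' / v - 1).
Proof.
move=> v1 v'0; have v0 : 0 < v by lra.
rewrite /logpot v1; case: ifPn => [v'1|].
  have : ln (v' / v) <= v' / v - 1 by apply: ln_le_sub1; rewrite divr_gt0 //; lra.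
  by rewrite ln_div ?posrE //; lra.
rewrite -ltNge => v'1.
have : ln (v^-1) <= v^-1 - 1 by apply: ln_le_sub1; rewrite invr_gt0.
rewrite lnV ?posrE // => h.
have : v^-1 <= 1 by rewrite invf_le1.
have : 0 < v^-1 by rewrite invr_gt0.
move: h; set i := v^-1; nra.
Qed.

Lemma logpot_ge0 v : 0 <= v -> 0 <= logpot v.
Proof.
rewrite /logpot; case: ifP => [v1 _|_ ?]; last by rewrite mulr_ge0.
by have := ln_ge0 v1; lra.
Qed.

(** For [mu S <= capA] this is [2 + ln (capA / mu S)]. The square root is there because [Ehat_sqrt]
    is the available contraction. *)
Definition psi (capA : R) S := logpot (Num.sqrt (capA / mu S)).

Lemma psi_ge0 capA S : 0 <= psi capA S.
Proof. by rewrite logpot_ge0 ?sqrtr_ge0. Qed.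

(** The tangent of [logpot] at the current value turns the contraction factor [1 - cond S ^+ 2 / 8]
    into an additive drop. *)
Lemma Ehat_psi capA K S : valid G K S -> (0 < vol G S)%N -> mu S <= capA ->
  Ehat K S (psi capA) <= psi capA S - cond S ^+ 2 / 4.
Proof.
move=> vK vS le_cap; have mu0 : 0 < mu S by rewrite ltr0n.
have cap0 : 0 <= capA by apply: le_trans le_cap.
set v := Num.sqrt (capA / mu S).
have v1 : 1 <= v by rewrite -[1]sqrtr1 ler_wsqrtr // ler_pdivlMr // mul1r.
apply: (@le_trans _ _ (Ehat K S (fun T => (psi capA S - 2) * 1 + (2 / v) * Num.sqrt (capA / mu T)))).
  apply: Ehat_le => // z _; have := logpot_tangent v1 (sqrtr_ge0 (capA / mu (lev G K S z))).
  rewrite -/(psi capA S) -/(psi _ _); lra.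
rewrite Ehat_lin // Ehat_cst //.
have := Ehat_sqrt vK vS cap0; rewrite -/v => h.
have : 2 / v * Ehat K S (fun T => Num.sqrt (capA / mu T)) <= 2 / v * ((1 - cond S ^+ 2 / 8) * v).
  by rewrite ler_wpM2l // divr_ge0 //; lra.
have -> : 2 / v * ((1 - cond S ^+ 2 / 8) * v) = 2 * (1 - cond S ^+ 2 / 8).
  by field; lra.
lra.
Qed.

Variable stop : {set 'I_n} -> bool.
Hypothesis stop_bd0 : forall S, boundary G S = 0%N -> stop S.

Definition newcost S T c : nat := (c + boundary G S + vol G (sdiff S T))%N.

(* [r] is the reward on stopping and [r0] the reward when [t] steps have been
   made without stopping; the second argument of both is the cost. *)
Fixpoint vbar (r r0 : {set 'I_n} -> nat -> R) t S c K : R :=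
  if stop S then r S c else
  if t is t'.+1 then
    Ehat K S (fun T => vbar r r0 t' T (newcost S T c) (K * touch G S T)%N)
  else r0 S c.

(** The number of [z] whose level set contains [y]; [z] uniform below it plays the role of a
    threshold uniform in [[0, Q(y, S)]]. *)
Definition thresholds K S y : nat := (K * att G S y %/ (2 * deg G y))%N.

Definition pair_step K S (f : {set 'I_n} -> 'I_n -> R) : 'I_n -> R :=
  wstep G (fun y => (\sum_(0 <= z < thresholds K S y) f (lev G K S z) y)
                      / (thresholds K S y)%:R).

(* The coupled process, where [x] is the position of the walk; [vbar] is its average
   over [x] distributed in [S] according to the degrees. *)
Fixpoint vpair (r r0 : {set 'I_n} -> nat -> R) t S x c K : R :=
  if stop S then r S c else
  if t is t'.+1 then
    pair_step K S (fun T y => vpair r r0 t' T y (newcost S T c) (K * touch G S T)%N) x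
  else r0 S c.

(** The number of thresholds available to [y] is proportional to the probability of reaching [y],
    and the two cancel: every pair of [z] and [y] in its level set has weight [d y / K]. The
    position thus stays distributed by degree in the current set. *)
Lemma pair_step_avg K S f : valid G K S -> (0 < vol G S)%N ->
  \sum_(x in S) d x * pair_step K S f x =
  (\sum_(0 <= z < K) \sum_(y in lev G K S z) d y * f (lev G K S z) y) / K%:R.
Proof.
move=> vK vS; rewrite sum_lazy.
have K0 : 0 < K%:R :> R by rewrite ltr0n vK.1.
under [in RHS]eq_bigr do rewrite big_mkcond /=.
rewrite exchange_big /= !mulr_suml; apply: eq_bigr => y _.
have [m mE [mK levE]] := lev_ub y vK.
have [a0|a0] := posnP (att G S y).
  rewrite a0 !mul0r big1 ?mul0r // => z _.
  by case: ifPn => // /lev_att; rewrite a0.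
have d0 : (0 < deg G y)%N by have := att_le G S y; lia.
have tE : thresholds K S y = m by rewrite /thresholds mE mulnK // muln_gt0.
have m0 : (0 < m)%N by have := vK.1; nia.
rewrite tE (big_cat_nat (leq0n m) mK) //=.
rewrite [X in _ = (_ + X) / _]big_nat [X in _ = (_ + X) / _]big1 ?addr0; last first.
  by move=> z /andP[mz _]; rewrite levE ltnNge mz.
have -> : \sum_(0 <= z < m) (if y \in lev G K S z then d y * f (lev G K S z) y else 0) =
   d y * \sum_(0 <= z < m) f (lev G K S z) y.
  by rewrite mulr_sumr; apply: eq_big_nat => z /andP[_ zm]; rewrite levE zm.
have : K%:R * (att G S y)%:R = m%:R * (2 * d y) by rewrite -!natrM mE.
have mR : m%:R != 0 :> R by rewrite pnatr_eq0 -lt0n.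
move=> E; set s := \sum_(_ <= _ < _) _.
have -> : (att G S y)%:R = m%:R * (2 * d y) / K%:R by rewrite -E; field; rewrite gt_eqF.
by field; rewrite mR gt_eqF.
Qed.

Lemma vpair_vbar r r0 t S c K : valid G K S -> (0 < vol G S)%N ->
  \sum_(x in S) d x * vpair r r0 t S x c K = mu S * vbar r r0 t S c K.
Proof.
elim: t S c K => [|t IH] S c K vK vS /=.
  by case: ifP => _; rewrite -mulr_suml -muE.
case: ifP => _; first by rewrite -mulr_suml -muE.
rewrite pair_step_avg // /Ehat mulrA mulr_sumr; congr (_ / _).
apply: eq_bigr => z _.
have [v0|v0] := posnP (vol G (lev G K S z)); last first.
  rewrite IH; [|exact: valid_lev|by []].
  by field; rewrite gt_eqF // ltr0n.
rewrite v0 !mul0r mulr0 big1 // => u uT.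
have : vol G (lev G K S z) == 0%N by rewrite v0.
by rewrite sum_nat_eq0 => /forallP/(_ u)/implyP/(_ uT)/eqP ->; rewrite mul0r.
Qed.

Lemma vpair1 r r0 t v c K : valid G K [set v] -> (0 < deg G v)%N ->
  vpair r r0 t [set v] v c K = vbar r r0 t [set v] c K.
Proof.
move=> vK dv.
have volE : vol G [set v] = deg G v by rewrite /vol big_set1.
have := @vpair_vbar r r0 t [set v] c K vK; rewrite volE => /(_ dv).
by rewrite big_set1 => /mulfI; apply; rewrite pnatr_eq0 -lt0n.
Qed.

Lemma vbar_affine (a b : R) r r0 t S c K : valid G K S -> (0 < vol G S)%N ->
  vbar (fun S c => a * r S c + b) (fun S c => a * r0 S c + b) t S c K
    = a * vbar r r0 t S c K + b.
Proof.
elim: t S c K => [|t IH] S c K vK vS /=; first by case: ifP.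
case: ifP => // _.
set F := fun T => vbar r r0 t T _ _.
transitivity (a * Ehat K S F + b * Ehat K S (fun=> 1)); last by rewrite Ehat_cst // mulr1.
rewrite -Ehat_lin; apply: eq_Ehat => z v0.
by rewrite IH // ?mulr1 //; apply: valid_lev.
Qed.

Lemma vbar_sum (I : finType) (r r0 : I -> {set 'I_n} -> nat -> R) t S c K :
  vbar (fun S c => \sum_i r i S c) (fun S c => \sum_i r0 i S c) t S c K
    = \sum_i vbar (r i) (r0 i) t S c K.
Proof.
elim: t S c K => [|t IH] S c K /=; first by case: ifP.
case: ifP => // _; rewrite /Ehat -mulr_suml; congr (_ / _).
rewrite exchange_big /=; apply: eq_bigr => z _.
by rewrite -mulr_sumr IH.
Qed.

Lemma vbar_le r r0 r' r0' t S c K : valid G K S -> (0 < vol G S)%N ->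
  (forall S c, (0 < vol G S)%N -> stop S -> r S c <= r' S c) ->
  (forall S c, (0 < vol G S)%N -> ~~ stop S -> r0 S c <= r0' S c) ->
  vbar r r0 t S c K <= vbar r' r0' t S c K.
Proof.
move=> + + rr' rr0'; elim: t S c K => [|t IH] S c K vK vS /=.
  by case: ifPn => ?; [exact: rr'|exact: rr0'].
case: ifPn => [?|_]; first exact: rr'.
by apply: Ehat_le => // z v0; apply: IH => //; apply: valid_lev.
Qed.

Lemma vbar_fuel r t t' S c K : (forall S c, 0 <= r S c) -> (t <= t')%N ->
  valid G K S -> (0 < vol G S)%N ->
  vbar r (fun _ _ => 0) t S c K <= vbar r (fun _ _ => 0) t' S c K.
Proof.
move=> r_ge0.
have v0 m T b L : 0 <= vbar r (fun _ _ => 0) m T b L.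
  elim: m T b L => [|m IHm] T b L /=; case: ifP => //.
  by rewrite /Ehat divr_ge0 // sumr_ge0 // => z _; rewrite mulr_ge0 ?divr_ge0.
elim: t t' S c K => [|t IH] [|t'] S c K //= le_t vK vS; case: ifP => // _.
  by rewrite /Ehat divr_ge0 // sumr_ge0 // => z _; rewrite mulr_ge0 ?divr_ge0 // v0.
by apply: Ehat_le => // z vz; apply: IH => //; apply: valid_lev.
Qed.

End Process.

(** * The walk killed outside a set *)

Section Stay.
Variables (R : realType) (n : nat) (G : sgraph n) (U : {set 'I_n}).
Implicit Types (A : {set 'I_n}) (u x y : 'I_n) (f g : 'I_n -> R).

Local Notation d u := ((deg G u)%:R : R).
Local Notation mu S := ((vol G S)%:R : R).
Local Notation bd S := ((boundary G S)%:R : R).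

Definition dot f g : R := \sum_u d u * f u * g u.

Definition indic A : 'I_n -> R := fun u => (u \in A)%:R.

Definition killed f : 'I_n -> R := fun x => if x \in U then wstep G f x else 0.

Lemma dot_wstep f g : dot f (wstep G g) = dot (wstep G f) g.
Proof.
have E f' g' : dot f' (wstep G g') =
    (\sum_u d u * f' u * g' u + \sum_u \sum_(y | G u y) f' u * g' y) / 2.
  rewrite -big_split mulr_suml; apply: eq_bigr => u _ /=.
  by rewrite mulrAC deg_wstep -mulr_sumr; field.
rewrite E; have -> : dot (wstep G f) g = dot g (wstep G f).
  by apply: eq_bigr => u _; ring.
rewrite E; congr ((_ + _) / _); first by apply: eq_bigr => u _; ring.
rewrite (exchange_big_dep predT) //=; apply: eq_bigr => u _.
by apply: eq_big => [y|y _]; [exact: edge_sym|rewrite mulrC].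
Qed.

Definition supported f := forall u, u \notin U -> f u = 0.

Lemma killed_supported f : supported (killed f).
Proof. by move=> u /negbTE uU; rewrite /killed uU. Qed.

Lemma iter_supported t f : supported f -> supported (iter t killed f).
Proof. by case: t => // t _; apply: killed_supported. Qed.

Lemma dot_killed f g : supported f -> supported g ->
  dot f (killed g) = dot (killed f) g.
Proof.
move=> sf sg; transitivity (dot f (wstep G g)).
  apply: eq_bigr => u _; rewrite /killed; case: ifPn => // uU.
  by rewrite sf // !(mulr0, mul0r).
rewrite dot_wstep; apply: eq_bigr => u _; rewrite /killed; case: ifPn => // uU.
by rewrite sg // !(mulr0, mul0r).
Qed.

Lemma dot_iter t f g : supported f -> supported g ->
  dot f (iter t killed g) = dot (iter t killed f) g.
Proof.
elim: t f g => // t IH f g sf sg.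
rewrite [in LHS]iterS dot_killed; [|by []|exact: iter_supported].
by rewrite IH; [rewrite -iterSr|exact: killed_supported|].
Qed.

Lemma dot_cauchy f g : dot f g ^+ 2 <= dot f f * dot g g.
Proof.
have dd0 h : 0 <= dot h h by apply: sumr_ge0 => u _; rewrite -mulrA mulr_ge0 // -expr2 sqr_ge0.
have quad a b : 0 <= a ^+ 2 * dot f f - 2 * a * b * dot f g + b ^+ 2 * dot g g.
  have <- : dot (fun u => a * f u - b * g u) (fun u => a * f u - b * g u) =
     a ^+ 2 * dot f f - 2 * a * b * dot f g + b ^+ 2 * dot g g.
    rewrite /dot !mulr_sumr -sumrB -big_split /=.
    by apply: eq_bigr => u _; ring.
  exact: dd0.
have := quad (dot g g) (dot f g); have := dd0 g; have := dd0 f.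
set p := dot f f; set q := dot g g; set s := dot f g => p0 q0.
have [q_eq0|q_neq0] := eqVneq q 0.
  have [-> _|s0] := eqVneq s 0; first by rewrite expr0n /= q_eq0 mulr0.
  (* With [q = 0] and [s != 0] the form is linear in its second argument; this argument gives it the
     value -1. *)
  have := quad 1 ((p + 1) / (2 * s)); rewrite -/p -/q -/s q_eq0.
  have -> : 2 * 1 * ((p + 1) / (2 * s)) * s = p + 1 by field.
  by lra.
have q_gt0 : 0 < q by rewrite lt_def q_neq0.
move=> h; have {h} : 0 <= q * (p * q - s ^+ 2) by move: h; rewrite !expr2; lra.
by rewrite pmulr_rge0 // subr_ge0.
Qed.

Lemma wstep_le f g u : (forall v, f v <= g v) -> wstep G f u <= wstep G g u.
Proof.
move=> fg; rewrite /wstep lerD ?ler_wpM2r ?invr_ge0 ?mulr_ge0 //.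
by apply: ler_sum => y _.
Qed.

Lemma killed_le f g : (forall u, f u <= g u) -> forall u, killed f u <= killed g u.
Proof.
by move=> fg u; rewrite /killed; case: ifP => // _; apply: wstep_le.
Qed.

Lemma iter_killed_le t f g : (forall u, f u <= g u) ->
  forall u, iter t killed f u <= iter t killed g u.
Proof. by move=> fg; elim: t => //= t IH; apply: killed_le. Qed.

Lemma iter_killed_ge0 t f : (forall u, 0 <= f u) -> forall u, 0 <= iter t killed f u.
Proof.
move=> f0; elim: t => //= t IH u; rewrite /killed; case: ifP => // _.
by rewrite addr_ge0 ?divr_ge0 ?mulr_ge0 ?sumr_ge0.
Qed.

Definition stay t := iter t killed (indic U).

Lemma stay_notin t u : u \notin U -> stay t u = 0.
Proof.
move=> uU; apply: (@iter_supported t (indic U) _ u uU) => v /negbTE vU.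
by rewrite /indic vU.
Qed.

Lemma stay_ge0 t u : 0 <= stay t u.
Proof. by apply: iter_killed_ge0 => v; rewrite ler0n. Qed.

Lemma wstep1_le u : wstep G (fun=> 1) u <= 1 :> R.
Proof.
rewrite /wstep sumr_const.
have -> : #|[pred y | G u y]| = deg G u by rewrite /deg; apply: eq_card => y; rewrite !inE.
have [->|d0] := posnP (deg G u); first by rewrite mul0r; lra.
have ? : d u != 0 by rewrite pnatr_eq0 -lt0n.
by rewrite le_eqVlt; apply/orP; left; apply/eqP; field.
Qed.

Lemma stay_le1 t u : stay t u <= 1.
Proof.
elim: t u => [|t IH] u; first by rewrite /stay /= /indic; case: (_ \in _).
rewrite /stay iterS /killed; case: ifP => // _; apply: le_trans (wstep1_le u).
exact: wstep_le.
Qed.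

Lemma dot_indic A f : dot (indic A) f = \sum_(u in A) d u * f u.
Proof.
rewrite [RHS]big_mkcond; apply: eq_bigr => u _; rewrite /indic.
by case: (u \in A); rewrite ?mulr1 ?mulr0 ?mul0r.
Qed.

Lemma stay_dec t u : stay t.+1 u <= stay t u.
Proof.
elim: t u => [|t IH] u; last by rewrite /stay iterS; apply: killed_le.
have [uU|uU] := boolP (u \in U); last by rewrite !stay_notin.
by apply: le_trans (stay_le1 1 u) _; rewrite /stay /= /indic uU.
Qed.

Lemma indic_supported A : A \subset U -> supported (indic A).
Proof.
by move=> /fintype.subsetP AU u uU; rewrite /indic; case: (boolP (u \in A)) => // /AU; rewrite (negbTE uU).
Qed.

(** With weights [d u], each boundary edge is crossed outwards at rate 1/2. *)
Lemma escape1 : \sum_(u in U) d u * stay 1 u = mu U - bd U / 2.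
Proof.
rewrite muE bdE mulr_suml -sumrB; apply: eq_bigr => u uU.
rewrite /stay /= /killed uU deg_wstep /indic uU mulr1.
have -> : \sum_(y | G u y) (y \in U)%:R = (nbr G u U)%:R :> R.
  rewrite nbrE natr_sum big_mkcond [RHS]big_mkcond; apply: eq_bigr => y _.
  by case: (G u y); case: (y \in U).
by field.
Qed.

(** Self-adjointness writes the loss at each step as the product of [stay t] with the loss of the
    first step; since [stay t <= 1], no step loses more than the first one. *)
Lemma escape t : mu U - t%:R * (bd U / 2) <= \sum_(u in U) d u * stay t u.
Proof.
elim: t => [|t IH].
  rewrite mul0r subr0 muE ler_sum // => u uU.
  by rewrite /stay /= /indic uU mulr1.
suff: \sum_(u in U) d u * stay t u - \sum_(u in U) d u * stay t.+1 u <= bd U / 2.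
  have -> : t.+1%:R = t%:R + 1 :> R by rewrite natr1.
  by move: IH; rewrite mulrDl mul1r; lra.
have sU : supported (indic U) by apply: indic_supported.
have -> : \sum_(u in U) d u * stay t u = dot (indic U) (stay t).
  by rewrite dot_indic.
have -> : \sum_(u in U) d u * stay t.+1 u = dot (stay t) (stay 1).
  rewrite -dot_indic /stay -[RHS]dot_iter //; last exact: killed_supported.
  by rewrite iterSr.
have -> : dot (indic U) (stay t) = dot (stay t) (indic U) by apply: eq_bigr => u _; ring.
have -> : dot (stay t) (indic U) - dot (stay t) (stay 1) = \sum_u d u * stay t u * (indic U u - stay 1 u).
  by rewrite /dot -sumrB; apply: eq_bigr => u _; rewrite mulrBr.
have -> : bd U / 2 = \sum_u d u * 1 * (indic U u - stay 1 u).
  under eq_bigr do rewrite mulr1 mulrBr.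
  rewrite sumrB.
  have -> : \sum_u d u * indic U u = mu U.
    rewrite muE [RHS]big_mkcond; apply: eq_bigr => u _; rewrite /indic.
    by case: (u \in U); rewrite ?mulr1 ?mulr0.
  have -> : \sum_u d u * stay 1 u = \sum_(u in U) d u * stay 1 u.
    rewrite [RHS]big_mkcond; apply: eq_bigr => u _; case: ifPn => // uU.
    by rewrite stay_notin ?mulr0.
  by rewrite escape1; lra.
apply: ler_sum => u _; rewrite ler_wpM2r ?subr_ge0 ?(stay_dec 0) //.
by rewrite ler_wpM2l // stay_le1.
Qed.

(** Split time [2t] into two halves by self-adjointness, then apply Cauchy-Schwarz. *)
Lemma moment_double A t : A \subset U ->
  dot (indic A) (iter t killed (indic A)) ^+ 2 <=
    mu A * dot (indic A) (iter t.*2 killed (indic A)).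
Proof.
move=> AU; have sA := indic_supported AU.
rewrite -addnn iterD [X in _ * X](dot_iter _ sA (iter_supported _ sA)).
have -> : mu A = dot (indic A) (indic A).
  by rewrite dot_indic muE; apply: eq_bigr => u uA; rewrite /indic uA mulr1.
exact: dot_cauchy.
Qed.

(** Returning to [A], rather than staying in [U], is the event whose probability can be squared
    repeatedly. Linear escape gives the share 1/8 at time [2a], and [moment_double] does the
    rest. *)
Lemma stay_sum A a j : A \subset U -> mu U <= 2 * mu A -> (0 < vol G A)%N ->
  2 * (a.*2)%:R * bd U <= mu U ->
  (8^-1) ^+ (2 ^ j) * mu A <= \sum_(u in A) d u * stay (a.*2 * 2 ^ j) u.
Proof.
move=> AU le2 A0 le_bd; have sA := indic_supported AU.
have sU : supported (indic U) by apply: indic_supported.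
have muA : 0 < mu A by rewrite ltr0n.
pose m t := dot (indic A) (iter t killed (indic A)).
have m0 t : 0 <= m t.
  apply: sumr_ge0 => u _; rewrite mulr_ge0 ?mulr_ge0 ?ler0n //.
  by apply: iter_killed_ge0 => v; rewrite ler0n.
apply: (@le_trans _ _ (m (a.*2 * 2 ^ j)%N)); last first.
  rewrite /m dot_indic ler_sum // => u uA; rewrite ler_wpM2l //.
  apply: iter_killed_le => v; rewrite /indic ler_nat.
  by case: (boolP (v \in A)) => // /(fintype.subsetP AU) ->.
have base : 8^-1 * mu A <= m a.*2.
  (* Up to time [2a] the set [U] loses at most a quarter of its volume, that is at most half of the
     volume of [A]. *)
  have low : mu A / 2 <= dot (indic A) (stay a.*2).
    have := escape a.*2; rewrite dot_indic.
    have : \sum_(u in U) d u * stay a.*2 u <= \sum_(u in A) d u * stay a.*2 u + (mu U - mu A).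
      rewrite (bigID (mem A)) /=; apply: lerD.
        rewrite le_eqVlt; apply/orP; left; apply/eqP; apply: eq_bigl => u.
        by rewrite andbC; case: (boolP (u \in A)) => // /(fintype.subsetP AU) ->.
      rewrite !muE [X in _ <= X - _](bigID (mem A)) /=.
      have -> : \sum_(i in U | i \in A) d i = \sum_(i in A) d i.
        by apply: eq_bigl => u; rewrite andbC; case: (boolP (u \in A)) => // /(fintype.subsetP AU) ->.
      rewrite addrAC subrr add0r; apply: ler_sum => u _.
      by rewrite -{2}[d u]mulr1 ler_wpM2l ?stay_le1.
    by lra.
  (* The even time [2a] is split in the middle: this converts ending in [U] into ending in [A], at
     the price of a square. *)
  have cs : dot (indic A) (stay a.*2) ^+ 2 <= m a.*2 * mu U.
    rewrite {1}/stay /m -!addnn !iterD (dot_iter _ sA (iter_supported _ sU)).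
    rewrite (dot_iter _ sA (iter_supported _ sA)).
    apply: le_trans (dot_cauchy _ _) _; rewrite ler_wpM2l //.
      apply: sumr_ge0 => u _; rewrite -mulrA mulr_ge0 // -expr2 sqr_ge0 //.
    rewrite -(dot_iter a sU (iter_supported a sU)) -iterD dot_indic muE ler_sum // => u _.
    by rewrite -{2}[d u]mulr1 ler_wpM2l ?stay_le1.
  have : (mu A / 2) ^+ 2 <= m a.*2 * (2 * mu A).
    apply: le_trans (_ : dot (indic A) (stay a.*2) ^+ 2 <= _).
      by rewrite ler_sqr ?nnegrE ?divr_ge0 //; apply: le_trans low; lra.
    by apply: le_trans cs _; rewrite ler_wpM2l.
  rewrite expr2 => h; rewrite -(ler_pM2r muA); lra.
elim: j => [|j IH]; first by rewrite expn0 expr1 muln1.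
have := moment_double (a.*2 * 2 ^ j) AU; rewrite -/(m _) -/(m _) => h.
have -> : (a.*2 * 2 ^ j.+1 = (a.*2 * 2 ^ j).*2)%N by rewrite expnS mulnCA mul2n.
rewrite -(ler_pM2l muA); apply: le_trans h.
have -> : mu A * (8^-1 ^+ (2 ^ j.+1) * mu A) = (8^-1 ^+ (2 ^ j) * mu A) ^+ 2.
  by rewrite expnS mul2n -addnn exprD; ring.
by rewrite ler_sqr ?nnegrE // mulr_ge0 // exprn_ge0.
Qed.

Definition core t (p : R) : {set 'I_n} := [set u in U | p <= stay t u].

(** Otherwise the rest of [U] has at least half of the volume, and [stay_sum] gives it an average
    survival that each of its vertices falls short of. *)
Lemma vol_core a j : 2 * (a.*2)%:R * bd U <= mu U ->
  mu U / 2 <= mu (core (a.*2 * 2 ^ j) (8^-1 ^+ (2 ^ j))).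
Proof.
set U' := core _ _ => le_bd; rewrite leNgt; apply/negP => lt.
pose A := U :\: U'.
have AU : A \subset U by apply: finset.subsetDl.
have U'U : U' \subset U by apply/fintype.subsetP => u; rewrite inE => /andP[].
have muD : mu U = mu U' + mu A.
  rewrite !muE [LHS](bigID (mem U')) /=; congr (_ + _); apply: eq_bigl => u.
    by rewrite andbC; case: (boolP (u \in U')) => // /(fintype.subsetP U'U) ->.
  by rewrite [u \in A]finset.in_setD andbC.
have A0 : (0 < vol G A)%N by rewrite -(ltr0n R); have := ler0n R (vol G U'); lra.
have leA : mu U <= 2 * mu A by lra.
have := stay_sum j AU leA A0 le_bd; rewrite leNgt => /negP; apply.
have [u0 u0A du0] := vol_gt0 A0.
rewrite muE mulr_sumr (bigD1 u0) //= [X in _ < X](bigD1 u0) //=.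
have small u : u \in A -> stay (a.*2 * 2 ^ j) u < 8^-1 ^+ (2 ^ j).
  rewrite finset.in_setD => /andP[uU' uU]; move: uU'; rewrite inE uU /= -ltNge.
  by [].
apply: ltr_leD.
  by rewrite [X in _ < X]mulrC ltr_pM2l ?ltr0n // small.
apply: ler_sum => u /andP[uA _]; rewrite [X in _ <= X]mulrC ler_wpM2l //.
by rewrite ltW // small.
Qed.

End Stay.

(** * Cost and success probability of one copy *)

Section Bounds.
Variables (R : realType) (n : nat) (G : sgraph n) (th cap : R).
Hypothesis th_gt0 : 0 < th.
Implicit Types (S T U : {set 'I_n}) (u x y : 'I_n) (K t c : nat).

Local Notation d u := ((deg G u)%:R : R).
Local Notation mu S := ((vol G S)%:R : R).
Local Notation bd S := ((boundary G S)%:R : R).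
Local Notation cond := (conductance R G).

Definition sparse S := bd S <= th * mu S.
Definition halted S := sparse S || (cap < mu S).
Definition success S := sparse S && (mu S <= cap).

Lemma halted_bd0 S : boundary G S = 0%N -> halted S.
Proof. by move=> b0; rewrite /halted /sparse b0 mulr_ge0 // ltW. Qed.

Lemma unhalted S : ~~ halted S -> (0 < vol G S)%N -> th < cond S /\ mu S <= cap.
Proof.
rewrite /halted /sparse negb_or -ltNge -leNgt => /andP[lt_th le_cap] vS; split=> //.
by rewrite /conductance ltr_pdivlMr // ltr0n.
Qed.

Let th8_ge0 : 0 <= 8 / th.
Proof. by rewrite divr_ge0 // ltW. Qed.

Lemma newcostE S T c : (newcost G S T c)%:R / mu T =
  (c%:R + bd S) * (mu T)^-1 + mu (sdiff S T) / mu T :> R.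
Proof. by rewrite /newcost !natrD mulrDl. Qed.

(* The work of a step is charged to [cond S <= cond S ^ 2 / th], whose expected
   sum is bounded by the initial value of the potential [psi]. *)
Lemma Ehat_cost capA S c K : valid G K S -> (0 < vol G S)%N -> ~~ halted S ->
  mu S <= capA ->
  Ehat G K S (fun T => (newcost G S T c)%:R / mu T + 8 / th * psi G capA T) <=
    c%:R / mu S + 8 / th * psi G capA S.
Proof.
move=> vK vS nh le_capA; have [lt_th _] := unhalted nh vS.
have mu0 : 0 < mu S by rewrite ltr0n.
have -> : Ehat G K S (fun T => (newcost G S T c)%:R / mu T + 8 / th * psi G capA T) =
    (c%:R + bd S) * Ehat G K S (fun T => (mu T)^-1) +
    1 * Ehat G K S (fun T => 1 * (mu (sdiff S T) / mu T) + 8 / th * psi G capA T).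
  by rewrite -Ehat_lin; apply: eq_Ehat => z _; rewrite newcostE; ring.
rewrite Ehat_lin !mul1r.
have A1 : (c%:R + bd S) * Ehat G K S (fun T => (mu T)^-1) <= c%:R / mu S + cond S.
  apply: (@le_trans _ _ ((c%:R + bd S) / mu S)).
    by apply: ler_wpM2l; [rewrite addr_ge0|exact: Ehat_inv].
  by rewrite mulrDl.
have A2 := Ehat_sdiff R vK vS.
have A3 : 8 / th * Ehat G K S (psi G capA) <= 8 / th * psi G capA S - 2 * cond S.
  apply: (@le_trans _ _ (8 / th * (psi G capA S - cond S ^+ 2 / 4))).
    by apply: ler_wpM2l; [exact: th8_ge0|exact: Ehat_psi].
  rewrite mulrBr lerD2l lerNl opprK.
  have -> : 8 / th * (cond S ^+ 2 / 4) = 2 * cond S * (cond S / th) by field; rewrite gt_eqF.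
  have c0 : 0 <= cond S by rewrite divr_ge0.
  by rewrite -[X in X <= _]mulr1 ler_wpM2l ?mulr_ge0 // ler_pdivlMr // mul1r ltW.
by apply: le_trans (lerD A1 (lerD A2 A3)) _; lra.
Qed.

(** [capA] is kept apart from the size limit [cap]: the choice [n * n] makes the expected ratio
    depend on [ln n] instead of [gamma]. *)
Lemma vbar_cost capA t S c K : valid G K S -> (0 < vol G S)%N ->
  (forall S, (0 < vol G S)%N -> mu S <= cap -> mu S <= capA) ->
  vbar G halted (fun S c => if success S then c%:R / mu S else 0) (fun _ _ => 0)
    t S c K <= c%:R / mu S + 8 / th * psi G capA S.
Proof.
move=> + + capA_ge; elim: t S c K => [|t IH] S c K vK vS /=.
  have ? : 0 <= c%:R / mu S + 8 / th * psi G capA S.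
    by rewrite addr_ge0 ?divr_ge0 // mulr_ge0 ?psi_ge0.
  case: ifP => // _; case: ifP => // _.
  by rewrite lerDl mulr_ge0 ?psi_ge0.
case: ifPn => [_|nh].
  have ? : 0 <= c%:R / mu S + 8 / th * psi G capA S.
    by rewrite addr_ge0 ?divr_ge0 // mulr_ge0 ?psi_ge0.
  case: ifP => // _; by rewrite lerDl mulr_ge0 ?psi_ge0.
have [_ le_cap] := unhalted nh vS.
apply: le_trans (Ehat_cost c vK vS nh (capA_ge _ vS le_cap)).
by apply: Ehat_le => // z vz; apply: IH => //; apply: valid_lev.
Qed.

(** The left side also kills the walk at the points of [S] outside [U], which can only decrease
    it. *)
Lemma Ehat_stay U t S K : valid G K S -> (0 < vol G S)%N ->
  (\sum_(u in S) d u * stay R G U t.+1 u) / mu S <=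
  Ehat G K S (fun T => (\sum_(u in T) d u * stay R G U t u) / mu T).
Proof.
move=> vK vS; rewrite Ehat_weight // ler_wpM2r ?invr_ge0 //.
apply: ler_sum => x xS; rewrite ler_wpM2l // /stay iterS {1}/killed.
case: ifP => // _; rewrite /wstep addr_ge0 ?divr_ge0 ?mulr_ge0 ?sumr_ge0 //.
  exact: stay_ge0.
by move=> y _; apply: stay_ge0.
Qed.

(** The second bound penalises large sets: a random point of [S] lies in [U] with probability at
    most [mu U / mu S]. *)
Lemma stay_share U t S : (0 < vol G S)%N ->
  (\sum_(u in S) d u * stay R G U t u) / mu S <= 1 /\
  (\sum_(u in S) d u * stay R G U t u) / mu S <= mu U / mu S.
Proof.
move=> vS; have mu0 : 0 < mu S by rewrite ltr0n.
split.
  rewrite ler_pdivrMr // mul1r muE ler_sum // => u _.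
  by rewrite -{2}[d u]mulr1 ler_wpM2l ?stay_le1.
rewrite ler_wpM2r ?invr_ge0 // muE big_mkcond [X in _ <= X]big_mkcond.
apply: ler_sum => u _; case: ifP => _; last by case: ifP.
case: ifPn => uU; last by rewrite stay_notin ?mulr0.
by rewrite -{2}[d u]mulr1 ler_wpM2l ?stay_le1.
Qed.

Lemma Ehat_lin3 K S (a b c : R) f g h : valid G K S -> (0 < vol G S)%N ->
  Ehat G K S (fun T => f T - a - b * g T - c * h T) =
  Ehat G K S f - a - b * Ehat G K S g - c * Ehat G K S h.
Proof.
move=> vK vS.
transitivity (1 * Ehat G K S f + 1 * Ehat G K S
   (fun T => (- a) * 1 + 1 * ((- b) * g T + (- c) * h T))).
  by rewrite -Ehat_lin; apply: eq_Ehat => z _; ring.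
by rewrite !Ehat_lin Ehat_cst //; ring.
Qed.

(* The four terms account for the event that the random walk stays in [U], and
   the exceptions: too large a set, no halting, too large a cost. *)
Lemma vbar_success U B t S c K : valid G K S -> (0 < vol G S)%N ->
  0 < cap -> 0 < B ->
  (\sum_(u in S) d u * stay R G U t u) / mu S - mu U / cap
    - expR (- (th ^+ 2 / 8)) ^+ t * Num.sqrt (cap / mu S)
    - cap / B * (c%:R / mu S + 8 / th * psi G cap S)
  <= vbar G halted (fun S c => (success S && (c%:R <= B))%:R) (fun _ _ => 0) t S c K.
Proof.
move=> + + cap0 B0.
set q := expR _; have q0 : 0 <= q by apply: expR_ge0.
have capB : 0 <= cap / B by rewrite divr_ge0 // ltW.
have term0 c' S' : 0 <= cap / B * (c'%:R / mu S' + 8 / th * psi G cap S').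
  by rewrite mulr_ge0 // addr_ge0 ?divr_ge0 // mulr_ge0 ?psi_ge0.
(* A halted set is handled by one term each: above [cap], the share is at most [mu U / cap]; with
   work above [B], the last term is at least 1; otherwise it is a success, and the share is at most
   1. *)
have base t' S' c' : (0 < vol G S')%N -> halted S' ->
  (\sum_(u in S') d u * stay R G U t' u) / mu S' - mu U / cap
    - q ^+ t' * Num.sqrt (cap / mu S')
    - cap / B * (c'%:R / mu S' + 8 / th * psi G cap S')
  <= (success S' && (c'%:R <= B))%:R.
  move=> vS'; have [s1 s2] := stay_share U t' vS'.
  have mu0 : 0 < mu S' by rewrite ltr0n.
  have t1 : 0 <= q ^+ t' * Num.sqrt (cap / mu S') by rewrite mulr_ge0 ?exprn_ge0 ?sqrtr_ge0.
  have t2 : 0 <= mu U / cap by rewrite divr_ge0 // ltW.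
  have t3 := term0 c' S'.
  rewrite /halted /success; have [le_cap|lt_cap] := leP (mu S') cap; last first.
    move=> _; rewrite andbF /=; suff: mu U / mu S' <= mu U / cap by lra.
    by rewrite ler_wpM2l // lef_pV2 ?posrE // ltW.
  rewrite orbF => -> /=; have [_|lt_B] := leP c'%:R B; first by rewrite mulr1n; move: s1 t1 t2 t3; lra.
  suff: 1 <= cap / B * (c'%:R / mu S' + 8 / th * psi G cap S') by rewrite mulr0n; move: s1 t1 t2; lra.
  apply: (@le_trans _ _ (cap / B * (c'%:R / mu S'))); last first.
    by rewrite ler_wpM2l // lerDl mulr_ge0 ?psi_ge0.
  have -> : cap / B * (c'%:R / mu S') = (cap / mu S') * (c'%:R / B) by field; rewrite !gt_eqF.
  by rewrite mulr_ege1 // ler_pdivlMr // mul1r // ltW.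
elim: t S c K => [|t IH] S c K vK vS /=.
  case: ifPn => [h|nh]; first exact: (base 0%N S c vS h).
  have [_ le_cap] := unhalted nh vS; have [s1 _] := stay_share U 0 vS.
  have mu0 : 0 < mu S by rewrite ltr0n.
  have t3 := term0 c S; have t2 : 0 <= mu U / cap by rewrite divr_ge0 // ltW.
  (* No step is left and the set has not halted: as [mu S <= cap], the horizon term is at least 1
     and cancels the share. *)
  suff: 1 <= Num.sqrt (cap / mu S) by rewrite expr0 mul1r; move: s1 t2 t3; lra.
  by rewrite -[X in X <= _]sqrtr1 ler_wsqrtr // ler_pdivlMr // mul1r.
case: ifPn => [h|nh]; first exact: (base t.+1 S c vS h).
have [lt_th le_cap] := unhalted nh vS; have mu0 : 0 < mu S by rewrite ltr0n.
apply: (@le_trans _ _ (Ehat G K S (fun T =>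
   (\sum_(u in T) d u * stay R G U t u) / mu T - mu U / cap
    - q ^+ t * Num.sqrt (cap / mu T)
    - cap / B * ((newcost G S T c)%:R / mu T + 8 / th * psi G cap T)))); last first.
  by apply: Ehat_le => // z vz; apply: IH => //; apply: valid_lev.
have -> : Ehat G K S (fun T =>
   (\sum_(u in T) d u * stay R G U t u) / mu T - mu U / cap
    - q ^+ t * Num.sqrt (cap / mu T)
    - cap / B * ((newcost G S T c)%:R / mu T + 8 / th * psi G cap T)) =
  Ehat G K S (fun T => (\sum_(u in T) d u * stay R G U t u) / mu T) - mu U / cap
   - q ^+ t * Ehat G K S (fun T => Num.sqrt (cap / mu T))
   - cap / B * Ehat G K S (fun T => (newcost G S T c)%:R / mu T + 8 / th * psi G cap T).
  exact: Ehat_lin3.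
have A1 := Ehat_stay U t vK vS.
have A2 : q ^+ t * Ehat G K S (fun T => Num.sqrt (cap / mu T)) <= q ^+ t.+1 * Num.sqrt (cap / mu S).
  rewrite exprSr -mulrA ler_wpM2l ?exprn_ge0 //.
  apply: le_trans (Ehat_sqrt vK vS (ltW cap0)) _; rewrite ler_wpM2r ?sqrtr_ge0 //.
  apply: le_trans (_ : 1 - th ^+ 2 / 8 <= _).
    rewrite lerB // ler_wpM2r // ler_sqr ?nnegrE ?ltW //.
    exact: lt_trans lt_th.
  by have := expR_ge1Dx (- (th ^+ 2 / 8)).
have A3 : cap / B * Ehat G K S (fun T => (newcost G S T c)%:R / mu T + 8 / th * psi G cap T)
   <= cap / B * (c%:R / mu S + 8 / th * psi G cap S).
  by apply: ler_wpM2l => //; apply: Ehat_cost.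
by rewrite !lerB.
Qed.

End Bounds.

(** * Data structures *)

(* Two-dimensional tables are stored in arrays through a pairing function.  The row
   number serves as a time stamp: using a row never used before replaces clearing
   the table, which would cost more than the work allowed. *)
Definition pairn (a b : nat) : nat := ((a + b) * (a + b) + b)%N.

(** Since [b <= a + b], the code of a pair lies between the squares of [a + b] and [a + b + 1]. *)
Lemma pairn_inj a b a' b' : pairn a b = pairn a' b' -> a = a' /\ b = b'.
Proof.
have lt c d c' d' : (c + d < c' + d')%N -> (pairn c d < pairn c' d')%N.
  move=> h; have : ((c + d).+1 * (c + d).+1 <= (c' + d') * (c' + d'))%N by rewrite leq_mul.
  by rewrite /pairn; nia.
move=> E; have [/lt|/lt|eq_s] := ltngtP (a + b) (a' + b'); rewrite ?E ?ltnn //.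
by move: E; rewrite /pairn eq_s; lia.
Qed.

Definition npair a b := NAdd (NMul (NAdd a b) (NAdd a b)) b.
Arguments npair : simpl never.

Lemma neval_npair (R : realType) (s : state R) a b :
  neval s (npair a b) = pairn (neval s a) (neval s b).
Proof. by []. Qed.
Arguments pairn : simpl never.

(** The column never exceeds the code, so a bounded search decides membership in the row. *)
Definition inrow (r i : nat) : bool := [exists j : 'I_i.+1, i == pairn r j].

Lemma inrow_pairn r r' j : inrow r (pairn r' j) = (r == r').
Proof.
apply/existsP/eqP => [[k /eqP/pairn_inj[]]|->]; first by [].
have lt : (j < (pairn r' j).+1)%N by rewrite ltnS /pairn leq_addl.
by exists (Ordinal lt).
Qed.

Definition var k := NGet 1 (NConst k).
Definition assign k e := NSet 1 (NConst k) e.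
Fixpoint block (ps : seq cmd) : cmd :=
  match ps with [::] => Skip | [:: p] => p | p :: ps => Seq p (block ps) end.

(* The scalar variables are cells of array 1.  Array 2 holds the membership in the
   current set, 3 the number of neighbours in it, 4 the list of candidates for the
   next changes, 5 the marks of the vertices in that list, 6 the log of all the
   vertices that have been toggled, and 7 the vertices to be toggled next. *)
Notation v_ctr := 0%N.
Notation v_rho := 1%N.
Notation v_sig := 2%N.
Notation v_len := 3%N.
Notation v_na := 4%N.
Notation v_vol := 5%N.
Notation v_bd := 6%N.
Notation v_K := 7%N.
Notation v_cost := 8%N.
Notation v_x := 9%N.
Notation v_z := 10%N.
Notation v_u := 11%N.
Notation v_d := 12%N.
Notation v_t := 13%N.
Notation v_j := 14%N.
Notation v_w := 15%N.
Notation v_nch := 16%N.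
Notation v_i := 17%N.
Notation v_osig := 18%N.
Notation v_olen := 19%N.
Notation v_done := 20%N.
Notation v_abort := 21%N.
Notation v_full := 22%N.
Notation v_jc := 23%N.
Notation v_P := 24%N.
Notation v_rd := 25%N.
Notation v_hub := 26%N.
Notation v_dw := 27%N.

Definition p_append :=
  If (NLe (NGet 5 (npair (var v_sig) (var v_w))) (NConst 0))
    (block [:: NSet 5 (npair (var v_sig) (var v_w)) (NConst 1);
               NSet 4 (npair (var v_sig) (var v_len)) (var v_w);
               assign v_len (NAdd (var v_len) (NConst 1))])
    Skip.

(** It runs after [p_toggle]: a membership bit 0 means that [u] has just left, and its neighbours
    lose one. *)
Definition p_touch :=
  block [:: Neighbour 1 (NConst v_w) (var v_u) (var v_j);
            Degree 1 (NConst v_dw) (var v_w);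
            assign v_K (NMul (var v_K) (NMul (NConst 2) (var v_dw)));
            If (NLe (NGet 2 (npair (var v_rho) (var v_u))) (NConst 0))
              (NSet 3 (npair (var v_rho) (var v_w))
                 (NSub (NGet 3 (npair (var v_rho) (var v_w))) (NConst 1)))
              (NSet 3 (npair (var v_rho) (var v_w))
                 (NAdd (NGet 3 (npair (var v_rho) (var v_w))) (NConst 1)));
            p_append;
            assign v_j (NAdd (var v_j) (NConst 1))].

Definition p_toggle :=
  block [:: Degree 1 (NConst v_d) (var v_u);
            assign v_t (NGet 3 (npair (var v_rho) (var v_u)));
            If (NLe (NGet 2 (npair (var v_rho) (var v_u))) (NConst 0))
              (block [:: NSet 2 (npair (var v_rho) (var v_u)) (NConst 1);
                         assign v_vol (NAdd (var v_vol) (var v_d));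
                         assign v_bd (NSub (NAdd (var v_bd) (var v_d))
                                           (NMul (NConst 2) (var v_t)))])
              (block [:: NSet 2 (npair (var v_rho) (var v_u)) (NConst 0);
                         assign v_vol (NSub (var v_vol) (var v_d));
                         assign v_bd (NSub (NAdd (var v_bd)
                                                 (NMul (NConst 2) (var v_t)))
                                           (var v_d))]);
            NSet 6 (npair (var v_rho) (var v_na)) (var v_u);
            assign v_na (NAdd (var v_na) (NConst 1));
            assign v_w (var v_u);
            assign v_j (NConst 0)].

Definition p_flip :=
  block [:: p_toggle; p_append; While (Not (NLe (var v_d) (var v_j))) p_touch].

Section Toggle.
Variables (n : nat) (G : sgraph n).
Implicit Types (S : {set 'I_n}) (u w : 'I_n).

Definition toggle S u := if u \in S then S :\ u else u |: S.

Lemma in_toggle S u w : (w \in toggle S u) = (w == u) (+) (w \in S).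
Proof.
by rewrite /toggle; case: ifPn => uS; rewrite !inE; case: eqP => [->|] //=; rewrite ?uS ?(negbTE uS).
Qed.

Lemma nbr_add S u w : u \notin S -> nbr G w (u |: S) = (nbr G w S + G w u)%N.
Proof. by move=> uS; rewrite !nbrE big_setU1 //= addnC. Qed.

Lemma nbr_toggle S u w : nbr G w (toggle S u) =
  if u \in S then (nbr G w S - G w u)%N else (nbr G w S + G w u)%N.
Proof.
rewrite /toggle; case: ifPn => uS; last exact: nbr_add.
by rewrite -[in RHS](finset.setD1K uS) nbr_add ?addnK // !inE eqxx.
Qed.

Lemma bd_add S u : u \notin S ->
  (boundary G (u |: S) + 2 * nbr G u S = boundary G S + deg G u)%N.
Proof.
move=> uS; rewrite !boundaryE big_setU1 //=.
have cE w : nbr G w (~: S) = (nbr G w (~: (u |: S)) + G w u)%N.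
  have -> : ~: S = u |: ~: (u |: S).
    by apply/setP => x; rewrite !inE negb_or; case: eqP => [->|].
  by rewrite nbr_add // !inE eqxx.
have -> : (\sum_(w in S) nbr G w (~: S) =
    \sum_(w in S) nbr G w (~: (u |: S)) + nbr G u S)%N.
  rewrite [nbr G u S]nbrE -big_split; apply: eq_bigr => w _.
  by rewrite cE [G u w]edge_sym.
have := cE u; rewrite edge_irr addn0 => <-; have := nbr_setC G u S.
set X := (\sum_(w in S) _)%N. lia.
Qed.

Lemma bd_toggle S u : boundary G (toggle S u) =
  if u \in S then (boundary G S + 2 * nbr G u S - deg G u)%N
  else (boundary G S + deg G u - 2 * nbr G u S)%N.
Proof.
rewrite /toggle; case: ifPn => uS; last by have := bd_add uS; lia.
have uD : u \notin S :\ u by rewrite !inE eqxx.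
have := bd_add uD; rewrite (finset.setD1K uS).
have : nbr G u S = nbr G u (S :\ u).
  by rewrite -[in LHS](finset.setD1K uS) nbr_add // edge_irr addn0.
lia.
Qed.

Lemma vol_toggle S u : vol G (toggle S u) =
  if u \in S then (vol G S - deg G u)%N else (vol G S + deg G u)%N.
Proof.
rewrite /toggle; case: ifPn => uS; last by rewrite /vol big_setU1 //= addnC.
by rewrite [in RHS]/vol (big_setD1 u) //= addKn.
Qed.

End Toggle.

(** * Frame conditions *)

Section Frames.
Variable R : realType.
Implicit Types (s : state R) (F : nat -> nat -> bool).

Definition same F s s' :=
  (forall a i, ~~ F a i -> nmem s' a i = nmem s a i) /\
  rmem s' = rmem s /\ emitted s' = emitted s.

Lemma same_refl F s : same F s s.
Proof. by []. Qed.

Lemma same_nset F s s' a i k : F a i -> same F s s' -> same F s (nset s' a i k).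
Proof.
move=> Fai [mem re]; split=> // b j nF /=; rewrite /upd.
by case: andP => [[/eqP eb /eqP ej]|_]; [rewrite eb ej Fai in nF|apply: mem].
Qed.

Lemma same_trans F s1 s2 s3 : same F s1 s2 -> same F s2 s3 -> same F s1 s3.
Proof.
move=> [m12 [r12 e12]] [m23 [r23 e23]]; split=> [a i nF|].
  by rewrite m23 // m12.
by rewrite r23 e23.
Qed.

Lemma same_sub F F' s s' : (forall a i, F a i -> F' a i) -> same F s s' -> same F' s s'.
Proof.
move=> FF' [mem re]; split=> // a i nF; apply: mem.
by apply: contra nF; apply: FF'.
Qed.

End Frames.

(* [F_p] is the set of the cells of natural numbers that the routine [p] may
   modify. *)
Definition F_append sig a i :=
  ((a == 1%N) && (i == v_len)) || ((a \in [:: 4; 5]) && inrow sig i)%N.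

Definition F_toggle rho a i :=
  ((a == 1) && (i \in [:: v_na; v_vol; v_bd; v_d; v_t; v_j; v_w]) ||
   (a \in [:: 2; 6]) && inrow rho i)%N.

Definition F_touch rho sig a i :=
  [|| (a == 1) && (i \in [:: v_len; v_K; v_j; v_w; v_dw]),
      (a \in [:: 4; 5]) && inrow sig i | (a == 3) && inrow rho i]%N.

Definition F_flip rho sig a i :=
  [|| (a == 1) && (i \in [:: v_len; v_na; v_vol; v_bd; v_K; v_d; v_t; v_j; v_w; v_dw]),
      (a \in [:: 4; 5]) && inrow sig i | (a \in [:: 2; 3; 6]) && inrow rho i]%N.

Definition adjoin (T : eqType) (l : seq T) w := if w \in l then l else rcons l w.

Lemma mem_adjoin (T : eqType) (l m : seq T) w :
  (w \in foldl (@adjoin T) l m) = (w \in l) || (w \in m).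
Proof.
elim: m l => [|x m IH] l /=; first by rewrite orbF.
rewrite IH /adjoin inE; case: ifP => xl; last by rewrite mem_rcons inE -orbA orbCA.
by case: eqP => [->|] //=; rewrite xl.
Qed.

Lemma size_adjoin (T : eqType) (l m : seq T) :
  (size (foldl (@adjoin T) l m) <= size l + size m)%N.
Proof.
elim: m l => [|x m IH] l /=; first by rewrite addn0.
apply: leq_trans (IH _) _; rewrite /adjoin; case: ifP => _; rewrite ?size_rcons; lia.
Qed.

Lemma prefix_adjoin (T : eqType) (l m : seq T) :
  take (size l) (foldl (@adjoin T) l m) = l.
Proof.
suff [r ->] : exists r, foldl (@adjoin T) l m = l ++ r by rewrite take_size_cat.
elim: m l => [|x m IH] l /=; first by exists [::]; rewrite cats0.
have [r ->] := IH (adjoin l x); rewrite /adjoin; case: ifP => _; first by exists r.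
by exists (x :: r); rewrite cat_rcons.
Qed.

Ltac wpstep := first [apply: wp_seq | apply: wp_nset | apply: wp_degree
  | apply: wp_neighbour | apply: wp_skip]; rewrite ?neval_npair /= /upd /=.

Section Oracle.
Variables (n : nat) (G : sgraph n) (L : 'I_n -> seq 'I_n).
Hypothesis adjL : adjacency_lists G L.

Lemma size_adj u : size (L u) = deg G u.
Proof.
have [un mem] := adjL u; rewrite /deg -(card_uniqP un).
by apply: eq_card => w; rewrite inE mem.
Qed.

Definition answers (O : oracle) :=
  (forall u : 'I_n, degree_query O u = deg G u) /\
  (forall (u : 'I_n) j, (j < deg G u)%N ->
    exists2 w, drop j (L u) = w :: drop j.+1 (L u) & neighbour_query O u j = w).

Lemma graph_oracle_answers : answers (graph_oracle L).
Proof.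
split=> [u|u j]; first by rewrite /= valK size_adj.
rewrite -size_adj => lt_j; rewrite /= valK.
case E: (L u) lt_j => [//|x r]; rewrite -E => lt_j.
by exists (nth x (L u) j); [exact: drop_nth|rewrite (nth_map x)].
Qed.

End Oracle.

Section Routines.
Variables (R : realType) (n : nat) (G : sgraph n) (L : 'I_n -> seq 'I_n).
Hypothesis adjL : adjacency_lists G L.
Variable O : oracle.
Hypothesis ansO : answers G L O.
Implicit Types (s : state R) (S : {set 'I_n}) (u w : 'I_n) (l : seq 'I_n).

Local Notation rho s := (nmem s 1 v_rho).
Local Notation sig s := (nmem s 1 v_sig).

Let degree_queryE := ansO.1.
Let neighbour_queryE := ansO.2.
Let sizeL := size_adj adjL.

Record listrep s l : Prop := Listrep {
  lr_len : nmem s 1 v_len = size l;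
  lr_nth : forall i, (i < size l)%N ->
    nmem s 4 (pairn (sig s) i) = nth 0%N [seq val w | w <- l] i;
  lr_mark : forall w, nmem s 5 (pairn (sig s) w) = (w \in l);
  lr_uniq : uniq l }.

Lemma append_spec s l w : listrep s l -> nmem s 1 v_w = w ->
  wp O p_append s (fun m s' => (m <= 7)%N /\ same (F_append (sig s)) s s' /\
    listrep s' (adjoin l w)).
Proof.
move=> [len nthl mark un] ew; apply: wp_if; rewrite /= -/(pairn _ _) ew mark leqn0 eqb0.
  move=> wl; do 5!wpstep; rewrite ew; split=> //; split.
    by repeat (apply: same_nset; first by rewrite /F_append ?inrow_pairn ?eqxx ?orbT).
  rewrite /adjoin (negbTE wl); constructor=> /=.
  - by rewrite /upd /= len size_rcons addn1.
  - move=> i; rewrite size_rcons ltnS => le_i; rewrite /upd /= len map_rcons nth_rcons size_map.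
    case: eqP => [/pairn_inj[_ ->]|ne]; first by rewrite ltnn eqxx.
    have lt_i : (i < size l)%N.
      by rewrite ltn_neqAle le_i andbT; apply/eqP => e; apply: ne; rewrite e.
    by rewrite lt_i -nthl.
  - move=> u; rewrite /upd /= mem_rcons inE; case: eqP => [/pairn_inj[_ e]|ne].
      by rewrite (ord_inj e) eqxx.
    rewrite mark; case: eqP => // e; case: ne; rewrite e //.
  - by rewrite rcons_uniq wl.
move/negPn=> wl; wpstep; split=> //; split; first exact: same_refl.
by rewrite /adjoin wl.
Qed.

(** The log may repeat vertices and keep those that have left. Emission goes through it and tests
    membership, which avoids a scan of all [n] vertices. *)
Record setrep s S : Prop := Setrep {
  sr_in : forall w, nmem s 2 (pairn (rho s) w) = (w \in S);
  sr_nbr : forall w, nmem s 3 (pairn (rho s) w) = nbr G w S;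
  sr_vol : nmem s 1 v_vol = vol G S;
  sr_bd : nmem s 1 v_bd = boundary G S;
  sr_log : forall w, w \in S -> exists2 i, (i < nmem s 1 v_na)%N &
    nmem s 6 (pairn (rho s) i) = w;
  sr_log_ord : forall i, (i < nmem s 1 v_na)%N ->
    exists w : 'I_n, nmem s 6 (pairn (rho s) i) = w }.

Lemma listrep_same F s s' l : same F s s' ->
  (forall i, ~~ F 4%N (pairn (sig s) i)) -> (forall i, ~~ F 5%N (pairn (sig s) i)) ->
  ~~ F 1%N v_len -> ~~ F 1%N v_sig -> listrep s l -> listrep s' l.
Proof.
move=> [mem _] F4 F5 Flen Fsig [len nthl mark un]; constructor=> //.
- by rewrite mem.
- by move=> i lt_i; rewrite (mem 1%N v_sig) // mem // nthl.
- by move=> w; rewrite (mem 1%N v_sig) // mem.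
Qed.

Lemma toggle_spec s S u : setrep s S -> nmem s 1 v_u = u ->
  wp O p_toggle s (fun m s' => (m <= 30)%N /\ same (F_toggle (rho s)) s s' /\
    [/\ nmem s' 1 v_d = deg G u, nmem s' 1 v_w = u & nmem s' 1 v_j = 0%N] /\
    (forall w, nmem s' 2 (pairn (rho s) w) = (w \in toggle S u)) /\
    nmem s' 1 v_vol = vol G (toggle S u) /\
    nmem s' 1 v_bd = boundary G (toggle S u) /\
    nmem s' 1 v_na = (nmem s 1 v_na).+1 /\
    (forall i, nmem s' 6 (pairn (rho s) i) =
       if i == nmem s 1 v_na then u : nat else nmem s 6 (pairn (rho s) i))).
Proof.
move=> [inS nbrS volS bdS logS log_ord] eu.
have eqrow i j : (pairn (rho s) i == pairn (rho s) j) = (i == j).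
  by apply/eqP/eqP => [/pairn_inj[]|->].
repeat wpstep.
apply: wp_if; rewrite /= /upd /= -/(pairn _ _) eu inS leqn0 eqb0 => uS.
- repeat wpstep.
  rewrite !degree_queryE eu nbrS volS bdS; split=> //; split.
    by repeat (apply: same_nset; first by rewrite /F_toggle ?inrow_pairn ?eqxx ?orbT).
  rewrite vol_toggle bd_toggle (negbTE uS); do !split=> //.
  + move=> w; rewrite eqrow in_toggle inS; case: eqP => [/ord_inj ->|ne].
      by rewrite eqxx (negbTE uS).
    by case: eqP => // e; case: ne; rewrite e.
  + by rewrite addn1.
  + by move=> i; rewrite eqrow.
- move/negPn in uS; repeat wpstep.
  rewrite !degree_queryE eu nbrS volS bdS; split=> //; split.
    by repeat (apply: same_nset; first by rewrite /F_toggle ?inrow_pairn ?eqxx ?orbT).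
  rewrite vol_toggle bd_toggle uS; do !split=> //.
  + move=> w; rewrite eqrow in_toggle inS; case: eqP => [/ord_inj ->|ne].
      by rewrite eqxx uS.
    by case: eqP => // e; case: ne; rewrite e.
  + by rewrite addn1.
  + by move=> i; rewrite eqrow.
Qed.

Lemma flip_spec s S l u : setrep s S -> listrep s l -> nmem s 1 v_u = u ->
  wp O p_flip s (fun m s' => (m <= 80 * (deg G u).+1)%N /\
    same (F_flip (rho s) (sig s)) s s' /\
    setrep s' (toggle S u) /\ listrep s' (foldl (@adjoin _) (adjoin l u) (L u)) /\
    nmem s' 1 v_K = (nmem s 1 v_K * \prod_(w <- L u) (2 * deg G w))%N /\
    nmem s' 1 v_na = (nmem s 1 v_na).+1).
Proof.
move=> srep lrep eu; apply: wp_seq; apply: wp_conseq (toggle_spec srep eu).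
move=> m0 s0 [m0_le [same0 [[d0 w0 j0] [in0 [vol0 [bd0 [na0 log0]]]]]]].
have rho0 : rho s0 = rho s by apply: same0.1.
have sig0 : sig s0 = sig s by apply: same0.1.
have lrep0 : listrep s0 l by apply: listrep_same same0 _ _ _ _ lrep.
apply: wp_seq; apply: wp_conseq (append_spec lrep0 w0).
move=> m1 s1 [m1_le [same1 lrep1]]; rewrite sig0 in same1.
have rho1 : rho s1 = rho s by rewrite same1.1.
have sig1 : sig s1 = sig s by rewrite same1.1.
have in1 w : nmem s1 2 (pairn (rho s) w) = (w \in toggle S u) by rewrite same1.1.
have u1 : nmem s1 1 v_u = u by rewrite same1.1 // same0.1.
have d1 : nmem s1 1 v_d = deg G u by rewrite same1.1.
have K1 : nmem s1 1 v_K = nmem s 1 v_K by rewrite same1.1 // same0.1.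
have nbr1 w : nmem s1 3 (pairn (rho s) w) = nbr G w S.
  by rewrite same1.1 // same0.1 // (sr_nbr srep).
apply: (@wp_while R O (fun m s2 => exists j, [/\ nmem s2 1 v_j = j, (j <= deg G u)%N & (m <= 40 * j)%N] /\
   same (F_touch (rho s) (sig s)) s1 s2 /\
   listrep s2 (foldl (@adjoin _) (adjoin l u) (take j (L u))) /\
   nmem s2 1 v_K = (nmem s 1 v_K * \prod_(w <- take j (L u)) (2 * deg G w))%N /\
   forall w, nmem s2 3 (pairn (rho s) w) =
     if u \in S then (nbr G w S - (w \in take j (L u)))%N
     else (nbr G w S + (w \in take j (L u)))%N) (fun s2 => deg G u - nmem s2 1 v_j)%N).
- exists 0%N; rewrite same1.1 // j0 take0 big_nil muln1; do !split=> //.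
  by move=> w; rewrite nbr1 addn0 subn0; case: ifP.
- move=> m s2 [j [[ej le_j m_le] [same2 [lrep2 [K2 nbr2]]]]].
  have d2 : nmem s2 1 v_d = deg G u by rewrite same2.1.
  rewrite /= d2 ej -ltnNge => lt_j.
  have [w dropE nbE] := neighbour_queryE lt_j.
  have takeE : take j.+1 (L u) = rcons (take j (L u)) w.
    by rewrite -[in LHS](cat_take_drop j (L u)) dropE -cat_rcons take_size_cat // size_rcons size_takel // sizeL ltnW.
  have w_new : w \notin take j (L u).
    have := (adjL u).1; rewrite -{1}(cat_take_drop j (L u)) dropE cat_uniq => /and3P[_ + _].
    by rewrite /= negb_or => /andP[].
  have rho2 : rho s2 = rho s by rewrite same2.1.
  have sig2 : sig s2 = sig s by rewrite same2.1.
  have u2 : nmem s2 1 v_u = u by rewrite same2.1.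
  wpstep; wpstep; rewrite u2 ej nbE; do 4!wpstep.
  have nbr2w : nmem s2 3 (pairn (rho s) w) = nbr G w S.
    by rewrite nbr2 (negbTE w_new) addn0 subn0; case: ifP.
  set s3 := nset _ 1 v_K _.
  have same3 : same (F_touch (rho s) (sig s)) s1 s3 by repeat (apply: same_nset; first by []).
  set x := if u \in S then (nbr G w S - 1)%N else (nbr G w S + 1)%N.
  apply: wp_seq; apply: (@wp_conseq _ _ _ _
    (fun m3 s4 => m3 = 2%N /\ s4 = nset s3 3 (pairn (rho s) w) x)).
    + move=> m3 s4 [-> ->]; apply: wp_seq.
      set s5 := nset s3 _ _ _.
      have same5 : same (F_touch (rho s) (sig s)) s1 s5.
        by apply: same_nset same3; rewrite /F_touch /= inrow_pairn.
      have lrep5 : listrep s5 (foldl (@adjoin _) (adjoin l u) (take j (L u))).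
        case: lrep2 => len nthl mark un; constructor=> //.
      have w5 : nmem s5 1 v_w = w by [].
      apply: wp_conseq (append_spec lrep5 w5) => m6 s6 [m6_le [same6 lrep6]].
      have sig5 : sig s5 = sig s by [].
      rewrite sig5 in same6.
      have same6' : same (F_touch (rho s) (sig s)) s1 s6.
        apply: same_trans same5 (same_sub _ same6) => a i.
        by rewrite /F_append /F_touch; case/orP => [/andP[/eqP -> /eqP ->]|->]; rewrite ?orbT.
      wpstep; rewrite (same6.1 1%N v_j) // /s5 /s3 /= /upd /= ej addn1; split; last by lia.
      exists j.+1; split; first by split=> //; lia.
      split; first by apply: same_nset same6'.
      split; first by case: lrep6 => len nthl mark un; rewrite takeE foldl_rcons; constructor.
      split.
        rewrite same6.1 // /s5 /s3 /= /upd /= K2 takeE -cats1 big_cat big_seq1 /= degree_queryE.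
        by rewrite -mulnA.
      move=> v; rewrite same6.1 // /s5 /s3 /= /upd /= takeE mem_rcons inE.
      case: eqP => [/pairn_inj[_ /ord_inj ->]|ne]; first by rewrite eqxx /x.
      by rewrite nbr2; case: eqP => // e; case: ne; rewrite e.
    + apply: wp_if; rewrite /= /upd /= rho2 u2 -/(pairn _ _) (same2.1 2%N) // in1 in_toggle eqxx leqn0 eqb0 /x negbK.
      * by move=> uS; wpstep; rewrite /s3 /= /upd /= rho2 nbr2w uS.
      * by move=> /negbTE uS; wpstep; rewrite /s3 /= /upd /= rho2 nbr2w uS.
- move=> m s2 [j [[ej le_j m_le] [same2 [lrep2 [K2 nbr2]]]]].
  have d2 : nmem s2 1 v_d = deg G u by rewrite same2.1.
  rewrite /= d2 ej negbK => le_d.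
  have {ej le_j le_d}jE : j = deg G u by lia.
  have sameF : same (F_flip (rho s) (sig s)) s s2.
    apply: same_trans (same_sub _ same0) (same_trans (same_sub _ same1) (same_sub _ same2)).
    - move=> a i; rewrite /F_toggle /F_flip; case/orP => /andP[].
        by rewrite !inE => /eqP ->; do 6?[case/orP=> [->|]; rewrite ?orbT //]; move=> ->; rewrite ?orbT.
      by rewrite !inE => /orP[]/eqP -> ->; rewrite ?orbT.
    - by move=> a i; rewrite /F_append /F_flip; case/orP => [/andP[/eqP -> /eqP ->]|->]; rewrite ?orbT.
    - move=> a i; rewrite /F_touch /F_flip; case/or3P => [/andP[]|->|/andP[/eqP -> ->]]; rewrite ?orbT //.
      by rewrite !inE => /eqP ->; do 4?[case/orP=> [->|]; rewrite ?orbT //]; move=> ->; rewrite ?orbT.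
  have rho2 : rho s2 = rho s by rewrite sameF.1.
  have na2 : nmem s2 1 v_na = (nmem s 1 v_na).+1 by rewrite same2.1 // same1.1 // na0.
  have log2 i : nmem s2 6 (pairn (rho s) i) =
      if i == nmem s 1 v_na then u : nat else nmem s 6 (pairn (rho s) i).
    by rewrite same2.1 // same1.1 // log0.
  rewrite jE take_oversize ?sizeL // in lrep2 K2 nbr2.
  split; first by rewrite jE in m_le; lia.
  split=> //; split; last by split.
  constructor.
  + by move=> w; rewrite rho2 same2.1 // in1.
  + move=> w; rewrite rho2 nbr2 nbr_toggle (adjL u).2 edge_sym.
    by [].
  + by rewrite same2.1 // same1.1.
  + by rewrite same2.1 // same1.1.
  + move=> w; rewrite in_toggle na2 rho2; have [-> _|wu /= wS] := eqVneq w u.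
      by exists (nmem s 1 v_na) => //; rewrite log2 eqxx.
    have [i lt_i <-] := sr_log srep wS.
    by exists i; rewrite ?ltnS 1?ltnW // log2 ltn_eqF.
  + move=> i; rewrite na2 rho2 log2; case: eqP => [_ _|ne]; first by exists u.
    by rewrite ltnS leq_eqVlt => /orP[/eqP //|/(sr_log_ord srep)].
Qed.

End Routines.

(** * Steps of the coupled process *)

Definition input := NGet 0 (NConst 0).

Definition p_new :=
  block [:: assign v_ctr (NAdd (var v_ctr) (NConst 1));
            assign v_rho (var v_ctr);
            assign v_sig (var v_ctr);
            assign v_len (NConst 0);
            assign v_na (NConst 0);
            assign v_vol (NConst 0);
            assign v_bd (NConst 0);
            assign v_full (NConst 0);
            assign v_w input;
            Degree 1 (NConst v_d) input;
            assign v_K (NMul (NConst 2) (var v_d));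
            p_append].

Definition p_push :=
  Seq (NSet 7 (var v_nch) (var v_u)) (assign v_nch (NAdd (var v_nch) (NConst 1))).

Definition p_scan1 :=
  block [:: assign v_u (NGet 4 (npair (var v_osig) (var v_i)));
            Degree 1 (NConst v_d) (var v_u);
            assign v_t (NAdd (NGet 3 (npair (var v_rho) (var v_u)))
                         (NMul (NGet 2 (npair (var v_rho) (var v_u))) (var v_d)));
            assign v_w (var v_u);
            assign v_i (NAdd (var v_i) (NConst 1));
            If (And (Not (NLe (var v_t) (NConst 0)))
                    (Not (NLe (NMul (NConst 2) (var v_d)) (var v_t))))
              p_append Skip;
            If (NLe (NMul (var v_K) (var v_t))
                    (NMul (var v_z) (NMul (NConst 2) (var v_d))))
              (If (NLe (NGet 2 (npair (var v_rho) (var v_u))) (NConst 0)) Skip p_push)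
              (If (NLe (NGet 2 (npair (var v_rho) (var v_u))) (NConst 0)) p_push Skip)].

Definition p_scan :=
  block [:: assign v_osig (var v_sig);
            assign v_olen (var v_len);
            assign v_ctr (NAdd (var v_ctr) (NConst 1));
            assign v_sig (var v_ctr);
            assign v_len (NConst 0);
            assign v_nch (NConst 0);
            assign v_i (NConst 0);
            While (Not (NLe (var v_olen) (var v_i))) p_scan1].

Definition r_bound := RGet 1 (NConst 4).

Definition p_apply1 :=
  block [:: assign v_u (NGet 7 (var v_i));
            Degree 1 (NConst v_d) (var v_u);
            assign v_i (NAdd (var v_i) (NConst 1));
            If (RLe (ROfNat (NAdd (var v_cost) (var v_d))) r_bound)
              (Seq (assign v_cost (NAdd (var v_cost) (var v_d))) p_flip)
              (assign v_abort (NConst 1))].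

Definition p_apply :=
  Seq (assign v_i (NConst 0))
    (While (And (Not (NLe (var v_nch) (var v_i))) (NLe (var v_abort) (NConst 0)))
       p_apply1).

Definition F_scan sig a i :=
  [|| (a == 1) && (i \in [:: v_ctr; v_sig; v_len; v_u; v_d; v_t; v_w; v_nch; v_i; v_osig; v_olen]),
      (a \in [:: 4; 5]) && inrow sig i | a == 7]%N.

Definition F_apply rho sig a i :=
  (F_flip rho sig a i || (a == 1) && (i \in [:: v_u; v_d; v_i; v_cost; v_abort]))%N.

Section Phases.
Variables (R : realType) (n : nat) (G : sgraph n) (L : 'I_n -> seq 'I_n).
Hypothesis adjL : adjacency_lists G L.
Variable O : oracle.
Hypothesis ansO : answers G L O.
Implicit Types (s : state R) (S : {set 'I_n}) (u w : 'I_n) (l : seq 'I_n).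

Local Notation rho s := (nmem s 1 v_rho).
Local Notation sig s := (nmem s 1 v_sig).
Local Notation ctr s := (nmem s 1 v_ctr).

(** Arrays 4, 6 and 7 are only read below a stored length, so only 2, 3 and 5 must be clean in the
    rows to come. *)
Definition fresh s := (rho s <= ctr s)%N /\ (sig s <= ctr s)%N /\
  forall a c i, a \in [:: 2; 3; 5]%N -> (ctr s < c)%N -> nmem s a (pairn c i) = 0%N.

Lemma fresh_same F s s' : fresh s -> same F s s' -> (ctr s <= ctr s')%N ->
  (rho s' <= ctr s')%N -> (sig s' <= ctr s')%N ->
  (forall a c i, a \in [:: 2; 3; 5]%N -> F a (pairn c i) -> (c <= ctr s')%N) ->
  fresh s'.
Proof.
move=> [_ [_ z]] [mem _] ctrP rhoP sigP FP; split=> //; split=> // a c i aP lt_c.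
rewrite mem ?z //; first exact: leq_ltn_trans ctrP lt_c.
by apply/negP => /(FP _ _ _ aP); rewrite leqNgt lt_c.
Qed.

Lemma setrep_same F s s' S : same F s s' ->
  (forall a i, a \in [:: 2; 3; 6]%N -> ~~ F a (pairn (rho s) i)) ->
  (forall k, k \in [:: v_rho; v_na; v_vol; v_bd] -> ~~ F 1%N k) ->
  setrep G s S -> setrep G s' S.
Proof.
move=> [mem _] Frow Fvar [inS nbrS volS bdS logS log_ord].
have rho' : rho s' = rho s by rewrite mem ?Fvar.
have na' : nmem s' 1 v_na = nmem s 1 v_na by rewrite mem ?Fvar.
constructor; rewrite ?rho' ?na'.
- by move=> w; rewrite mem ?Frow.
- by move=> w; rewrite mem ?Frow.
- by rewrite mem ?Fvar.
- by rewrite mem ?Fvar.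
- by move=> w /logS[i lt_i e]; exists i => //; rewrite mem ?Frow.
- by move=> i /log_ord[w e]; exists w; rewrite mem ?Frow.
Qed.

Definition listed s l := [/\ nmem s 1 v_nch = size l &
  forall i, (i < size l)%N -> nmem s 7 i = nth 0%N [seq val w | w <- l] i].

Lemma new_spec s (v : 'I_n) : fresh s -> nmem s 0 0 = v ->
  wp O p_new s (fun m s' => (m <= 60)%N /\
    same (fun a i => ((a == 1) && (i \in [:: v_ctr; v_rho; v_sig; v_len; v_na; v_vol; v_bd; v_full; v_w; v_d; v_K])) || (a \in [:: 4; 5]))%N s s' /\
    setrep G s' finset.set0 /\ listrep s' [:: v] /\ fresh s' /\
    [/\ nmem s' 1 v_d = deg G v, nmem s' 1 v_K = (2 * deg G v)%N,
       nmem s' 1 v_full = 0%N & nmem s' 1 v_na = 0%N]).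
Proof.
move=> fr ev.
repeat wpstep.
rewrite ev ansO.1.
set s1 := nset _ 1 v_K _.
have same1 : same (fun a i => ((a == 1) && (i \in [:: v_ctr; v_rho; v_sig; v_len; v_na; v_vol; v_bd; v_full; v_w; v_d; v_K])) || (a \in [:: 4; 5]))%N s s1.
  by repeat (apply: same_nset; first by []).
have fr1 : fresh s1.
  case: fr => _ [_ z]; split=> //; split=> // a c i.
  rewrite /s1 /= /upd /= !inE => aP; rewrite addn1 => lt_c.
  have -> : a == 1%N = false by case/or3P: aP => /eqP ->.
  by rewrite /= z // ?inE // ltnW.
have lrep1 : listrep s1 ([::] : seq 'I_n).
  constructor=> // w; case: fr => _ [_ z].
  by rewrite /s1 /= /upd /= z // addn1.
apply: wp_conseq (append_spec (w := v) O lrep1 _) => // m s2 [m_le [same2 lrep2]].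
have sig1 : sig s1 = (ctr s).+1 by rewrite /s1 /= /upd /= addn1.
have rho1 : rho s1 = (ctr s).+1 by rewrite /s1 /= /upd /= addn1.
have ctr1 : ctr s1 = (ctr s).+1 by rewrite /s1 /= /upd /= addn1.
have rho2 : rho s2 = (ctr s).+1 by rewrite same2.1.
split; first lia.
split.
  apply: same_trans same1 (same_sub _ same2) => a i; rewrite /F_append.
  by case/orP => [/andP[/eqP -> /eqP ->]|/andP[-> _]] //; rewrite orbT.
split.
  constructor.
  - move=> w; rewrite rho2 same2.1 //; case: fr => _ [_ z].
    by rewrite /s1 /= /upd /= z // finset.in_set0.
  - move=> w; rewrite rho2 same2.1 //; case: fr => _ [_ z].
    rewrite /s1 /= /upd /= z // nbrE big_pred0 // => x.
    by rewrite finset.in_set0.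
  - by rewrite same2.1 // /vol big_set0.
  - by rewrite same2.1 // boundaryE big_set0.
  - by move=> w; rewrite finset.in_set0.
  - by move=> i; rewrite same2.1.
split=> //; split; last by split; rewrite same2.1.
have ctr2 : ctr s2 = (ctr s).+1 by rewrite same2.1.
have sig2 : sig s2 = (ctr s).+1 by rewrite same2.1.
apply: fresh_same fr1 same2 _ _ _ _; rewrite ?ctr2 ?rho2 ?sig2 ?ctr1 //.
move=> a c i aP; rewrite /F_append inrow_pairn sig1.
by case/orP => [/andP[/eqP e _]|/andP[_ /eqP ->]] //; rewrite e in aP.
Qed.

(** The vertices whose membership depends on the threshold: attachment 0 never enters, attachment
    [2 * deg] never leaves. *)
Definition bordering S u := (0 < att G S u < 2 * deg G u)%N.

Lemma bordering_sdiff K S z u : (z < K)%N -> (forall u, u \in S -> (0 < deg G u)%N) ->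
  u \in sdiff S (lev G K S z) -> bordering S u.
Proof.
move=> lt_z dS; rewrite /sdiff finset.in_setU !finset.in_setD /bordering.
case/orP => /andP[].
  move=> uT uS; have du := dS u uS; rewrite att_in // addn_gt0 du orbT /=.
  rewrite ltn_neqAle -{2}(att_in G uS) att_le andbT.
  apply/eqP => e; move: uT; rewrite inE att_in // e ltn_mul2r muln_gt0 du lt_z.
  by [].
move=> uS uT; have a0 := lev_att uT; rewrite a0 /= att_notin //.
rewrite att_notin // in a0; have := nbr_le_deg G u S; lia.
Qed.

(** Changes are only recorded during the scan, since toggling at once would alter the attachments
    still to be compared. The list is rebuilt from bordering vertices alone, which keeps its size in
    proportion to the boundary. *)
Lemma scan_spec s S l K z : setrep G s S -> listrep s l -> fresh s ->
  (forall u, u \in S -> (0 < deg G u)%N) ->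
  (forall u, bordering S u -> u \in l) ->
  nmem s 1 v_K = K -> nmem s 1 v_z = z -> (z < K)%N ->
  wp O p_scan s (fun m s' => (m <= 60 * (size l).+1)%N /\
    same (F_scan (ctr s).+1) s s' /\ setrep G s' S /\ fresh s' /\
    listrep s' [seq u <- l | bordering S u] /\
    exists ch, [/\ listed s' ch, uniq ch &
      forall u, (u \in ch) = (u \in sdiff S (lev G K S z))]).
Proof.
move=> srep lrep fr dS lS eK ez lt_z.
repeat wpstep.
set s1 := nset _ 1 v_i _.
have F1 : same (F_scan (ctr s).+1) s s1 by repeat (apply: same_nset; first by []).
have fr1 : fresh s1.
  apply: (fresh_same fr F1); rewrite /s1 /= /upd /= ?addn1 //.
    by case: fr => h _; apply: leqW.
  by move=> a c i aP; rewrite /F_scan inrow_pairn => /or3P[/andP[/eqP e _]|/andP[_ /eqP ->]|/eqP e] //; rewrite e in aP.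
have lrep1 : listrep s1 ([::] : seq 'I_n).
  constructor=> // w; case: fr => _ [_ fz].
  by rewrite /s1 /= /upd /= fz // addn1.
pose chg u := u \in sdiff S (lev G K S z).
have osl : nmem s1 1 v_osig = sig s by [].
have [lenl nthl markl unl] := lrep.
apply: (@wp_while R O (fun m s2 => exists j, [/\ nmem s2 1 v_i = j, (j <= size l)%N & (m <= 50 * j)%N] /\
   same (fun a i => F_scan (ctr s).+1 a i && ~~ ((a == 1%N) && (i \in [:: v_ctr; v_sig; v_osig; v_olen]))) s1 s2 /\
   listrep s2 [seq u <- take j l | bordering S u] /\
   listed s2 [seq u <- take j l | chg u]) (fun s2 => size l - nmem s2 1 v_i)%N).
- exists 0%N; rewrite take0; split; first by [].
  split; first exact: same_refl.
  by split.
- move=> m s2 [j [[ej le_j m_le] [same2 [lrep2 [nch2 list2]]]]].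
  have ol2 : nmem s2 1 v_olen = size l by rewrite same2.1.
  rewrite /= ol2 ej -ltnNge => lt_j.
  have os2 : nmem s2 1 v_osig = sig s by rewrite same2.1.
  have rho2 : rho s2 = rho s by rewrite same2.1.
  have K2 : nmem s2 1 v_K = K by rewrite same2.1.
  have z2 : nmem s2 1 v_z = z by rewrite same2.1.
  have sig2 : sig s2 = (ctr s).+1 by rewrite same2.1 // /s1 /= /upd /= addn1.
  have [u dropE] : exists u, drop j l = u :: drop j.+1 l.
    case E: l lt_j => [//|x r]; rewrite -E => lt_j.
    by exists (nth x l j); apply: drop_nth.
  have takeE : take j.+1 l = rcons (take j l) u.
    by rewrite -[in LHS](cat_take_drop j l) dropE -cat_rcons take_size_cat // size_rcons size_takel // ltnW.
  have u_new : u \notin take j l.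
    have := unl; rewrite -{1}(cat_take_drop j l) dropE cat_uniq => /and3P[_ + _].
    by rewrite /= negb_or => /andP[].
  have ul : nmem s2 4 (pairn (sig s) j) = u.
    rewrite same2.1 /s1 /= /upd /= ?nthl //; last first.
      rewrite /F_scan inrow_pairn /= orbF; apply/negP => /andP[/eqP e _].
      by case: fr => _ [+ _]; rewrite -e ltnn.
    by rewrite -(cat_take_drop j l) dropE map_cat nth_cat size_map size_takel ?(ltnW lt_j) // ltnn subnn.
  have in2 w : nmem s2 2 (pairn (rho s) w) = (w \in S).
    by rewrite same2.1 //; apply: (sr_in srep).
  have nbr2 w : nmem s2 3 (pairn (rho s) w) = nbr G w S.
    by rewrite same2.1 //; apply: (sr_nbr srep).
  repeat wpstep; rewrite os2 ej ul rho2 ansO.1 nbr2 in2 -/(att G S u).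
  set s3 := nset _ 1 v_i _; set Fw := fun a i => _ && _ in same2 *.
  have same3 : same Fw s1 s3 by repeat (apply: same_nset; first by []).
  have lrep3 : listrep s3 [seq u0 <- take j l | bordering S u0].
    by case: lrep2 => len2 nth2 mark2 un2; constructor.
  have w3 : nmem s3 1 v_w = u by [].
  have sig3 : sig s3 = (ctr s).+1 by [].
  apply: (@wp_conseq _ _ _ _ (fun m4 s4 => (m4 <= 8)%N /\ same (F_append (ctr s).+1) s3 s4 /\
     listrep s4 [seq u0 <- take j.+1 l | bordering S u0])).
    + move=> m4 s4 [m4_le [same4 lrep4]].
      have same4' : same Fw s1 s4.
        apply: same_trans same3 (same_sub _ same4) => a i.
        rewrite /F_append /Fw /F_scan; case/orP => [/andP[/eqP -> /eqP ->] //|].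
        by case/andP; rewrite !inE => /orP[]/eqP -> ->.
      have [K4 z4 d4 t4] : [/\ nmem s4 1 v_K = K, nmem s4 1 v_z = z,
          nmem s4 1 v_d = deg G u & nmem s4 1 v_t = att G S u].
        by split; rewrite same4.1 // /s3 /= /upd /= ?K2 ?z2 ?rho2 ?nch2.
      have [rho4 u4 nch4] : [/\ rho s4 = rho s, nmem s4 1 v_u = u & nmem s4 1 v_nch = size [seq u0 <- take j l | chg u0]].
        by split; rewrite same4.1 // /s3 /= /upd /= ?K2 ?z2 ?rho2 ?nch2.
      have i4 : nmem s4 1 v_i = j.+1 by rewrite same4.1 // /s3 /= /upd /= addn1.
      have in4 : nmem s4 2 (pairn (rho s) u) = (u \in S) by rewrite same4.1 //; apply: in2.
      have list4 i : (i < size [seq u0 <- take j l | chg u0])%N ->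
         nmem s4 7 i = nth 0%N [seq val w | w <- [seq u0 <- take j l | chg u0]] i.
        by move=> lt_i; rewrite same4.1 //; apply: list2.
      have chgE : chg u = (u \in S) (+) (u \in lev G K S z).
        by rewrite /chg /sdiff finset.in_setU !finset.in_setD; case: (u \in S); case: (u \in lev _ _ _ _).
      have levE : (K * att G S u <= z * (2 * deg G u))%N = (u \notin lev G K S z).
        by rewrite inE -leqNgt.
      have skip_case : chg u = false -> (exists j0 : nat, [/\ nmem s4 1 v_i = j0, (j0 <= size l)%N
           & (j0 = j.+1)%N] /\ same Fw s1 s4 /\
         listrep s4 [seq u0 <- take j0 l | bordering S u0] /\
         listed s4 [seq u0 <- take j0 l | chg u0]).
        move=> cF; exists j.+1; split; first by [].
        split=> //; split=> //; rewrite takeE filter_rcons cF; split=> //.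
      have push_case : chg u -> wp O p_push s4 (fun m5 s5 => (m5 = 3)%N /\ (exists j0 : nat, [/\ nmem s5 1 v_i = j0, (j0 <= size l)%N
           & (j0 = j.+1)%N] /\ same Fw s1 s5 /\
         listrep s5 [seq u0 <- take j0 l | bordering S u0] /\
         listed s5 [seq u0 <- take j0 l | chg u0])).
        move=> cT; repeat wpstep; split=> //; exists j.+1; split; first by [].
        split; first by repeat (apply: same_nset; first by []).
        split; first by case: lrep4 => len4 nth4 mark4 un4; constructor.
        rewrite takeE filter_rcons cT; split; rewrite /= /upd /=.
          by rewrite nch4 size_rcons addn1.
        move=> i; rewrite size_rcons ltnS nch4 u4 map_rcons nth_rcons size_map => le_i.
        by case: ltngtP le_i => // lt_i _; apply: list4.
      apply: wp_if; rewrite /= K4 z4 d4 t4 levE => uT.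
      * apply: wp_if; rewrite /= rho4 u4 -/(pairn _ _) in4 leqn0 eqb0 => uS.
          wpstep; have cF : chg u = false by rewrite chgE (negbTE uS) (negbTE uT).
          have [j0 [[? ? ej0] rest]] := skip_case cF; split; last by rewrite i4; lia.
          by exists j0; split=> //; split=> //; rewrite ej0; lia.
        have cT : chg u by rewrite chgE (negPn uS) (negbTE uT).
        apply: wp_conseq (push_case cT) => m5 s5 [-> [j0 [[i5 ? ej0] rest]]]; split; last by rewrite i5; lia.
        by exists j0; split=> //; split=> //; rewrite ej0; lia.
      * move/negPn in uT; apply: wp_if; rewrite /= rho4 u4 -/(pairn _ _) in4 leqn0 eqb0 => uS.
          have cT : chg u by rewrite chgE (negbTE uS) uT.
          apply: wp_conseq (push_case cT) => m5 s5 [-> [j0 [[i5 ? ej0] rest]]]; split; last by rewrite i5; lia.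
          by exists j0; split=> //; split=> //; rewrite ej0; lia.
        wpstep; have cF : chg u = false by rewrite chgE (negPn uS) uT.
        have [j0 [[? ? ej0] rest]] := skip_case cF; split; last by rewrite i4; lia.
        by exists j0; split=> //; split=> //; rewrite ej0; lia.
    + have bE : teval s3 (And (Not (NLe (var v_t) (NConst 0))) (Not (NLe (NMul (NConst 2) (var v_d)) (var v_t)))) = bordering S u.
        by rewrite /= /upd /= -ltnNge -ltnNge.
      rewrite takeE filter_rcons; apply: wp_if; rewrite bE => buS; last first.
        by wpstep; rewrite (negbTE buS); split.
      rewrite buS; apply: wp_conseq (append_spec O lrep3 w3) => m4 s4 [m4_le [same4 lrep4]].
      rewrite sig3 in same4; split; first by lia.
      split=> //; move: lrep4; rewrite /adjoin mem_filter (negbTE u_new) andbF.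
      by [].
- move=> m s2 [j [[ej le_j m_le] [same2 [lrep2 list2]]]].
  have ol2 : nmem s2 1 v_olen = size l by rewrite same2.1.
  rewrite /= ol2 ej negbK => ge_j.
  have jE : j = size l by apply/eqP; rewrite eqn_leq le_j ge_j.
  rewrite jE take_size in lrep2 list2.
  have same2' : same (F_scan (ctr s).+1) s s2.
    by apply: same_trans F1 (same_sub _ same2) => a i /andP[].
  split; first by rewrite jE in m_le; lia.
  split=> //; split.
    apply: (setrep_same same2' _ _ srep) => [a i|k]; rewrite !inE.
      by case/or3P => /eqP ->.
    by case/or4P => /eqP ->.
  split.
    have ctr2 : ctr s2 = ctr s1 by rewrite same2.1.
    have sig2 : sig s2 = sig s1 by rewrite same2.1.
    have rho2 : rho s2 = rho s1 by rewrite same2.1.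
    have [fr_rho [fr_sig _]] := fr1.
    apply: (fresh_same fr1 same2); rewrite ?ctr2 ?sig2 ?rho2 //.
    move=> a c i aP; rewrite /F_scan inrow_pairn => /andP[/or3P[/andP[/eqP e _]|/andP[_ /eqP <-]|/eqP e] _] //; try by rewrite e in aP.
    by rewrite /s1 /= /upd /= addn1.
  split=> //; exists [seq u <- l | chg u]; split=> //; first exact: filter_uniq.
  move=> u; rewrite mem_filter /chg; case: (boolP (_ \in sdiff _ _)) => // uD.
  exact/lS/(bordering_sdiff lt_z dS uD).
Qed.

Definition toggles S l : {set 'I_n} := [set u | (u \in S) (+) (u \in l)].

Definition visit l u := foldl (@adjoin _) (adjoin l u) (L u).

Definition sdeg l : nat := (\sum_(u <- l) deg G u)%N.

Definition kmul l : nat := (\prod_(u <- l) \prod_(w <- L u) (2 * deg G w))%N.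

Lemma toggles_rcons S l u : u \notin l -> toggle (toggles S l) u = toggles S (rcons l u).
Proof.
move=> ul; apply/setP => w; rewrite in_toggle !inE mem_rcons inE.
by case: eqP => [->|] //=; rewrite (negbTE ul) addbF addbT.
Qed.

Lemma sdeg_rcons l u : sdeg (rcons l u) = (sdeg l + deg G u)%N.
Proof. by rewrite /sdeg -cats1 big_cat big_seq1. Qed.

Lemma kmul_rcons l u : kmul (rcons l u) = (kmul l * \prod_(w <- L u) (2 * deg G w))%N.
Proof. by rewrite /kmul -cats1 big_cat big_seq1. Qed.

Lemma sdeg_take j l : (sdeg (take j l) <= sdeg l)%N.
Proof. by rewrite -{2}(cat_take_drop j l) /sdeg big_cat leq_addr. Qed.

Lemma take_decomp j l u : drop j l = u :: drop j.+1 l -> (j < size l)%N ->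
  take j.+1 l = rcons (take j l) u.
Proof.
move=> dropE lt_j; rewrite -[in LHS](cat_take_drop j l) dropE -cat_rcons.
by rewrite take_size_cat // size_rcons size_takel // ltnW.
Qed.

Lemma drop_decomp j l : (j < size l)%N -> exists u, drop j l = u :: drop j.+1 l.
Proof.
by case E: l => [//|x r] lt_j; exists (nth x (x :: r) j); apply: drop_nth.
Qed.

Lemma nth_decomp j l u : drop j l = u :: drop j.+1 l -> (j < size l)%N ->
  nth 0%N [seq val w | w <- l] j = u.
Proof.
move=> dropE lt_j; rewrite -(cat_take_drop j l) dropE map_cat nth_cat size_map.
by rewrite size_takel ?(ltnW lt_j) // ltnn subnn.
Qed.

Lemma uniq_decomp j l u : uniq l -> drop j l = u :: drop j.+1 l -> u \notin take j l.
Proof.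
move=> un dropE; move: un; rewrite -{1}(cat_take_drop j l) dropE cat_uniq.
by move=> /and3P[_ + _]; rewrite /= negb_or => /andP[].
Qed.

(** The budget is tested before every flip, so an aborted copy never works beyond [B]; yet it aborts
    exactly when the whole batch does not fit, in agreement with [newcost]. *)
Lemma apply_spec s S l ch c B : setrep G s S -> listrep s l -> fresh s ->
  listed s ch -> uniq ch -> (forall u, u \in ch -> (0 < deg G u)%N) ->
  nmem s 1 v_cost = c -> nmem s 1 v_abort = 0%N -> rmem s 1 4 = B -> c%:R <= B ->
  wp O p_apply s (fun m s' => fresh s' /\ same (F_apply (rho s) (sig s)) s s' /\
    if (c + sdeg ch)%:R <= B then
      [/\ nmem s' 1 v_abort = 0%N, nmem s' 1 v_cost = (c + sdeg ch)%N &
          (m <= 200 * sdeg ch + 20)%N] /\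
      [/\ setrep G s' (toggles S ch), listrep s' (foldl visit l ch),
        nmem s' 1 v_K = (nmem s 1 v_K * kmul ch)%N &
        nmem s' 1 v_na = (nmem s 1 v_na + size ch)%N]
    else nmem s' 1 v_abort = 1%N /\
      exists c', [/\ (c <= c')%N, c'%:R <= B & (m + 200 * c <= 200 * c' + 20)%N]).
Proof.
move=> srep lrep fr [nchs lists] un dch ec ab eB le_c.
apply: wp_seq; apply: wp_nset; rewrite [neval s _]/= [neval s _]/=.
set s1 := nset _ _ _ _.
have F1 : same (F_apply (rho s) (sig s)) s s1 by apply: same_nset.
have frF s' : same (F_apply (rho s) (sig s)) s s' -> fresh s'.
  move=> F'; have ctr' : ctr s' = ctr s by rewrite F'.1.
  have sig' : sig s' = sig s by rewrite F'.1.
  have rho' : rho s' = rho s by rewrite F'.1.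
  have [fr_rho [fr_sig _]] := fr.
  apply: (fresh_same fr F'); rewrite ?ctr' ?sig' ?rho' // => a b i aP.
  rewrite /F_apply /F_flip !inrow_pairn orbC => /orP[/andP[/eqP e _]|]; first by rewrite e in aP.
  by case/or3P => [/andP[/eqP e _]|/andP[_ /eqP <-]|/andP[_ /eqP <-]] //; rewrite e in aP.
have keep s' : same (F_apply (rho s) (sig s)) s s' ->
  [/\ rho s' = rho s, sig s' = sig s, nmem s' 1 v_nch = size ch & rmem s' 1 4 = B] /\
  (forall i, (i < size ch)%N -> nmem s' 7 i = nth 0%N [seq val w | w <- ch] i).
  move=> F'; split; first by split; rewrite ?F'.1 ?F'.2.1.
  by move=> i lt_i; rewrite F'.1 ?lists.
apply: (@wp_while R O (fun m s2 => same (F_apply (rho s) (sig s)) s s2 /\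
   exists j, [/\ nmem s2 1 v_i = j & (j <= size ch)%N] /\
   ([/\ nmem s2 1 v_abort = 0%N, nmem s2 1 v_cost = (c + sdeg (take j ch))%N,
        (c + sdeg (take j ch))%:R <= B & (m <= 200 * sdeg (take j ch))%N] /\
    [/\ setrep G s2 (toggles S (take j ch)), listrep s2 (foldl visit l (take j ch)),
        nmem s2 1 v_K = (nmem s 1 v_K * kmul (take j ch))%N &
        nmem s2 1 v_na = (nmem s 1 v_na + j)%N] \/
    [/\ nmem s2 1 v_abort = 1%N, (c + sdeg ch)%:R <= B = false &
      exists c', [/\ (c <= c')%N, c'%:R <= B & (m + 200 * c <= 200 * c' + 15)%N]]))
  (fun s2 => size ch - nmem s2 1 v_i)%N).
- split=> //; exists 0%N; split=> //; left; rewrite take0 /sdeg /kmul !big_nil addn0 muln1.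
  split; first by split.
  have T0 : toggles S [::] = S by apply/setP => w; rewrite inE addbF.
  split=> //; [|by case: lrep => ? ? ? ?; constructor|by rewrite addn0].
  rewrite T0; apply: (setrep_same (F := fun a i => (a == 1%N) && (i == v_i)) _ _ _ srep).
  + by apply: same_nset.
  + by move=> a i; rewrite !inE => /or3P[]/eqP ->.
  + by move=> k; rewrite !inE => /or4P[]/eqP ->.
- move=> m s2 [F2 [j [[ej le_j]]]] [|[ab2 _ _]]; last by rewrite /= ab2 andbF.
  move=> [[ab2 cost2 le_B m_le] [srep2 lrep2 K2 na2]].
  have [[rho2 sig2 nch2 B2] list2] := keep _ F2.
  rewrite /= nch2 ej -ltnNge => /andP[lt_j _].
  have [u dropE] := drop_decomp lt_j.
  have takeE := take_decomp dropE lt_j.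
  have u_new := uniq_decomp un dropE.
  have uch : u \in ch by rewrite -(cat_take_drop j ch) dropE mem_cat inE eqxx orbT.
  repeat wpstep.
  rewrite ej list2 // (nth_decomp dropE lt_j) ansO.1.
  set s3 := nset _ 1 v_i _.
  have F3 : same (F_apply (rho s) (sig s)) s s3.
    by repeat (apply: same_nset; first by []).
  apply: wp_if; rewrite [teval _ _]/= /upd /= B2 cost2.
    move=> le_u; do 2!wpstep.
    set s4 := nset s3 _ _ _.
    have F4 : same (F_apply (rho s) (sig s)) s s4 by apply: same_nset.
    have srep4 : setrep G s4 (toggles S (take j ch)).
      apply: (setrep_same (F := fun a i => (a == 1%N) && (i \in [:: v_u; v_d; v_i; v_cost])) _ _ _ srep2).
      + by repeat (apply: same_nset; first by []).
      + by move=> a i; rewrite !inE => /or3P[]/eqP ->.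
      + by move=> k; rewrite !inE => /or4P[]/eqP ->.
    have lrep4 : listrep s4 (foldl visit l (take j ch)).
      by case: lrep2 => ? ? ? ?; constructor.
    have u4 : nmem s4 1 v_u = u by [].
    apply: wp_conseq (flip_spec adjL ansO srep4 lrep4 u4) => m5 s5 [m5_le [F5 [srep5 [lrep5 [K5 na5]]]]].
    have rho4 : rho s4 = rho s by rewrite F4.1.
    have sig4 : sig s4 = sig s by rewrite F4.1.
    rewrite rho4 sig4 in F5.
    have F5' : same (F_apply (rho s) (sig s)) s s5.
      by apply: same_trans F4 (same_sub _ F5) => a i; rewrite /F_apply => ->.
    have i5 : nmem s5 1 v_i = j.+1 by rewrite F5.1 // /s4 /s3 /= /upd /= addn1.
    split; last by rewrite i5; lia.
    split=> //; exists j.+1; split; first by split.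
    left; rewrite takeE sdeg_rcons kmul_rcons foldl_rcons addnA.
    split; last split=> //.
    + split=> //; first by rewrite F5.1 // /s4 /s3 /= /upd /= ab2.
      * by rewrite F5.1 // /s4 /s3 /= /upd /= cost2.
      * by have := dch u uch; lia.
    + by rewrite -toggles_rcons.
    + by rewrite K5 /s4 /s3 /= /upd /= K2 mulnA.
    + by rewrite na5 /s4 /s3 /= /upd /= na2 addnS.
  move=> gt_u; wpstep; split; last by rewrite ?ej; lia.
  split; first by apply: same_nset F3.
  exists j.+1; split; first by split=> //; rewrite ?ej ?addn1.
  right; split=> //.
    apply/negbTE; apply: contra gt_u => le_ch; apply: le_trans le_ch.
    by rewrite ler_nat -addnA leq_add2l -sdeg_rcons -takeE sdeg_take.
  exists (c + sdeg (take j ch))%N; split=> //; first exact: leq_addr.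
  by lia.
- move=> m s2 [F2 [j [[ej le_j] alt]]]; have [[rho2 sig2 nch2 B2] _] := keep _ F2.
  move=> halt; split; first exact: frF F2.
  split=> //; case: alt halt => [[[ab2 cost2 le_B m_le] [srep2 lrep2 K2 na2]]|[ab2 -> [c' [h1 h2 h3]]]].
    rewrite /= nch2 ej ab2 andbT negbK => ge_j.
    have jE : j = size ch by apply/eqP; rewrite eqn_leq le_j ge_j.
    rewrite jE take_size in cost2 le_B m_le srep2 lrep2 K2; rewrite jE in na2.
    by rewrite le_B; split=> //; split=> //; lia.
  by move=> _; split=> //; exists c'; split=> //; lia.
Qed.

End Phases.

(** * Steps of the coupled process as draws of integers *)

Section PairSteps.
Variables (R : realType) (n : nat) (G : sgraph n).
Implicit Types (S T : {set 'I_n}) (x y : 'I_n) (K c : nat).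

Lemma thresholds_spec K S y : valid G K S -> (0 < att G S y)%N ->
  (0 < thresholds G K S y)%N /\ (thresholds G K S y <= K)%N /\
  forall z, (y \in lev G K S z) = (z < thresholds G K S y)%N.
Proof.
move=> vK a0; have [m mE [mK levE]] := lev_ub y vK.
have d0 : (0 < deg G y)%N by have := att_le G S y; lia.
have tE : thresholds G K S y = m by rewrite /thresholds mE mulnK // muln_gt0.
by rewrite tE; split=> //; have := vK.1; nia.
Qed.

Lemma att_gt0 S x y : x \in S -> (0 < deg G x)%N -> y = x \/ G x y ->
  (0 < att G S y)%N.
Proof.
move=> xS dx [->|Gxy]; first by rewrite att_in // addn_gt0 dx orbT.
rewrite /att addn_gt0; apply/orP; left; apply/card_gt0P; exists x.
by rewrite inE xS edge_sym.
Qed.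

Lemma att_deg S y : (0 < att G S y)%N -> (0 < deg G y)%N.
Proof. by have := att_le G S y; lia. Qed.

Lemma pair_step_cst K S x (f : {set 'I_n} -> 'I_n -> R) b : valid G K S ->
  x \in S -> (0 < deg G x)%N ->
  (forall z y, y \in lev G K S z -> (0 < deg G y)%N -> f (lev G K S z) y = b) ->
  pair_step G K S f x = b.
Proof.
move=> vK xS dx fb; rewrite /pair_step.
have E y : y = x \/ G x y ->
   (\sum_(0 <= z < thresholds G K S y) f (lev G K S z) y) / (thresholds G K S y)%:R = b.
  move=> xy; have a0 := att_gt0 xS dx xy.
  have [t0 [_ levE]] := thresholds_spec vK a0.
  rewrite (eq_big_nat _ _ (F2 := fun=> b)).
    by rewrite sumr_const_nat subn0 -[b *+ _]mulr_natr mulfK // pnatr_eq0 -lt0n.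
  by move=> z /andP[_ lt_z]; apply: fb; [rewrite levE|apply: att_deg a0].
rewrite /wstep E; last by left.
rewrite (eq_bigr (fun=> b)); last by move=> y Gxy; apply: E; right.
rewrite sumr_const.
have -> : #|[pred y | G x y]| = deg G x by rewrite /deg; apply: eq_card => y; rewrite !inE.
have ? : (deg G x)%:R != 0 :> R by rewrite pnatr_eq0 -lt0n.
by rewrite -[b *+ _]mulr_natr; field.
Qed.

(** Costs only grow, so a cost above [B] settles the value. This makes the early abort of the
    program faithful to a process that has no abort. *)
Lemma vpair_over stop (r : {set 'I_n} -> nat -> R) fail (B : R) t S x c K : valid G K S -> x \in S ->
  (0 < deg G x)%N -> (forall S c, B < c%:R -> r S c = fail) -> B < c%:R ->
  vpair G stop r (fun _ _ => fail) t S x c K = fail.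
Proof.
move=> + + + rF; elim: t S x c K => [|t IH] S x c K vK xS dx lt_B /=.
  by case: ifP => // _; apply: rF.
case: ifP => _; first exact: rF.
apply: pair_step_cst => // z y yT dy; apply: IH => //; first exact: valid_lev.
by apply: lt_le_trans lt_B _; rewrite ler_nat /newcost -addnA leq_addr.
Qed.

(** One draw below [2 * deg] realises a lazy step: the lower half stays, the upper half selects a
    neighbour. *)
Lemma wstep_rand (L : 'I_n -> seq 'I_n) (f : 'I_n -> R) x : adjacency_lists G L ->
  (0 < deg G x)%N ->
  wstep G f x = (\sum_(0 <= j < 2 * deg G x)
     f (if (j < deg G x)%N then x else nth x (L x) (j - deg G x))) / (2 * deg G x)%:R.
Proof.
move=> adjL dx; set d := deg G x.
rewrite mul2n -addnn (@big_cat_nat _ _ _ d) ?leq_addr //=.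
rewrite (eq_big_nat _ _ (F2 := fun=> f x)); last by move=> j /andP[_ ->].
have -> : \sum_(d <= j < d + d) f (if (j < d)%N then x else nth x (L x) (j - d)) = \sum_(y | G x y) f y.
  rewrite -{1}[d]add0n big_addn addnK.
  rewrite (eq_bigr (fun j => f (nth x (L x) j))); last first.
    by move=> j _; rewrite ltnNge leq_addl /= addnK.
  rewrite /d -(size_adj adjL) -(big_nth x xpredT f) big_uniq ?(adjL x).1 //=.
  by apply: eq_bigl => y; rewrite (adjL x).2.
have ? : d%:R != 0 :> R by rewrite pnatr_eq0 -lt0n.
rewrite sumr_const_nat subn0 natrD /wstep -/d -[f x *+ _]mulr_natr.
have -> : d%:R + d%:R = 2 * d%:R :> R by ring.
by field.
Qed.

End PairSteps.

Definition r_th := RGet 1 (NConst 0).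
Definition r_h := RGet 1 (NConst 1).
Definition r_D := RGet 1 (NConst 2).
Definition r_cap := RGet 1 (NConst 3).
Definition r_prev := RGet 1 (NConst 5).

Definition t_sparse := RLe (ROfNat (var v_bd)) (RMul r_th (ROfNat (var v_vol))).
Definition t_small := RLe (ROfNat (var v_vol)) r_cap.
Definition t_live :=
  And (NLe (var v_abort) (NConst 0)) (And (Not t_sparse) t_small).

Definition p_walk :=
  If (NLe (var v_d) (var v_t))
    (Neighbour 1 (NConst v_x) (var v_x) (NSub (var v_t) (var v_d))) Skip.

Definition p_att :=
  block [:: Degree 1 (NConst v_d) (var v_x);
            assign v_t (NAdd (NGet 3 (npair (var v_rho) (var v_x)))
                         (NMul (NGet 2 (npair (var v_rho) (var v_x))) (var v_d)))].

Definition p_step :=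
  If (RLe (ROfNat (NAdd (var v_cost) (var v_bd))) r_bound)
    (block [:: Seq (assign v_cost (NAdd (var v_cost) (var v_bd)))
                   (Degree 1 (NConst v_d) (var v_x));
               Rand 1 (NConst v_t) (NMul (NConst 2) (var v_d));
               Seq p_walk p_att;
               Rand 1 (NConst v_z)
                 (NDiv (NMul (var v_K) (var v_t)) (NMul (NConst 2) (var v_d)));
               Seq p_scan p_apply])
    (assign v_abort (NConst 1)).

Definition p_esp := While t_live p_step.

(* Everything but the input, the output, the real numbers and the variables of
   the outer loops. *)
Definition F_copy a i :=
  (a != 0)%N && ~~ ((a == 1) && (i \in [:: v_done; v_jc; v_P; v_rd; v_hub; v_full]))%N.

(** * Simulation of one copy *)

Section Esp.
Variables (R : realType) (n : nat) (G : sgraph n) (L : 'I_n -> seq 'I_n).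
Hypothesis adjL : adjacency_lists G L.
Variable O : oracle.
Hypothesis ansO : answers G L O.
Variable P : nat -> config R -> R -> Prop.
Hypothesis clP : step_closed O P.
Implicit Types (s : state R) (S : {set 'I_n}) (u w x y : 'I_n) (l : seq 'I_n).

Local Notation rho s := (nmem s 1 v_rho).
Local Notation sig s := (nmem s 1 v_sig).
Local Notation ctr s := (nmem s 1 v_ctr).

Lemma closed_seq (w : nat) p q k s b : P w.+1 (p :: q :: k, s) b -> P w (Seq p q :: k, s) b.
Proof. by move=> Pb; apply: (closed_step1 clP _ _ Pb). Qed.

Lemma closed_wp (w : nat) p k s Q b : wp O p s Q ->
  (forall m s', Q m s' -> P (w + m)%N (k, s') b) -> P w (p :: k, s) b.
Proof. by move=> [m [s' [bs q]]] Pb; apply: (closed_bigstep clP bs); apply: Pb. Qed.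

Lemma closed_while (w : nat) b p k s v : teval s b ->
  P w.+1 (p :: While b p :: k, s) v -> P w (While b p :: k, s) v.
Proof.
move=> bT Pv; apply: (@closed_step1 _ _ _ clP _ _ (p :: While b p :: k, s)) => //.
by rewrite /step /= bT.
Qed.

Lemma closed_exit (w : nat) b p k s v : ~~ teval s b ->
  P w.+1 (k, s) v -> P w (While b p :: k, s) v.
Proof.
move=> /negbTE bF Pv; apply: (@closed_step1 _ _ _ clP _ _ (k, s)) => //.
by rewrite /step /= bF.
Qed.

Lemma closed_if (w : nat) b p q k s v :
  P w.+1 ((if teval s b then p else q) :: k, s) v -> P w (If b p q :: k, s) v.
Proof. by move=> Pv; apply: (closed_step1 clP _ _ Pv). Qed.

Lemma closed_rand_eq (m w : nat) a i e k s (f : nat -> R) : neval s e = m ->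
  (0 < m)%N -> (forall j, (j < m)%N -> P w.+1 (k, nset s a (neval s i) j) (f j)) ->
  P w (Rand a i e :: k, s) ((\sum_(0 <= j < m) f j) / m%:R).
Proof. by move=> <- m0 Pf; apply: (closed_rand clP m0 Pf). Qed.

Variables (th cap B : R) (s0 : state R).
Hypothesis th0 : rmem s0 1 0 = th.
Hypothesis cap0 : rmem s0 1 3 = cap.
Hypothesis B0 : rmem s0 1 4 = B.
Hypothesis th_gt0 : 0 < th.

(** [lv_cov] lets the scan ignore all vertices outside the list; [lv_na] bounds the log by the work,
    which later pays for the emission. *)
Record live s S x c K l : Prop := Live {
  lv_set : setrep G s S;
  lv_list : listrep s l;
  lv_fresh : fresh s;
  lv_x : nmem s 1 v_x = x;
  lv_cost : nmem s 1 v_cost = c;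
  lv_K : nmem s 1 v_K = K;
  lv_abort : nmem s 1 v_abort = 0%N;
  lv_valid : valid G K S;
  lv_xS : x \in S;
  lv_deg : forall u, u \in S -> (0 < deg G u)%N;
  lv_cov : forall u, bordering G S u -> u \in l;
  lv_le : c%:R <= B;
  lv_na : (nmem s 1 v_na <= c)%N;
  lv_same : same F_copy s0 s }.

(** Every bordering vertex is an end of a boundary edge, and an edge has two ends. *)
Lemma size_bordering S l : uniq l ->
  (size [seq u <- l | bordering G S u] <= 2 * boundary G S)%N.
Proof.
move=> un; apply: (@leq_trans (\sum_(u in S) nbr G u (~: S) + \sum_(u in ~: S) nbr G u S)%N); last first.
  by rewrite -boundaryE -boundaryCE mul2n addnn.
have := filter_uniq (bordering G S) un => /card_uniqP <-.
apply: (@leq_trans #|[set u | bordering G S u]|).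
  by apply: subset_leq_card; apply/fintype.subsetP => u; rewrite mem_filter inE => /andP[].
rewrite -sum1_card big_mkcond /= (bigID (mem S)) /=; apply: leq_add.
  apply: leq_sum => u uS; rewrite inE; case: ifP => // /andP[_].
  by rewrite att_in //; have := nbr_setC G u S; lia.
rewrite [X in (_ <= X)%N](eq_bigl (fun u => u \notin S)); last by move=> u; rewrite finset.in_setC.
apply: leq_sum => u uS; rewrite inE; case: ifP => // /andP[+ _].
by rewrite att_notin.
Qed.

Lemma size_visits l ch : (forall u, u \in ch -> (0 < deg G u)%N) ->
  (size (foldl (visit L) l ch) <= size l + 2 * sdeg G ch)%N.
Proof.
elim: ch l => [|u ch IH] l dch /=; first by rewrite /sdeg big_nil muln0 addn0.
apply: leq_trans (IH _ _) _.
  by move=> v vch; apply: dch; rewrite inE vch orbT.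
have du : (0 < deg G u)%N by apply: dch; rewrite inE eqxx.
rewrite /sdeg big_cons mulnDr addnA leq_add2r /visit.
apply: leq_trans (size_adjoin _ _) _; rewrite (size_adj adjL) /adjoin.
by case: ifP => _; rewrite ?size_rcons ?addSn -?addnS leq_add2l; lia.
Qed.

Lemma leq_sdeg ch : (forall u, u \in ch -> (0 < deg G u)%N) ->
  (size ch <= sdeg G ch)%N.
Proof.
elim: ch => [|u ch IH] dch //=; rewrite /sdeg big_cons -add1n leq_add //.
  by apply: dch; rewrite inE eqxx.
by apply: IH => v vch; apply: dch; rewrite inE vch orbT.
Qed.

Lemma mem_visits l ch w : (w \in foldl (visit L) l ch) =
  (w \in l) || has (fun u => (w == u) || G u w) ch.
Proof.
elim: ch l => [|u ch IH] l /=; first by rewrite orbF.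
rewrite IH /visit mem_adjoin (adjL u).2 /adjoin !orbA; congr (_ || _ || _).
case: ifP => ul; last by rewrite mem_rcons inE orbC.
by case: eqP => [->|]; rewrite ?ul ?orbF.
Qed.

(** A vertex that is not toggled and has no toggled neighbour keeps its attachment, hence its
    status. *)
Lemma bordering_visits S l ch u : (forall u, bordering G S u -> u \in l) ->
  bordering G (toggles S ch) u ->
  u \in foldl (visit L) [seq v <- l | bordering G S v] ch.
Proof.
move=> cov; rewrite mem_visits mem_filter => bo.
case: (boolP (has _ ch)) => [|/hasPn noch]; first by rewrite orbT.
have E : att G (toggles S ch) u = att G S u.
  have inE' w : w \notin ch -> (w \in toggles S ch) = (w \in S).
    by move=> /negbTE wch; rewrite inE wch addbF.
  have nch w : w \in ch -> (u != w) && ~~ G w u by move=> /noch; rewrite negb_or.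
  rewrite /att inE'; last by apply/negP => /nch; rewrite eqxx.
  congr (_ + _)%N; rewrite !nbrE big_mkcond [RHS]big_mkcond; apply: eq_bigr => w _.
  have [/nch/andP[_ Gwu]|wch] := boolP (w \in ch); last by rewrite inE'.
  by rewrite edge_sym (negbTE Gwu); case: ifP; case: ifP.
have boS : bordering G S u by move: bo; rewrite /bordering E.
by rewrite boS cov.
Qed.

Lemma sdeg_vol ch S : uniq ch -> (forall u, (u \in ch) = (u \in S)) -> sdeg G ch = vol G S.
Proof.
by move=> un chE; rewrite /sdeg big_uniq //=; apply: eq_bigl => u; rewrite chE.
Qed.

Lemma kmul_touch ch S T : uniq ch -> (forall u, (u \in ch) = (u \in sdiff S T)) ->
  kmul G L ch = touch G S T.
Proof.
move=> un chE; rewrite /kmul big_uniq //= /touch.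
transitivity (\prod_(u in sdiff S T) \prod_(w <- L u) (2 * deg G w))%N.
  by apply: eq_bigl => u; apply: chE.
apply: eq_bigr => u _; rewrite big_uniq ?(adjL u).1 //=.
by apply: eq_bigl => w; rewrite (adjL u).2.
Qed.

Lemma toggles_sdiff ch S T : (forall u, (u \in ch) = (u \in sdiff S T)) -> toggles S ch = T.
Proof.
move=> chE; apply/setP => u; rewrite inE chE /sdiff finset.in_setU !finset.in_setD.
by case: (u \in S); case: (u \in T).
Qed.

Lemma rmem_same s : same F_copy s0 s ->
  [/\ rmem s 1 0 = th, rmem s 1 3 = cap & rmem s 1 4 = B].
Proof. by case=> _ [-> _]. Qed.

Lemma t_live_halted s S x c K l : live s S x c K l ->
  teval s t_live = ~~ halted G th cap S.
Proof.
move=> lv; have [eth ecap _] := rmem_same (lv_same lv).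
rewrite /= (lv_abort lv) eth ecap (sr_vol (lv_set lv)) (sr_bd (lv_set lv)) /=.
by rewrite /halted /sparse negb_or -leNgt.
Qed.

Definition F_rand a i := ((a == 1) && (i \in [:: v_cost; v_x; v_d; v_t; v_z]))%N.

Definition F_walk a i := ((a == 1) && (i \in [:: v_x; v_d; v_t]))%N.

Lemma walk_spec s S x j : setrep G s S -> nmem s 1 v_x = x -> nmem s 1 v_d = deg G x ->
  nmem s 1 v_t = j -> (j < 2 * deg G x)%N ->
  let y := if (j < deg G x)%N then x else nth x (L x) (j - deg G x) in
  wp O (Seq p_walk p_att) s (fun m s' => (m <= 10)%N /\ same F_walk s s' /\
    [/\ nmem s' 1 v_x = y, nmem s' 1 v_d = deg G y & nmem s' 1 v_t = att G S y]).
Proof.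
move=> srep ex ed et lt_j y; apply: wp_seq.
apply: (@wp_conseq _ _ _ _ (fun m s1 => m = 2%N /\ s1 = nset s 1 v_x y \/ m = 2%N /\ s1 = s /\ y = x)).
  have dx y' s1 : nmem s1 1 v_x = val (y' : 'I_n) -> setrep G s1 S -> forall m, (m <= 3)%N -> same F_walk s s1 ->
     wp O p_att s1 (fun m0 s2 => ((m + m0).+1 <= 10)%N /\ same F_walk s s2 /\
    [/\ nmem s2 1 v_x = y', nmem s2 1 v_d = deg G y' & nmem s2 1 v_t = att G S y']).
    move=> ex1 srep1 m m_le F1; repeat wpstep.
    rewrite ex1 ansO.1 (sr_nbr srep1) (sr_in srep1); split; first by lia.
    by split=> //; repeat (apply: same_nset; first by []).
  move=> m s1 [[-> ->]|[-> [-> yx]]].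
    apply: dx => //; last by apply: same_nset.
    apply: (setrep_same (F := F_walk) _ _ _ srep).
    - by apply: same_nset.
    - by move=> a i; rewrite !inE => /or3P[]/eqP ->.
    - by move=> i; rewrite !inE => /or4P[]/eqP ->.
  by apply: dx => //; rewrite ex yx.
apply: wp_if; rewrite [teval _ _]/= ed et => le_d.
  have lt_jd : (j - deg G x < deg G x)%N by rewrite ltn_subLR // addnn -mul2n.
  wpstep; rewrite ex ed et; left; split=> //; congr nset.
  have [y' dropE ->] := ansO.2 x _ lt_jd.
  rewrite /y ltnNge le_d /=; congr val.
  by have := nth_drop (j - deg G x) x (L x) 0; rewrite dropE addn0 /= => <-.
by wpstep; right; do 2!split=> //; rewrite /y ltnNge le_d.
Qed.

(** The term [60 * size l] prepays the next scan. Each step has cost at least 1, because a set that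
    has not halted has a nonempty boundary; with [B < c + t] the fuel therefore cannot run out
    before the budget. *)
Lemma esp_loop t S x c K l s tm tm0 r fail k :
  (forall S c, B < c%:R -> r S c = fail) ->
  live s S x c K l -> B < (c + t)%:R -> (tm + 60 * size l <= tm0 + 600 * c)%N ->
  (forall tm' s' S' x' c' K' l', live s' S' x' c' K' l' ->
     halted G th cap S' -> (tm' <= tm0 + 600 * c' + 10)%N -> P tm' (k, s') (r S' c')) ->
  (forall tm' s' c', fresh s' -> same F_copy s0 s' -> nmem s' 1 v_abort = 1%N ->
     c'%:R <= B -> (tm' <= tm0 + 600 * c' + 500)%N -> P tm' (k, s') fail) ->
  P tm (p_esp :: k, s)
    (vpair G (halted G th cap) r (fun _ _ => fail) t S x c K).
Proof.
move=> rF + + + Hhalt Hab.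
elim: t S x c K l s tm => [|t IH] S x c K l s tm lv lt_t le_w.
  by have := lv_le lv; rewrite leNgt -(addn0 c) lt_t.
have liveE := t_live_halted lv.
rewrite /=; case: ifPn => [hS|nh].
  apply: closed_exit; first by rewrite liveE hS.
  by refine (Hhalt _ _ _ _ _ _ _ lv hS _); lia.
have dx : (0 < deg G x)%N by exact: (lv_deg lv (lv_xS lv)).
have vS : (0 < vol G S)%N.
  by rewrite lt0n sum_nat_eq0 negb_forall; apply/existsP; exists x; rewrite (lv_xS lv) -lt0n.
have bd1 : (0 < boundary G S)%N.
  rewrite lt0n; apply/negP => /eqP bd0; move: nh; rewrite (halted_bd0 _ th_gt0) //.
have [eth ecap eB] := rmem_same (lv_same lv).
apply: closed_while; first by rewrite liveE nh.
apply: closed_if; rewrite [teval _ _]/= eB (lv_cost lv) (sr_bd (lv_set lv)).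
case: ifPn => [le_B|]; last first.
  rewrite -ltNge => lt_B.
  (* The program aborts before drawing, whereas the process still makes this step; every outcome of
     it already exceeds the budget. *)
  rewrite (pair_step_cst (b := fail) (lv_valid lv) (lv_xS lv) dx); last first.
    move=> z y yT dy; apply: (vpair_over _ _ _ yT dy rF); first exact: valid_lev (lv_valid lv).
    by apply: lt_le_trans lt_B _; rewrite ler_nat /newcost leq_addr.
  apply: (@closed_wp _ _ _ _ (fun m s' => m = 1%N /\ s' = nset s 1 v_abort 1)).
    by wpstep.
  move=> m s' [-> ->].
  have F1 : same F_copy s0 (nset s 1 v_abort 1) by apply: same_nset (lv_same lv).
  apply: closed_exit; first by [].
  apply: (Hab _ _ c _ F1 _ (lv_le lv)) => //; last by lia.
  apply: (@fresh_same _ (fun a i => (a == 1%N) && (i == v_abort)) _ _ (lv_fresh lv)).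
  - by apply: same_nset.
  - by [].
  - by case: (lv_fresh lv).
  - by case: (lv_fresh lv) => _ [].
  - by move=> a b i; rewrite !inE => /or3P[]/eqP ->.
set F := fun T y => vpair _ _ _ _ _ _ _ _ _.
apply: closed_seq.
apply: (@closed_wp _ _ _ _ (fun m s1 => m = 3%N /\
    s1 = nset (nset s 1 v_cost (c + boundary G S)) 1 v_d (deg G x))).
  by do 3!wpstep; rewrite (lv_cost lv) (sr_bd (lv_set lv)) (lv_x lv) ansO.1.
move=> _ _ [-> ->]; set s1 := nset _ 1 v_d _.
have F1 : same F_rand s s1 by repeat (apply: same_nset; first by []).
apply: closed_seq; rewrite /pair_step (wstep_rand _ adjL dx).
apply: closed_rand_eq; [by []|by rewrite muln_gt0|move=> j lt_j].
set y := if (j < deg G x)%N then _ else _.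
set s2 := nset s1 _ _ _.
have F2 : same F_rand s s2 by apply: same_nset.
have srepF s' : same F_rand s s' -> setrep G s' S.
  move=> F'; apply: (setrep_same F' _ _ (lv_set lv)).
  - by move=> a i; rewrite !inE => /or3P[]/eqP ->.
  - by move=> i; rewrite !inE => /or4P[]/eqP ->.
apply: closed_seq; apply: (closed_wp (walk_spec (x := x) (srepF _ F2) _ _ _ lt_j)) => //.
  exact: lv_x lv.
move=> m3 s3 [m3_le [F23 [x3 d3 t3]]]; rewrite -/y in x3 d3 t3.
have F3 : same F_rand s s3.
  apply: same_trans F2 (same_sub _ F23) => a i; rewrite /F_walk /F_rand !inE.
  by case/andP => -> /or3P[]->; rewrite ?orbT.
have K3 : nmem s3 1 v_K = K by rewrite F3.1 // (lv_K lv).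
have xy : y = x \/ G x y.
  rewrite /y; case: ifPn => le_j; first by left.
  right; rewrite -(adjL x).2 mem_nth // (size_adj adjL); lia.
have ay := att_gt0 (lv_xS lv) dx xy.
have [thr0 [thrK levE]] := thresholds_spec (lv_valid lv) ay.
apply: closed_seq; apply: closed_rand_eq => [|//|z lt_z].
  by rewrite /= K3 t3 d3.
set s4 := nset s3 _ _ _.
have F4 : same F_rand s s4 by apply: same_nset.
have lrep4 : listrep s4 l by apply: (listrep_same F4) (lv_list lv).
have fr4 : fresh s4.
  have ctr4 : ctr s4 = ctr s by rewrite F4.1.
  have sig4 : sig s4 = sig s by rewrite F4.1.
  have rho4 : rho s4 = rho s by rewrite F4.1.
  apply: (fresh_same (lv_fresh lv) F4); rewrite ?ctr4 ?sig4 ?rho4 //.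
  - by case: (lv_fresh lv).
  - by case: (lv_fresh lv) => _ [].
  - by move=> a b i; rewrite !inE => /or3P[]/eqP ->.
have lt_zK : (z < K)%N by apply: leq_trans lt_z _.
have K4 : nmem s4 1 v_K = K by rewrite F4.1 // (lv_K lv).
set T := lev G K S z.
have yT : y \in T by rewrite levE.
have chdeg (ch : seq 'I_n) u : (forall u, (u \in ch) = (u \in sdiff S T)) -> u \in ch -> (0 < deg G u)%N.
  move=> chE; rewrite chE => /(bordering_sdiff lt_zK (lv_deg lv)) /andP[a0 _].
  exact: att_deg a0.
have cost4 : nmem s4 1 v_cost = (c + boundary G S)%N by rewrite /s4 /= /upd /= F23.1.
have abort4 : nmem s4 1 v_abort = 0%N by rewrite F4.1 // (lv_abort lv).
have F4c : same F_copy s0 s4.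
  apply: same_trans (lv_same lv) (same_sub _ F4) => a i; rewrite /F_rand /F_copy.
  by case/andP => /eqP -> /=; rewrite !inE; do 4?[case/orP=> [/eqP -> //|]]; move=> /eqP ->.
have [_ _ eB4] := rmem_same F4c.
pose C := (c + boundary G S)%N.
apply: (@closed_wp _ _ _ _ (fun m s' => fresh s' /\ same F_copy s0 s' /\
  if (newcost G S T c)%:R <= B then
    [/\ nmem s' 1 v_abort = 0%N, nmem s' 1 v_cost = newcost G S T c,
        (m <= 60 * size l + 200 * vol G (sdiff S T) + 100)%N & nmem s' 1 v_x = y] /\
    exists l', [/\ setrep G s' T, listrep s' l',
       (size l' <= 2 * boundary G S + 2 * vol G (sdiff S T))%N,
       nmem s' 1 v_K = (K * touch G S T)%N & forall u, bordering G T u -> u \in l'] /\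
       (nmem s' 1 v_na <= newcost G S T c)%N
  else nmem s' 1 v_abort = 1%N /\
    exists c', [/\ (C <= c')%N, c'%:R <= B & (m + 200 * C <= 200 * c' + 60 * size l + 100)%N])).
  apply: wp_seq; apply: wp_conseq (scan_spec ansO (srepF _ F4) lrep4 fr4 (lv_deg lv) (lv_cov lv) K4 _ lt_zK) => //.
  move=> m5 s5 [m5_le [F5 [srep5 [fr5 [lrep5 [ch [listed5 unch chE]]]]]]].
  have cost5 : nmem s5 1 v_cost = C by rewrite F5.1.
  have abort5 : nmem s5 1 v_abort = 0%N by rewrite F5.1.
  have B5 : rmem s5 1 4 = B by rewrite F5.2.1.
  apply: wp_conseq (apply_spec adjL ansO srep5 lrep5 fr5 listed5 unch _ cost5 abort5 B5 le_B).
    move=> m6 s6 [fr6 [F6 post]]; split=> //; split.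
      apply: same_trans F4c (same_trans (same_sub _ F5) (same_sub _ F6)) => a i.
        rewrite /F_scan /F_copy; case/or3P => [/andP[/eqP -> /=]|/andP[+ _]|/eqP -> //].
          by rewrite !inE; do 10?[case/orP=> [/eqP -> //|]]; move=> /eqP ->.
        by rewrite !inE => /orP[]/eqP ->.
      rewrite /F_apply /F_flip /F_copy; case/orP => [/or3P[/andP[/eqP -> /=]|/andP[+ _]|/andP[+ _]]|/andP[/eqP -> /=]].
      + by rewrite !inE; do 9?[case/orP=> [/eqP -> //|]]; move=> /eqP ->.
      + by rewrite !inE => /orP[]/eqP ->.
      + by rewrite !inE => /or3P[]/eqP ->.
      + by rewrite !inE; do 4?[case/orP=> [/eqP -> //|]]; move=> /eqP ->.
    move: post; rewrite (sdeg_vol unch chE) -/T /newcost -/C; case: ifP => le_C.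
      move=> [[ab6 cost6 m6_le] [srep6 lrep6 K6 na6]]; split.
        split=> //; first by move: m5_le m6_le; clear; lia.
        by rewrite F6.1 // F5.1 // x3.
      exists (foldl (visit L) [seq v <- l | bordering G S v] ch).
      rewrite (toggles_sdiff chE) in srep6; split; last first.
        rewrite na6 F5.1 // F4.1 //.
        apply: leq_trans (leq_add (lv_na lv) (leq_sdeg (fun u => chdeg ch u chE))) _.
        by rewrite (sdeg_vol unch chE) -/T leq_add2r leq_addr.
      split=> //.
      + have sv := size_visits [seq v <- l | bordering G S v] (fun u => chdeg ch u chE).
        rewrite (sdeg_vol unch chE) in sv; apply: (leq_trans sv).
        by rewrite leq_add2r size_bordering // (lr_uniq (lv_list lv)).
      + by rewrite K6 F5.1 // K4 (kmul_touch unch chE).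
      + by move=> u; rewrite -[T](toggles_sdiff chE); apply: bordering_visits (lv_cov lv).
    move=> [ab6 [c' [h1 h2 h3]]]; split=> //; exists c'; split=> //.
    by move: m5_le h3; clear; lia.
  by move=> u; apply: chdeg chE.
move=> m7 s7 [fr7 [F7 post]]; rewrite /F.
case: ifP post => [le_N|/negbT].
  move=> [[ab7 cost7 m7_le x7] [l' [[srep7 lrep7 size7 K7 cov7] na7]]].
  apply: (IH _ _ _ _ l').
  - constructor=> //; first exact: valid_lev (lv_valid lv).
    by move=> u /lev_att; apply: att_deg.
  - by apply: lt_le_trans lt_t _; rewrite ler_nat /newcost; move: bd1; clear; lia.
  - by rewrite /newcost; move: le_w bd1 m3_le m7_le size7; clear; lia.
rewrite -ltNge => lt_N [ab7 [c' [h1 h2 h3]]].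
rewrite (vpair_over _ _ (valid_lev z (lv_valid lv)) yT _ rF lt_N); last exact: att_deg ay.
apply: closed_exit; first by rewrite /= ab7.
apply: (Hab _ _ c' fr7 F7 ab7 h2); rewrite /C in h1 h3.
by move: le_w bd1 m3_le h1 h3; clear; lia.
Qed.

End Esp.

(** * Copies, search and output *)

Definition p_start :=
  block [:: p_new; assign v_x input; assign v_u input; assign v_abort (NConst 0);
            assign v_cost (var v_d);
            If (RLe (ROfNat (var v_cost)) r_bound) p_flip
               (assign v_abort (NConst 1))].

Definition p_copy :=
  Seq p_start (Seq p_esp
    (If (And (NLe (var v_abort) (NConst 0))
          (And t_sparse (And t_small (Not (RLe (ROfNat (var v_cost)) r_prev)))))
       (assign v_done (NConst 1)) Skip)).

(** The vertex that would exceed the volume limit is only remembered: exploring its neighbours could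
    cost far more than the limit, while emitting it takes one step and brings the volume above the
    limit. *)
Definition p_bfs1 :=
  block [:: assign v_u (NGet 4 (npair (var v_sig) (var v_i)));
            Degree 1 (NConst v_d) (var v_u);
            If (NLe (NAdd (var v_vol) (var v_d)) (var v_P))
              (Seq p_flip (assign v_i (NAdd (var v_i) (NConst 1))))
              (Seq (assign v_full (NConst 1)) (assign v_hub (var v_u)))].

Definition p_bfs :=
  block [:: p_new; assign v_i (NConst 0);
            While (And (Not (NLe (var v_len) (var v_i))) (NLe (var v_full) (NConst 0)))
              p_bfs1].

Definition p_emit1 :=
  block [:: assign v_u (NGet 6 (npair (var v_rho) (var v_i)));
            If (NLe (NGet 2 (npair (var v_rho) (var v_u))) (NConst 0))
               Skip (Emit (var v_u));
            assign v_i (NAdd (var v_i) (NConst 1))].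

Definition p_emit :=
  block [:: assign v_i (NConst 0);
            While (Not (NLe (var v_na) (var v_i))) p_emit1;
            If (NLe (var v_full) (NConst 0)) Skip (Emit (var v_hub))].

Definition F_bfs a i :=
  ((a != 0) && ~~ ((a == 1) && (i \in [:: v_done; v_jc; v_P; v_rd])))%N.

Section Copy.
Variables (R : realType) (n : nat) (G : sgraph n) (L : 'I_n -> seq 'I_n).
Hypothesis adjL : adjacency_lists G L.
Variable O : oracle.
Hypothesis ansO : answers G L O.
Implicit Types (s : state R) (S : {set 'I_n}) (u x y v : 'I_n) (l : seq 'I_n).

Local Notation rho s := (nmem s 1 v_rho).
Local Notation sig s := (nmem s 1 v_sig).
Local Notation ctr s := (nmem s 1 v_ctr).

Lemma emit_spec s S (b : nat) : setrep G s S -> nmem s 1 v_full = b ->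
  emitted s = [::] -> (0 < b -> exists u, nmem s 1 v_hub = val (u : 'I_n))%N ->
  wp O p_emit s (fun m s' => (m <= 20 * nmem s 1 v_na + 20)%N /\
    output_set n (emitted s') =
      [set u | (u \in S) || ((0 < b)%N && (nmem s 1 v_hub == u))]).
Proof.
move=> srep eb em hub; do 2!wpstep.
set s1 := nset _ 1 v_i _.
apply: wp_seq.
pose F a i := ((a == 1) && (i \in [:: v_i; v_u]))%N.
apply: (@wp_while R O (fun m s2 => exists j, [/\ nmem s2 1 v_i = j, (j <= nmem s 1 v_na)%N & (m <= 15 * j)%N] /\
   (forall a i, ~~ F a i -> nmem s2 a i = nmem s a i) /\
   forall u, (val u \in emitted s2) =
     (u \in S) && [exists i : 'I_j, nmem s 6 (pairn (rho s) i) == u])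
   (fun s2 => nmem s 1 v_na - nmem s2 1 v_i)%N).
- exists 0%N; split=> //; split=> [a i|u].
    by rewrite /F /s1 /= /upd; case: eqP => //= ->; case: eqP => //= ->.
  rewrite /s1 /= em; apply/esym/negbTE; apply/nandP; right.
  by apply/existsP => -[[]].
- move=> m s2 [j [[ej le_j m_le] [F2 em2]]].
  rewrite /= F2 // ej -ltnNge => lt_j.
  have [u eu] := sr_log_ord srep lt_j.
  repeat wpstep; rewrite ej !F2 // eu.
  apply: wp_if; rewrite /= /upd /= !F2 // -/(pairn _ _) (sr_in srep) leqn0 eqb0 => uS.
    repeat wpstep; rewrite ?ej; split; last by lia.
    exists j.+1; split; first by split=> //; lia.
    split=> [a i nF|w].
      rewrite -F2 //; case: eqP nF => [->|] //=; rewrite /F /= !inE negb_or => /andP[/negbTE -> /negbTE ->] //.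
    rewrite em2; case: (boolP (w \in S)) => //= wS.
    apply/existsP/existsP => -[i /eqP ei].
      by exists (widen_ord (leqnSn j) i); rewrite /= ei.
    have [lt_i|ge_i] := ltnP i j; first by exists (Ordinal lt_i); rewrite /= ei.
    have ij : i = j :> nat by apply/eqP; rewrite eqn_leq ge_i -ltnS ltn_ord.
    by move: ei; rewrite ij eu => /ord_inj e; rewrite e wS in uS.
  move/negPn in uS; apply: wp_emit; rewrite /= /upd /=.
  repeat wpstep; rewrite ?ej; split; last by lia.
  exists j.+1; split; first by split=> //; lia.
  split=> [a i nF|w].
    rewrite -F2 //; case: eqP nF => [->|] //=; rewrite /F /= !inE negb_or => /andP[/negbTE -> /negbTE ->] //.
  rewrite mem_rcons inE em2; case: eqP => [/ord_inj ->|ne] /=.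
    rewrite uS; apply/esym/existsP; exists (Ordinal (ltnSn j)).
    by rewrite /= eu.
  case: (boolP (w \in S)) => //= wS; apply/existsP/existsP => -[i /eqP ei].
    by exists (widen_ord (leqnSn j) i); rewrite /= ei.
  have [lt_i|ge_i] := ltnP i j; first by exists (Ordinal lt_i); rewrite /= ei.
  have ij : i = j :> nat by apply/eqP; rewrite eqn_leq ge_i -ltnS ltn_ord.
  by case: ne; rewrite -ei ij eu.
- move=> m s2 [j [[ej le_j m_le] [F2 em2]]]; rewrite /= F2 // ej negbK => ge_j.
  have jE : j = nmem s 1 v_na by apply/eqP; rewrite eqn_leq le_j ge_j.
  have emS w : (val w \in emitted s2) = (w \in S).
    rewrite em2; case: (boolP (w \in S)) => //= wS.
    have [i lt_i ei] := sr_log srep wS; apply/existsP.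
    by rewrite jE; exists (Ordinal lt_i); rewrite /= ei.
  apply: wp_if; rewrite /= F2 // eb leqn0 => b0.
    wpstep; split; first by lia.
    by apply/setP => w; rewrite !inE emS (eqP b0) orbF.
  have {}b0 : (0 < b)%N by rewrite lt0n.
  have [h eh] := hub b0.
  apply: wp_emit; rewrite /= F2 // eh; split; first by lia.
  by apply/setP => w; rewrite !inE mem_rcons inE emS b0 /= eq_sym orbC.
Qed.

(** [C] contains the component of [v]; quantifying over all such [C] replaces naming the
    component. *)
Definition spans (v : 'I_n) (C : {set 'I_n}) :=
  v \in C /\ forall u w, u \in C -> G u w -> w \in C.

Lemma spans_boundary v C : spans v C -> boundary G C = 0%N.
Proof.
move=> [_ clo]; rewrite boundaryE big1 // => u uC; rewrite nbrE big1 // => w.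
by rewrite finset.in_setC => wC; case: (boolP (G u w)) => // /(clo u w uC); rewrite (negbTE wC).
Qed.

Lemma bfs_spec s v p : fresh s -> nmem s 0 0 = v -> nmem s 1 v_P = p ->
  (0 < deg G v)%N ->
  wp O p_bfs s (fun m s' => exists S, [/\ setrep G s' S, fresh s' & same F_bfs s s'] /\
     [/\ (m <= 200 * p + 200)%N, (nmem s' 1 v_na <= p)%N & (vol G S <= p)%N] /\
   ((nmem s' 1 v_full = 0%N /\ spans v S) \/
    exists u, [/\ nmem s' 1 v_full = 1%N, nmem s' 1 v_hub = u :> nat,
      (p < vol G (u |: S))%N & forall C, spans v C -> u |: S \subset C])).
Proof.
move=> fr ev eP dv; apply: wp_seq; apply: wp_conseq (new_spec ansO fr ev).
move=> m1 s1 [m1_le [F1 [srep1 [lrep1 [fr1 [d1 K1 full1 na1]]]]]].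
do 2!wpstep; set s2 := nset s1 1 v_i 0.
have F2 : same F_bfs s s2.
  apply: same_nset => //; apply: (same_sub _ F1) => a i; rewrite /F_bfs.
  case/orP => [/andP[/eqP -> /=]|]; last by rewrite !inE => /orP[]/eqP ->.
  by rewrite !inE; do 10?[case/orP=> [/eqP -> //|]]; move=> /eqP ->.
have srep2 : setrep G s2 finset.set0.
  apply: (setrep_same (F := fun a i => (a == 1%N) && (i == v_i)) _ _ _ srep1).
  - by apply: same_nset.
  - by move=> a i; rewrite !inE => /or3P[]/eqP ->.
  - by move=> k; rewrite !inE => /or4P[]/eqP ->.
have lrep2 : listrep s2 [:: v] by case: lrep1 => ? ? ? ?; constructor.
have frF s' : same (fun a i => (a == 1) && (i \in [:: v_i; v_u; v_d; v_full; v_hub]) || F_flip (rho s2) (sig s2) a i)%N s2 s' -> fresh s'.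
  move=> F'; have ctr' : ctr s' = ctr s2 by rewrite F'.1.
  have sig' : sig s' = sig s2 by rewrite F'.1.
  have rho' : rho s' = rho s2 by rewrite F'.1.
  have [fr_rho [fr_sig fz]] := fr1.
  have fr2 : fresh s2.
    apply: (@fresh_same _ (fun a i => (a == 1%N) && (i == v_i)) _ _ fr1) => //.
      by apply: same_nset.
    by move=> a b i; rewrite !inE => /or3P[]/eqP ->.
  apply: (fresh_same fr2 F'); rewrite ?ctr' ?sig' ?rho' // => a b i aP.
  rewrite /F_flip !inrow_pairn => /orP[/andP[/eqP e _]|]; first by rewrite e in aP.
  by case/or3P => [/andP[/eqP e _]|/andP[_ /eqP <-]|/andP[_ /eqP <-]] //; rewrite e in aP.
pose F := fun a i => ((a == 1) && (i \in [:: v_i; v_u; v_d; v_full; v_hub]) || F_flip (rho s2) (sig s2) a i)%N.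
apply: (@wp_while R O (fun m s3 => same F s2 s3 /\ exists j l,
   [/\ nmem s3 1 v_i = j, (j <= size l)%N, nmem s3 1 v_na = j,
      listrep s3 l & setrep G s3 (toggles finset.set0 (take j l))] /\
   [/\ v \in l, (forall u w, u \in take j l -> G u w -> w \in l),
     (forall C, spans v C -> {subset l <= C}) & forall u, u \in l -> (0 < deg G u)%N] /\
   let S := toggles finset.set0 (take j l) in
   [/\ (m <= 200 * vol G S + 30)%N, (j <= vol G S)%N & (vol G S <= p)%N] /\
   (nmem s3 1 v_full = 0%N /\ (m <= 200 * vol G S)%N \/
    exists u, [/\ nmem s3 1 v_full = 1%N, nmem s3 1 v_hub = u :> nat,
      u \notin S, u \in l & (p < vol G S + deg G u)%N]))
   (* The flag enters the measure because the iteration that raises it does not advance [v_i]. *)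
   (fun s3 => (2 * n + 1 - 2 * nmem s3 1 v_i - nmem s3 1 v_full))%N).
- split; first exact: same_refl.
  have T0 : toggles finset.set0 (take 0 [:: v]) = finset.set0 :> {set 'I_n}.
    by apply/setP => w; rewrite inE take0 addbF.
  exists 0%N, [:: v]; rewrite T0; split; first by split.
  split; last by rewrite /vol big_set0 muln0; split=> //; left.
  split=> //; first by rewrite inE.
    by move=> C [vC _] w; rewrite inE => /eqP ->.
  by move=> u; rewrite inE => /eqP ->.
- move=> m s3 [F3 [j [l [[ej le_j na3 lrep3 srep3] [[vl Nl sub dl] [[m_le j_le vol_le] alt]]]]]].
  set S := toggles _ _ in srep3 m_le j_le vol_le alt.
  have sig3 : sig s3 = sig s2 by rewrite F3.1.
  have rho3 : rho s3 = rho s2 by rewrite F3.1.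
  have P3 : nmem s3 1 v_P = p by rewrite F3.1 // /s2 /= /upd /= F1.1.
  rewrite /= ej (lr_len lrep3) -ltnNge; case: alt => [[full3 m_le']|[u [full3 _ _ _ _]]]; last first.
    by rewrite full3 andbF.
  rewrite full3 andbT => lt_j.
  have [u dropE] := drop_decomp lt_j.
  have takeE := take_decomp dropE lt_j.
  have u_new := uniq_decomp (lr_uniq lrep3) dropE.
  have ul : u \in l by rewrite -(cat_take_drop j l) dropE mem_cat inE eqxx orbT.
  have uS : u \notin S by rewrite /S inE finset.in_set0.
  have size_l : (size l <= n)%N.
    by have := max_card (mem l); rewrite card_ord (card_uniqP (lr_uniq lrep3)).
  repeat wpstep.
  rewrite ej (lr_nth lrep3) // (nth_decomp dropE lt_j) ansO.1.
  set s4 := nset _ 1 v_d _.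
  have F4 : same F s2 s4 by repeat (apply: same_nset; first by []).
  have srep4 : setrep G s4 S.
    apply: (setrep_same (F := fun a i => (a == 1%N) && (i \in [:: v_u; v_d])%N) _ _ _ srep3).
    + by repeat (apply: same_nset; first by []).
    + by move=> a i; rewrite !inE => /or3P[]/eqP ->.
    + by move=> k; rewrite !inE => /or4P[]/eqP ->.
  apply: wp_if; rewrite [teval _ _]/= /upd /= (sr_vol srep3) P3 => le_P; last first.
    repeat wpstep; split; last by rewrite ?ej ?full3; lia.
    split; first by repeat (apply: same_nset; first by []).
    exists j, l; split.
      split=> //; first by case: lrep3 => ? ? ? ?; constructor.
      apply: (setrep_same (F := fun a i => (a == 1%N) && (i \in [:: v_full; v_hub])%N) _ _ _ srep4).
      + by repeat (apply: same_nset; first by []).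
      + by move=> a i; rewrite !inE => /or3P[]/eqP ->.
      + by move=> k; rewrite !inE => /or4P[]/eqP ->.
    split=> //; rewrite /= -/S; split; first by split=> //; lia.
    by right; exists u; split=> //; rewrite ltnNge.
  have lrep4 : listrep s4 l by case: lrep3 => ? ? ? ?; constructor.
  have u4 : nmem s4 1 v_u = u by [].
  apply: wp_seq; apply: wp_conseq (flip_spec adjL ansO srep4 lrep4 u4).
  move=> m5 s5 [m5_le [F5 [srep5 [lrep5 [_ na5]]]]].
  have sig4 : sig s4 = sig s2 by rewrite F4.1.
  have rho4 : rho s4 = rho s2 by rewrite F4.1.
  rewrite rho4 sig4 in F5.
  have F5' : same F s2 s5.
    by apply: same_trans F4 (same_sub _ F5) => a i; rewrite /F orbC => ->.
  have i5 : nmem s5 1 v_i = j by rewrite F5.1.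
  have full5 : nmem s5 1 v_full = 0%N by rewrite F5.1.
  wpstep; rewrite i5 ?full5; split; last by rewrite ?ej ?full3; lia.
  have lE : adjoin l u = l by rewrite /adjoin ul.
  rewrite lE in lrep5; set l' := foldl _ _ _ in lrep5.
  have memE w : (w \in l') = (w \in l) || G u w by rewrite mem_adjoin (adjL u).2.
  have preE : take j.+1 l' = rcons (take j l) u.
    rewrite -takeE; have := prefix_adjoin l (L u); rewrite -/l' => <-.
    by rewrite take_takel.
  have S'E : toggles finset.set0 (take j.+1 l') = toggle S u.
    by rewrite preE -toggles_rcons.
  have volE : vol G (toggle S u) = (vol G S + deg G u)%N.
    by rewrite vol_toggle (negbTE uS).
  split; first by apply: same_nset F5'.
  have du := dl u ul.
  exists j.+1, l'; rewrite S'E; split.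
    split; rewrite /= /upd /= ?addn1 //.
    + have := size_take j.+1 l'; rewrite preE size_rcons size_takel //.
      by case: ltnP => [/ltnW //|_ <-].
    + by rewrite na5 /s4 /= /upd /= na3.
    + by case: lrep5 => ? ? ? ?; constructor.
    + apply: (setrep_same (F := fun a i => (a == 1%N) && (i == v_i)) _ _ _ srep5).
      * by apply: same_nset.
      * by move=> a i; rewrite !inE => /or3P[]/eqP ->.
      * by move=> k; rewrite !inE => /or4P[]/eqP ->.
  split.
    split.
    + by rewrite memE vl.
    + move=> x w; rewrite preE mem_rcons inE memE => /orP[/eqP -> ->|xl Gxw]; first by rewrite orbT.
      by rewrite (Nl x w xl Gxw).
    + move=> C sC w; rewrite memE => /orP[/(sub C sC) //|Guw].
      by apply: sC.2 Guw; apply: sub.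
    + by move=> w; rewrite memE => /orP[/dl //|Guw]; apply: (@deg_gt0 _ _ w u); rewrite edge_sym.
  split; first by rewrite volE; split; lia.
  left; split=> //; rewrite volE; lia.
- move=> m s3 [F3 [j [l [[ej le_j na3 lrep3 srep3] [[vl Nl sub dl] [[m_le j_le vol_le] alt]]]]]].
  set S := toggles _ _ in srep3 m_le j_le vol_le alt.
  rewrite /= ej (lr_len lrep3) => halt.
  have inS w : (w \in S) = (w \in take j l) by rewrite /S inE finset.in_set0.
  have subS C : spans v C -> S \subset C.
    by move=> sC; apply/fintype.subsetP => w; rewrite inS => /mem_take; apply: sub.
  exists S; split.
    split=> //; first exact: frF F3.
    apply: same_trans F2 (same_sub _ F3) => a i; rewrite /F /F_flip /F_bfs.
    case/orP => [/andP[/eqP -> /=]|/or3P[/andP[/eqP -> /=]|/andP[+ _]|/andP[+ _]]].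
    + by rewrite !inE; do 4?[case/orP=> [/eqP -> //|]]; move=> /eqP ->.
    + by rewrite !inE; do 9?[case/orP=> [/eqP -> //|]]; move=> /eqP ->.
    + by rewrite !inE => /orP[]/eqP ->.
    + by rewrite !inE => /or3P[]/eqP ->.
  split; first by rewrite na3; split=> //; lia.
  case: alt halt => [[full3 _]|[u [full3 hub3 uS ul lt_p]] _]; last first.
    right; exists u; split=> //; first by rewrite /vol big_setU1 //= addnC.
    by move=> C sC; rewrite finset.subUset finset.sub1set subS // andbT; apply: sub.
  rewrite full3 andbT negbK => ge_j; left; split=> //.
  have jE : j = size l by apply/eqP; rewrite eqn_leq le_j ge_j.
  rewrite jE take_size in inS Nl; split=> [|x w]; first by rewrite inS.
  by rewrite !inS; apply: Nl.
Qed.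

Variable P : nat -> config R -> R -> Prop.
Hypothesis clP : step_closed O P.

(** The value of [K] once [v] is inserted: [p_new] sets the first factor and [p_flip] contributes
    those of the neighbours. *)
Definition mult0 v : nat := (2 * deg G v * \prod_(w | G v w) (2 * deg G w))%N.

Lemma valid0 v : (0 < deg G v)%N -> valid G (mult0 v) [set v].
Proof.
move=> dv; rewrite /mult0; split.
  rewrite !muln_gt0 /= dv; apply: prodn_cond_gt0 => w Gvw.
  by rewrite muln_gt0 /=; apply: (@deg_gt0 _ _ w v); rewrite edge_sym.
move=> u; have [->|uv] := eqVneq u v; first by rewrite dvdn_mulr.
rewrite att_notin ?inE // => /nbr_gt0[w]; rewrite inE => /eqP -> Guv.
by rewrite dvdn_mull // (bigD1 u) /=; [exact: dvdn_mulr|rewrite edge_sym].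
Qed.

Lemma start_spec s0 v B : fresh s0 -> nmem s0 0 0 = v -> (0 < deg G v)%N ->
  rmem s0 1 4 = B ->
  wp O p_start s0 (fun m s => same F_bfs s0 s /\ nmem s 1 v_full = 0%N /\ fresh s /\
    if (deg G v)%:R <= B then exists l,
      live G B s s [set v] v (deg G v) (mult0 v) l /\ (m + 60 * size l <= 300 + 600 * deg G v)%N
    else nmem s 1 v_abort = 1%N /\ (m <= 200)%N).
Proof.
move=> fr ev dv eB; apply: wp_seq; apply: wp_conseq (new_spec ansO fr ev).
move=> m1 s1 [m1_le [F1 [srep1 [lrep1 [fr1 [d1 K1 full1 na1]]]]]].
have v1 : nmem s1 0 0 = v by rewrite F1.1.
repeat wpstep; rewrite v1 d1; set s2 := nset _ 1 v_cost _.
have F2 : same F_bfs s0 s2.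
  repeat (apply: same_nset; first by []); apply: (same_sub _ F1) => a i; rewrite /F_bfs.
  case/orP => [/andP[/eqP -> /=]|]; last by rewrite !inE => /orP[]/eqP ->.
  by rewrite !inE; do 10?[case/orP=> [/eqP -> //|]]; move=> /eqP ->.
have B2 : rmem s2 1 4 = B by rewrite F2.2.1.
have F12 : same (fun a i => ((a == 1) && (i \in [:: v_x; v_u; v_abort; v_cost]))%N) s1 s2.
  by repeat (apply: same_nset; first by []).
have fr2 : fresh s2.
  have [fr_rho [fr_sig _]] := fr1.
  apply: (fresh_same fr1 F12) => //.
  by move=> a b i; rewrite !inE => /or3P[]/eqP ->.
apply: wp_if; rewrite [teval _ _]/= /upd /= (F1.2.1) eB => le_B; last first.
  wpstep; rewrite (negbTE le_B); split; first by apply: same_nset F2.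
  split; first by rewrite full1.
  split; last by split=> //; lia.
  apply: (@fresh_same _ (fun a i => (a == 1%N) && (i == v_abort)) _ _ fr2) => //.
  - by apply: same_nset.
  - by case: fr2.
  - by case: fr2 => _ [].
  - by move=> a b i; rewrite !inE => /or3P[]/eqP ->.
rewrite le_B.
have srep2 : setrep G s2 finset.set0.
  apply: (setrep_same F12 _ _ srep1).
  - by move=> a i; rewrite !inE => /or3P[]/eqP ->.
  - by move=> k; rewrite !inE => /or4P[]/eqP ->.
have lrep2 : listrep s2 [:: v] by case: lrep1 => ? ? ? ?; constructor.
have u2 : nmem s2 1 v_u = v by [].
apply: wp_conseq (flip_spec adjL ansO srep2 lrep2 u2).
move=> m3 s3 [m3_le [F3 [srep3 [lrep3 [K3 na3]]]]].
have F3' : same F_bfs s0 s3.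
  apply: same_trans F2 (same_sub _ F3) => a i; rewrite /F_flip /F_bfs.
  case/or3P => [/andP[/eqP -> /=]|/andP[+ _]|/andP[+ _]].
  + by rewrite !inE; do 9?[case/orP=> [/eqP -> //|]]; move=> /eqP ->.
  + by rewrite !inE => /orP[]/eqP ->.
  + by rewrite !inE => /or3P[]/eqP ->.
have fr3 : fresh s3.
  have ctr3 : ctr s3 = ctr s2 by rewrite F3.1.
  have sig3 : sig s3 = sig s2 by rewrite F3.1.
  have rho3 : rho s3 = rho s2 by rewrite F3.1.
  have [fr_rho [fr_sig _]] := fr2.
  apply: (fresh_same fr2 F3); rewrite ?ctr3 ?sig3 ?rho3 // => a b i aP.
  rewrite /F_flip !inrow_pairn.
  by case/or3P => [/andP[/eqP e _]|/andP[_ /eqP <-]|/andP[_ /eqP <-]] //; rewrite e in aP.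
split=> //; split; first by rewrite F3.1.
split=> //; have T0 : toggle finset.set0 v = [set v].
  by apply/setP => w; rewrite in_toggle !inE addbF.
rewrite T0 in srep3; set l := foldl _ _ _ in lrep3.
have memE w : (w \in l) = (w == v) || G v w.
  by rewrite mem_adjoin (adjL v).2 /adjoin inE eqxx inE.
have size_l : (size l <= 1 + deg G v)%N.
  by apply: leq_trans (size_adjoin _ _) _; rewrite /adjoin inE eqxx (size_adj adjL).
exists l; split; last first.
  apply: leq_trans (leq_add (leqnn _) (_ : (_ <= 60 * (1 + deg G v))%N)) _.
    by rewrite leq_mul2l.
  by lia.
constructor=> //.
- by rewrite F3.1.
- by rewrite F3.1.
- rewrite K3 /s2 /= /upd /= K1 /mult0 big_uniq ?(adjL v).1 //=; congr muln.
  by apply: eq_bigl => w; rewrite (adjL v).2.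
- by rewrite F3.1.
- exact: valid0.
- by rewrite inE.
- by move=> u; rewrite inE => /eqP ->.
- move=> u /andP[a0 _]; rewrite memE.
  have [->//|uv] := eqVneq u v.
  move: a0; rewrite att_notin ?inE // => /nbr_gt0[w]; rewrite inE => /eqP -> Guv.
  by rewrite edge_sym Guv orbT.
- by rewrite na3 /s2 /= /upd /= na1; lia.
Qed.

Variables (th cap B Bp : R) (s0 : state R) (v : 'I_n) (tm0 : nat) (k : seq cmd).
Variables (rS : {set 'I_n} -> nat -> R) (fail : R).
Hypotheses (th0 : rmem s0 1 0 = th) (cap0 : rmem s0 1 3 = cap).
Hypotheses (B0 : rmem s0 1 4 = B) (Bp0 : rmem s0 1 5 = Bp).
Hypotheses (fr0 : fresh s0) (ev : nmem s0 0 0 = v) (dv : (0 < deg G v)%N).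
Hypothesis th_gt0 : 0 < th.

Definition accept S c := [&& success G th cap S, Bp < c%:R & c%:R <= B].

(** Continuation style: [rS] and [fail] are the values of what follows an accepted and a failed
    copy, so the values of rounds can be composed from those of copies. *)
Lemma copy_spec t : B < (deg G v + t)%:R -> 0 <= B ->
  (forall tm s S c, setrep G s S -> nmem s 1 v_full = 0%N -> nmem s 1 v_done = 1%N ->
     (forall a i, (a == 0) || (a == 1) && (i \in [:: v_jc; v_P; v_rd])  -> nmem s a i = nmem s0 a i)%N ->
     rmem s = rmem s0 -> emitted s = emitted s0 ->
     (nmem s 1 v_na <= c)%N ->
     (0 < vol G S)%N -> accept S c -> (tm <= tm0 + 600 * c + 1000)%N ->
     P tm (k, s) (rS S c)) ->
  (forall tm s c, fresh s -> same F_bfs s0 s -> c%:R <= B ->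
     (tm <= tm0 + 600 * c + 1000)%N -> P tm (k, s) fail) ->
  P tm0 (p_copy :: k, s0)
    (vbar G (halted G th cap) (fun S c => if accept S c then rS S c else fail)
       (fun _ _ => fail) t [set v] (deg G v) (mult0 v)).
Proof.
move=> lt_t B_ge0 Hsucc Hfail.
set r := fun S c => _.
have rF S c : B < c%:R -> r S c = fail.
  by rewrite /r /accept ltNge => /negbTE ->; rewrite !andbF.
(* The program follows the coupled process; started from a single vertex, its value is that of the
   set process alone. *)
rewrite -vpair1 //; last exact: valid0.
apply: (closed_seq clP).
apply: (closed_wp clP (start_spec fr0 ev dv B0)) => m1 s1 [F1 [full1 [fr1 post]]].
have [th1 cap1 B1 Bp1] : [/\ rmem s1 1 0 = th, rmem s1 1 3 = cap, rmem s1 1 4 = B & rmem s1 1 5 = Bp].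
  by rewrite F1.2.1.
apply: (closed_seq clP).
have FC s : same F_copy s1 s -> same F_bfs s0 s.
  move=> Fs; apply: same_trans F1 (same_sub _ Fs) => a i; rewrite /F_copy /F_bfs.
  case/andP => -> /=; apply: contra => /andP[-> /=]; rewrite !inE.
  by do 3?[case/orP=> [->|]; rewrite ?orbT //]; move=> ->; rewrite ?orbT.
have failP tm s c : same F_copy s1 s -> fresh s -> c%:R <= B -> 
  nmem s 1 v_abort = 1%N \/ (exists S, setrep G s S /\ nmem s 1 v_cost = c /\ ~~ accept S c) ->
  (tm <= tm0 + 600 * c + 900)%N -> 
  P tm (If (And (NLe (var v_abort) (NConst 0))
          (And t_sparse (And t_small (Not (RLe (ROfNat (var v_cost)) r_prev)))))
       (assign v_done (NConst 1)) Skip :: k, s) fail.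
  move=> Fs frs le_c alt tm_le; apply: (closed_if clP).
  have es : rmem s = rmem s1 by case: Fs => _ [].
  have -> : teval s (And (NLe (var v_abort) (NConst 0))
          (And t_sparse (And t_small (Not (RLe (ROfNat (var v_cost)) r_prev))))) = false.
    case: alt => [ab|[S [srep [cost nacc]]]]; first by rewrite /= ab.
    rewrite /= es th1 cap1 Bp1 (sr_vol srep) (sr_bd srep) cost; apply/negbTE.
    apply: contra nacc => /andP[_ /and3P[h1 h2 h3]].
    by rewrite /accept /success /sparse h1 h2 le_c ltNge h3.
  apply: (closed_wp clP (Q := fun m s' => m = 1%N /\ s' = s)); first by wpstep.
  move=> _ _ [-> ->]; apply: (Hfail _ _ c) => //; first exact: FC.
  lia.
have same1 : same F_copy s1 s1 by apply: same_refl.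
case: ifP post => [le_B [l [lv tm_le]]|/negbT]; last first.
  rewrite -ltNge => lt_B [ab m_le].
  rewrite (vpair_over _ _ (valid0 dv) _ dv rF lt_B) ?inE //.
  apply: (closed_exit clP); first by rewrite /= ab.
  by apply: (failP _ _ 0%N) => //; [left|lia].
apply: (esp_loop adjL ansO clP th1 cap1 B1 th_gt0 (tm0 := (tm0 + 310)%N) rF lv lt_t).
- lia.
- move=> tm s S x c K l' lvs hS tm_le'.
  have Fs := lv_same lvs.
  have es : rmem s = rmem s1 by case: Fs => _ [].
  rewrite /r; case: ifPn => [acc|nacc]; last first.
    apply: (failP _ _ c) => //; [exact: lv_fresh lvs|exact: lv_le lvs| |lia].
    by right; exists S; split; [exact: lv_set lvs|split; [exact: lv_cost lvs|]].
  apply: (closed_if clP).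
  have -> : teval s (And (NLe (var v_abort) (NConst 0))
          (And t_sparse (And t_small (Not (RLe (ROfNat (var v_cost)) r_prev))))) = true.
    case/and3P: acc => /andP[h1 h2] h3 _.
    rewrite /= es th1 cap1 Bp1 (sr_vol (lv_set lvs)) (sr_bd (lv_set lvs)) (lv_cost lvs) (lv_abort lvs).
    by rewrite /= -ltNge h3 h2 andbT /= [_ <= _]h1.
  apply: (closed_wp clP (Q := fun m s' => m = 1%N /\ s' = nset s 1 v_done 1)); first by wpstep.
  move=> _ _ [-> ->].
  have Fs' := FC s Fs.
  apply: Hsucc => //.
  + apply: (setrep_same (F := fun a i => (a == 1%N) && (i == v_done)) _ _ _ (lv_set lvs)).
    * by apply: same_nset.
    * by move=> a i; rewrite !inE => /or3P[]/eqP ->.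
    * by move=> i; rewrite !inE => /or4P[]/eqP ->.
  + by rewrite /= /upd /= Fs.1.
  + move=> a i; case/orP => [/eqP ->|/andP[/eqP ->]]; rewrite /= /upd /=.
      by rewrite Fs'.1.
    by rewrite !inE => /or3P[]/eqP ->; rewrite /= Fs'.1.
  + by rewrite /= es F1.2.1.
  + by rewrite /=; case: Fs' => _ [].
  + exact: lv_na lvs.
  + rewrite lt0n sum_nat_eq0 negb_forall; apply/existsP; exists x.
    by rewrite (lv_xS lvs) -lt0n (lv_deg lvs (lv_xS lvs)).
  + lia.
- move=> tm s c frs Fs ab le_c tm_le'.
  by apply: (failP _ _ c) => //; [left|lia].
Qed.

End Copy.

(** * Rounds *)

Definition p_tail :=
  block [:: RSet 1 (NConst 5) r_bound;
            assign v_rd (NAdd (var v_rd) (NConst 1));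
            assign v_P (NMul (NConst 2) (var v_P));
            RSet 1 (NConst 4) (RMul (RMul r_D (ROfNat (NAdd (var v_rd) (NConst 1))))
                                    (ROfNat (var v_P)))].

Definition p_copies :=
  While (And (NLe (var v_done) (NConst 0)) (RLe (ROfNat (var v_jc)) r_h))
    (Seq (assign v_jc (NAdd (var v_jc) (NConst 1))) p_copy).

Definition p_fallback :=
  If (NLe (var v_done) (NConst 0))
    (Seq p_bfs
       (If (And (Not (NLe (var v_full) (NConst 0)))
                (Not (RLe r_cap (ROfNat (var v_P)))))
          Skip (assign v_done (NConst 1))))
    Skip.

Definition p_round :=
  Seq (assign v_jc (NConst 0)) (Seq p_copies (Seq p_fallback p_tail)).

Definition p_rounds := While (NLe (var v_done) (NConst 0)) p_round.

Lemma natr_le_lin (R : realType) (m a k c l : nat) :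
  (m <= a + k * c + l)%N -> m%:R <= a%:R + k%:R * c%:R + l%:R :> R.
Proof. by rewrite -natrM -!natrD ler_nat. Qed.

Section Arithmetic.
Variables (R : realFieldType) (N B B' c j p t t' : R).
Hypotheses (B_ge : 1000 <= B) (NB : B <= N * B).

Lemma start_time : t <= 700 * N * B -> t' <= t + 0%:R * 0%:R + 4 ->
  t' <= 700 * N * B + 602 * 0%:R * B + 10.
Proof. by move: B_ge NB; lra. Qed.

Lemma copy_time : t <= 700 * N * B + 602 * j * B + 10 -> c <= B ->
  t' <= t + 600 * c + 1010 -> t' <= 700 * N * B + 602 * (j + 1) * B + 10.
Proof. by move: B_ge NB; rewrite mulrDr mulrDl mulr1; lra. Qed.

Lemma success_time : t <= 700 * N * B + 602 * j * B + 10 -> c <= B ->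
  j * B <= N * B -> t' <= t + 620 * c + 1100 -> t' <= 2000 * N * B.
Proof. by move: B_ge NB; lra. Qed.

Lemma fallback_time : t <= 700 * N * B + 602 * N * B + 10 -> 1000 * p <= B ->
  t' <= t + 220 * p + 500 -> t' <= 1400 * N * B.
Proof. by move: B_ge NB; lra. Qed.

(** The time up to the end of a round is at most [1400 * N * B]; since budgets at least double, the
    bound [700 * N * B'] holds again at the next start. *)
Lemma next_time : t <= 1400 * N * B -> 2 * B <= B' -> 0 <= N ->
  t <= 700 * N * B'.
Proof. by move=> h h' N0; have := ler_wpM2l N0 h'; lra. Qed.

End Arithmetic.

Section Rounds.
Variables (R : realType) (n : nat) (G : sgraph n) (L : 'I_n -> seq 'I_n).
Hypothesis adjL : adjacency_lists G L.
Variable O : oracle.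
Hypothesis ansO : answers G L O.
Implicit Types (s : state R) (S C : {set 'I_n}).

Variable P : nat -> config R -> R -> Prop.
Hypothesis clP : step_closed O P.
Variable dir : R -> R -> Prop.
Hypothesis dirP : forall tm c b b', dir b b' -> P tm c b -> P tm c b'.
Variable rew : nat -> {set 'I_n} -> R -> Prop.
Hypothesis rewP : forall tm s b, rew tm (output_set n (emitted s)) b -> P tm ([::], s) b.

Variables (v : 'I_n) (th h D cap : R) (N : nat).
Hypothesis dv : (0 < deg G v)%N.
Hypothesis th_gt0 : 0 < th.
Hypothesis N_gt0 : (0 < N)%N.
Hypothesis hN : forall j, (j%:R <= h) = (j < N)%N.
Hypothesis D_ge : 1000 <= D.

(* [prev_budget] starts at [-1] so that the work 0 would be accepted in round 0. *)
Definition budget i : R := D * i.+1%:R * (2 ^ i)%:R.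
Definition prev_budget i : R := if i is i'.+1 then budget i' else -1.

Lemma budget_double i : 2 * budget i <= budget i.+1.
Proof.
rewrite /budget expnS natrM mulrCA -!mulrA ler_wpM2l //; first by move: D_ge; lra.
by rewrite ler_wpM2r ?mulr_ge0 // ler_nat.
Qed.

Lemma budget_ge i : 1000 * (2 ^ i)%:R <= budget i.
Proof.
rewrite /budget ler_wpM2r //; apply: le_trans D_ge _.
by rewrite ler_peMr ?ler1n //; move: D_ge; lra.
Qed.

Lemma budget_ge1000 i : 1000 <= budget i.
Proof.
have : 1 <= (2 ^ i)%:R :> R by rewrite ler1n expn_gt0.
by have := budget_ge i; lra.
Qed.

(** What the searches of earlier rounds have shown about the component of [v]. Applied to all
    vertices it bounds the number of rounds; applied to the output it pays for the budget. *)
Definition large i S := if i is i'.+1 then (2 ^ i' < vol G S)%N else (0 < vol G S)%N.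

Definition fallback i S := [/\ (0 < vol G S)%N, large i S,
  i = 0%N \/ (2 ^ i.-1)%:R < cap &
  cap <= (2 ^ i)%:R \/ boundary G S = 0%N /\ (vol G S <= 2 ^ i)%N].

Definition accepted i := accept G th cap (budget i) (prev_budget i).

Variables (V : nat -> nat -> R) (rS : nat -> {set 'I_n} -> nat -> R) (fuel : nat -> nat).
Hypothesis fuelP : forall i, budget i < (deg G v + fuel i)%:R.
Hypothesis V_copy : forall i m, (m < N)%N -> (forall C, spans G v C -> large i C) -> dir
  (vbar G (halted G th cap)
     (fun S c => if accepted i S c then rS i S c else V i m) (fun _ _ => V i m)
     (fuel i) [set v] (deg G v) (mult0 G v)) (V i m.+1).
Hypothesis V_next : forall i, (2 ^ i)%:R < cap ->
  (forall C, spans G v C -> large i.+1 C) -> dir (V i.+1 N) (V i 0).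
Hypothesis V_success : forall i S c tm, (0 < vol G S)%N -> accepted i S c ->
  tm%:R <= 2000 * N%:R * budget i -> rew tm S (rS i S c).
Hypothesis V_fallback : forall i S tm, fallback i S ->
  tm%:R <= 2000 * N%:R * budget i -> rew tm S (V i 0).

Definition reals s i := [/\ rmem s 1 0 = th, rmem s 1 1 = h & rmem s 1 2 = D] /\
  [/\ rmem s 1 3 = cap, rmem s 1 4 = budget i & rmem s 1 5 = prev_budget i].

Definition at_round s i := [/\ fresh s, nmem s 0 0 = v, emitted s = [::] & reals s i] /\
  [/\ nmem s 1 v_P = (2 ^ i)%N, nmem s 1 v_rd = i & nmem s 1 v_done = 0%N].

Lemma finish s S (b : nat) tm x : setrep G s S -> nmem s 1 v_done = 1%N ->
  nmem s 1 v_full = b -> emitted s = [::] ->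
  (0 < b -> exists u : 'I_n, nmem s 1 v_hub = u)%N ->
  (forall tm', (tm' <= tm + 20 * nmem s 1 v_na + 60)%N ->
     rew tm' [set u | (u \in S) || ((0 < b)%N && (nmem s 1 v_hub == u))] x) ->
  P tm ([:: p_tail; p_rounds; p_emit], s) x.
Proof.
move=> srep ed eb em hub rewx.
pose Q m s' := [/\ m = 7%N, nmem s' 1 v_done = 1%N, nmem s' 1 v_hub = nmem s 1 v_hub,
    nmem s' 1 v_na = nmem s 1 v_na & emitted s' = [::]] /\
   setrep G s' S /\ nmem s' 1 v_full = b.
have wt : wp O p_tail s Q.
  rewrite /p_tail /=; apply: wp_seq; apply: wp_rset => /=.
  do 4!wpstep; apply: wp_rset => /=; rewrite /Q /=; split; first by split.
  by split=> //; case: srep => *; constructor.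
apply: (closed_wp clP wt) => _ s1 [[-> ed1 hub1 na1 em1] [srep1 eb1]].
apply: (closed_exit clP); first by rewrite /= ed1.
rewrite -hub1 in hub rewx; rewrite -na1 in rewx.
apply: (closed_wp clP (emit_spec O srep1 eb1 em1 hub)) => m s2 [m_le outE].
by apply: rewP; rewrite outE; apply: rewx; lia.
Qed.

Lemma NR1 : 1 <= N%:R :> R. Proof. by rewrite ler1n. Qed.

(** [V i m] is the value of the run when [m] copies of round [i] are left, so [V i 0] is its value
    at the search. The direction [dir] and the reward relation [rew] are abstract to serve upper and
    lower bounds alike. *)
Lemma rounds_spec M i s tm : cap <= (2 ^ M)%:R -> (i <= M.+1)%N ->
  (i = 0%N \/ (2 ^ i.-1)%:R < cap) -> at_round s i ->
  (forall C, spans G v C -> large i C) -> tm%:R <= 700 * N%:R * budget i ->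
  P tm ([:: p_rounds; p_emit], s) (V i N).
Proof.
move=> capM; have [d] := ubnP (M.+1 - i)%N; elim: d i s tm => // d IH i s tm lt_d le_i capi.
move=> [[fr ev em rl] [eP erd ed]] exC tm_le.
have Bi := budget_ge1000 i; have B2 := budget_ge i; have N1 := NR1.
have B_ge0 : 0 <= budget i by apply: le_trans Bi; rewrite ler0n.
have NB : budget i <= N%:R * budget i by rewrite ler_peMl.
apply: (closed_while clP); first by rewrite /= ed.
apply: (closed_seq clP); apply: (closed_wp clP (Q := fun m s' => m = 1%N /\ s' = nset s 1 v_jc 0)).
  by wpstep.
move=> _ _ [-> ->]; apply: (closed_seq clP).
have small_tm (m : nat) (x : R) : m%:R <= x -> forall m', (m' <= m)%N -> m'%:R <= x.
  by move=> le_x m' le_m; apply: le_trans le_x; rewrite ler_nat.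
have same_at F s1 s2 j : same F s1 s2 -> (forall k, k \in [:: v_P; v_rd; v_done] -> ~~ F 1%N k) ->
  (forall k, ~~ F 0%N k) -> fresh s2 -> at_round s1 j -> at_round s2 j.
  move=> Fs F1 F0 fr2 [[_ ev1 em1 [[r1 r2 r3] [r4 r5 r6]]] [e1 e2 e3]].
  have [mem [erm eem]] := Fs.
  split; last by split; rewrite mem ?F1.
  by split=> //; [rewrite mem ?F0|rewrite eem|split; rewrite erm].
have at_jc s1 j m : at_round s1 j -> at_round (nset s1 1 v_jc m) j.
  move=> ar; apply: (same_at (fun a i => (a == 1%N) && (i == v_jc)) _ _ _ _ _ _ _ ar) => //.
  - by apply: same_nset.
  - by move=> k; rewrite !inE => /or3P[]/eqP ->.
  case: ar => [[fr1 _ _ _] _].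
  apply: (@fresh_same _ (fun a i => (a == 1%N) && (i == v_jc)) _ _ fr1) => //.
  - by apply: same_nset.
  - by case: fr1.
  - by case: fr1 => _ [].
  - by move=> a b k; rewrite !inE => /or3P[]/eqP ->.
suff copies tm1 s1 j : nmem s1 1 v_jc = j -> (j <= N)%N -> at_round s1 i ->
    tm1%:R <= 700 * N%:R * budget i + 602 * j%:R * budget i + 10 ->
    P tm1 ([:: p_copies, Seq p_fallback p_tail, p_rounds & [:: p_emit]], s1) (V i (N - j)).
  rewrite -[in X in P _ _ X](subn0 N).
  apply: copies; [by []|by []|exact: at_jc|].
  have : ((tm.+2 + 1).+1 <= tm + 0 * 0 + 4)%N by clear; lia.
  by move=> /(natr_le_lin R); apply: start_time.
have [e] := ubnP (N - j)%N; elim: e j tm1 s1 => // e IHe j tm1 s1 lt_e ej le_j ar tm1_le.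
have [[fr1 ev1 em1 [[r1 r2 r3] [r4 r5 r6]]] [e1 e2 e3]] := ar.
have [lt_j|ge_j] := ltnP j N.
  apply: (closed_while clP); first by rewrite /= e3 ej r2 hN lt_j.
  apply: (closed_seq clP).
  apply: (closed_wp clP (Q := fun m s' => m = 1%N /\ s' = nset s1 1 v_jc j.+1)).
    by wpstep; rewrite ej addn1.
  move=> _ _ [-> ->]; set s2 := nset _ _ _ _.
  have ar2 : at_round s2 i by apply: at_jc.
  have [[fr2 ev2 em2 [[q1 q2 q3] [q4 q5 q6]]] [g1 g2 g3]] := ar2.
  have -> : (N - j = (N - j.+1).+1)%N by rewrite subnSK.
  have lt_m : (N - j.+1 < N)%N by move: lt_j; clear; lia.
  apply: dirP (V_copy lt_m exC) _.
  apply: (copy_spec adjL ansO clP q1 q4 q5 q6 fr2 ev2 dv th_gt0 (fuelP i)).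
  - exact: B_ge0.
  - move=> tm3 s3 S c srep3 full3 done3 keep3 rm3 em3 na3 vS acc tm3_le.
    have le_c : c%:R <= budget i by case/and3P: acc.
    have nhub : (0 < 0 -> exists u : 'I_n, nmem s3 1 v_hub = u)%N by [].
    apply: (closed_exit clP); first by rewrite /= done3.
    apply: (closed_seq clP); apply: (closed_if clP); rewrite /= done3 /=.
    apply: (closed_wp clP (Q := fun m s' => m = 1%N /\ s' = s3)); first by wpstep.
    move=> _ _ [-> ->]; apply: (finish srep3 done3 full3 _ nhub); first by rewrite em3.
    move=> tm4 tm4_le.
    have -> : [set u | (u \in S) || (0 < 0)%N && (nmem s3 1 v_hub == u)] = S.
      by apply/setP => u; rewrite inE orbF.
    have jN : j%:R * budget i <= N%:R * budget i.
      by rewrite ler_wpM2r // ler_nat ltnW.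
    have : (tm4 <= tm1 + 620 * c + 1100)%N by move: tm4_le tm3_le na3; clear; lia.
    move=> /(natr_le_lin R) tm4R; apply: (V_success vS acc).
    exact: success_time Bi NB tm1_le le_c jN tm4R.
  move=> tm3 s3 c fr3 F3 le_c tm3_le.
  apply: IHe.
  - by move: lt_e lt_j; clear; lia.
  - by rewrite F3.1 //.
  - by [].
  - apply: (same_at _ _ _ _ F3) => // k; first by rewrite !inE => /or3P[]/eqP ->.
  have : (tm3 <= tm1 + 600 * c + 1010)%N by move: tm3_le; clear; lia.
  move=> /(natr_le_lin R); rewrite -[j.+1%:R]natr1.
  exact: copy_time.
have {ge_j le_j}jN : j = N by apply/eqP; rewrite eqn_leq le_j ge_j.
apply: (closed_exit clP); first by rewrite /= e3 ej r2 hN jN ltnn.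
apply: (closed_seq clP); apply: (closed_if clP); rewrite /= e3 /=.
apply: (closed_seq clP).
apply: (closed_wp clP (bfs_spec adjL ansO fr1 ev1 e1 dv)).
move=> m s2 [S [[srep2 fr2 F2] [[m_le na_le vol_le] alt]]].
have ar2 : at_round s2 i.
  by apply: (same_at _ _ _ _ F2) => // k; rewrite !inE => /or3P[]/eqP ->.
have [[_ ev2 em2 [[q1 q2 q3] [q4 q5 q6]]] [g1 g2 g3]] := ar2.
rewrite jN subnn.
have done_case (S' : {set 'I_n}) (b : nat) x : (b <= 1)%N -> nmem s2 1 v_full = b ->
    (0 < b -> exists u : 'I_n, nmem s2 1 v_hub = u)%N ->
    S' = [set u | (u \in S) || ((0 < b)%N && (nmem s2 1 v_hub == u))] ->
    (forall tm', tm'%:R <= 2000 * N%:R * budget i -> rew tm' S' x) ->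
    P ((tm1.+4 + m).+1 + 1)%N ([:: p_tail; p_rounds; p_emit], nset s2 1 v_done 1) x.
  move=> b1 eb hub S'E rewx; apply: (@finish _ S b) => //.
    apply: (setrep_same (F := fun a i => (a == 1%N) && (i == v_done)) _ _ _ srep2).
    - by apply: same_nset.
    - by move=> a k; rewrite !inE => /or3P[]/eqP ->.
    - by move=> k; rewrite !inE => /or4P[]/eqP ->.
  move=> tm' tm'_le; rewrite -S'E; apply: rewx.
  have : (tm' <= tm1 + 220 * 2 ^ i + 500)%N.
    by move: tm'_le m_le na_le; rewrite /= /upd /=; clear; lia.
  move=> /(natr_le_lin R) tm'R; rewrite jN in tm1_le.
  apply: le_trans (fallback_time Bi NB tm1_le B2 tm'R) _.
  by rewrite !ler_wpM2r ?ler0n // ler_nat.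
have volC (A C : {set 'I_n}) : A \subset C -> (vol G A <= vol G C)%N.
  move=> AC; rewrite /vol [X in (_ <= X)%N](bigID (mem A)) /=.
  apply: leq_trans (leq_addr _ _); rewrite leq_eqVlt; apply/orP; left; apply/eqP.
  by apply: eq_bigl => x; rewrite andbC; case: (boolP (x \in A)) => // /(fintype.subsetP AC) ->.
have pos_large (A : {set 'I_n}) : large i A -> (0 < vol G A)%N.
  by rewrite /large; case: (i) => // i' /(leq_ltn_trans (leq0n _)).
apply: (closed_if clP).
case: alt => [[full2 sS]|[u [full2 hub2 vu subC]]].
  rewrite /= full2 /=.
  apply: (closed_wp clP (Q := fun m s' => m = 1%N /\ s' = nset s2 1 v_done 1)); first by wpstep.
  move=> _ _ [-> ->]; apply: (@done_case S 0%N) => //.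
    by apply/setP => x; rewrite inE orbF.
  move=> tm' tm'_le; apply: V_fallback tm'_le; split=> //; [exact: pos_large (exC S sS)|exact: exC|].
  by right; rewrite (spans_boundary sS).
have volU : (vol G S <= 2 ^ i)%N by [].
rewrite /= full2 q4 g1 /=; case: ifPn => [|/negPn cap_le]; last first.
  apply: (closed_wp clP (Q := fun m s' => m = 1%N /\ s' = nset s2 1 v_done 1)); first by wpstep.
  move=> _ _ [-> ->]; apply: (@done_case (u |: S) 1%N) => //.
  - by exists u.
  - by apply/setP => x; rewrite !inE hub2 /= orbC eq_sym.
  move=> tm' tm'_le; apply: V_fallback tm'_le; split=> //; last by left.
    exact: leq_ltn_trans (leq0n _) vu.
  rewrite /large; case: (i) vu => [|i'] vu; first exact: leq_ltn_trans (leq0n _) vu.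
  by apply: leq_ltn_trans vu; rewrite leq_exp2l.
rewrite -ltNge => lt_cap.
apply: (closed_wp clP (Q := fun m s' => m = 1%N /\ s' = s2)); first by wpstep.
move=> _ _ [-> ->].
have exC' C : spans G v C -> large i.+1 C.
  by move=> sC; apply: leq_trans vu (volC _ _ (subC C sC)).
apply: dirP (V_next lt_cap exC') _.
pose Q m s' := m = 7%N /\ at_round s' i.+1.
have wt : wp O p_tail s2 Q.
  rewrite /p_tail /=; apply: wp_seq; apply: wp_rset => /=.
  do 4!wpstep; apply: wp_rset => /=; rewrite /Q; split=> //.
  split; last by split; rewrite /= /upd /= ?g1 ?g2 ?expnS ?addn1.
  split=> //; first by case: fr2 => h1 [h2 h3]; split=> //; split=> // a b c aP; rewrite /= /upd;
    move: aP; rewrite !inE => /or3P[]/eqP -> /=; apply: h3.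
  split; split; rewrite /= /upd //= q3 g1 g2 !addn1 /budget expnS.
  by [].
apply: (closed_wp clP wt) => _ s3 [-> ar3].
have iM : (i < M)%N.
  by rewrite -(@ltn_exp2l 2) // -(ltr_nat R); apply: lt_le_trans lt_cap capM.
apply: IH => //.
- by move: lt_d iM; clear; lia.
- by apply: leqW.
- by right.
- have : (((tm1.+4 + m).+1 + 1) + 7 <= tm1 + 220 * 2 ^ i + 500)%N by move: m_le; clear; lia.
  move=> /(natr_le_lin R) tm'R; rewrite jN in tm1_le.
  apply: (next_time (fallback_time Bi NB tm1_le B2 tm'R) (budget_double i)).
  exact: ler0n.
Qed.

End Rounds.

(** * Choice of the constants *)

Section Reals.
Variable R : realType.
Implicit Types x y : R.

Lemma ln2_le1 : ln 2 <= 1 :> R.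
Proof. by have := @ln_le_sub1 R 2 ltac:(by []); lra. Qed.

Lemma ln2_ge_half : 1 / 2 <= ln 2 :> R.
Proof.
have i0 : 0 < 2^-1 :> R by rewrite invr_gt0.
by have := ln_le_sub1 i0; rewrite lnV ?posrE //; lra.
Qed.

Lemma ln_nat_ge_half n : (2 <= n)%N -> 1 / 2 <= ln n%:R :> R.
Proof.
move=> n2; apply: le_trans ln2_ge_half _.
by rewrite ler_ln ?posrE ?ltr0n ?ler_nat //; apply: leq_trans n2.
Qed.

Lemma ln_pow2 k : ln (2 ^ k)%:R = k%:R * ln 2 :> R.
Proof. by rewrite natrX lnXn // mulr_natl. Qed.

Lemma ln_pow2_le k x : 0 < x -> x <= (2 ^ k)%:R -> ln x <= k%:R.
Proof.
move=> x0 le_x; apply: (@le_trans _ _ (ln (2 ^ k)%:R)).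
  by rewrite ler_ln ?posrE // (lt_le_trans x0).
rewrite ln_pow2 -[X in _ <= X]mulr1 ler_wpM2l //.
exact: ln2_le1.
Qed.

Lemma pow2_ln k x : 0 < x -> (2 ^ k)%:R <= x -> k%:R <= 2 * ln x.
Proof.
move=> x0 le_x; have : ln (2 ^ k)%:R <= ln x.
  by rewrite ler_ln ?posrE // ltr0n expn_gt0.
rewrite ln_pow2 => h.
have : k%:R * (1 / 2) <= k%:R * ln 2 :> R by rewrite ler_wpM2l // ln2_ge_half.
by move: h; lra.
Qed.

Lemma pow2_between x : 1 <= x -> exists j, (2 ^ j)%:R <= x /\ x < 2 * (2 ^ j)%:R.
Proof.
move=> x1; have [m [mx xm]] : exists m : nat, m%:R <= x /\ x < m.+1%:R.
  exists (Num.truncn x); apply/andP; apply: truncn_itv; lra.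
have m0 : (0 < m)%N.
  by rewrite lt0n; apply: contraTneq xm => ->; rewrite -leNgt.
have /andP[lo hi] := trunc_log_bounds (isT : (1 < 2)%N) m0.
exists (trunc_log 2 m); split; first by apply: le_trans mx; rewrite ler_nat.
by apply: lt_le_trans xm _; rewrite -natrM ler_nat -expnS.
Qed.

Lemma ub_pow2 x : exists M, x <= (2 ^ M)%:R.
Proof.
exists (Num.truncn x).+1; apply: (@le_trans _ _ (Num.truncn x).+1%:R).
  by rewrite ltW // truncnS_gt.
by rewrite ler_nat ltnW // ltn_expl.
Qed.

(** For [x] the size limit, [I] is the first round in which the search can stop by size, hence the
    last one that counts for success. *)
Lemma first_pow2 x : exists I, x <= (2 ^ I)%:R /\ (I = 0%N \/ (2 ^ I.-1)%:R < x).
Proof.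
have [M leM] := ub_pow2 x.
have ex : exists I, x <= (2 ^ I)%:R by exists M.
case: (ex_minnP ex) => I leI minI; exists I; split=> //.
case: I leI minI => [|I] leI minI; [by left|right].
by rewrite ltNge; apply/negP => /minI; rewrite ltnn.
Qed.

End Reals.

Section Scalars.
Variables (R : realType) (phi gamma eps : R).
Hypotheses (phi_gt0 : 0 < phi) (phi_lt1 : phi < 1) (gamma_ge1 : 1 <= gamma).
Hypotheses (eps_gt0 : 0 < eps) (eps_lt1 : eps < 1).

(** Powers are written with [expR] and [ln], the operations of the machine: [p_h = gamma^(eps/2)]
    and [p_isq = phi^(-1/2)]. The 32 of [p_cap] makes [gamma / p_cap = 1 / (32 * p_h)]; the 100 of
    [p_th] and the 1000 of [p_D] similarly bound the horizon and budget losses. *)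
Definition p_h : R := expR (eps * ln gamma / 2).
Definition p_isq : R := expR ((0 - ln phi) / 2).
Definition p_th : R := 100 * expR ((ln phi - ln eps) / 2).
Definition p_D : R := 1000 * (p_h * p_isq).
Definition p_cap : R := 32 * (gamma * p_h).

Lemma gamma_gt0 : 0 < gamma. Proof. by apply: lt_le_trans gamma_ge1. Qed.

Lemma lng_ge0 : 0 <= ln gamma. Proof. exact: ln_ge0. Qed.

Lemma h_ge1 : 1 <= p_h.
Proof. by rewrite -expR0 ler_expR divr_ge0 // mulr_ge0 ?lng_ge0 // ltW. Qed.

Lemma h_sqr : p_h * p_h = gamma `^ eps.
Proof.
rewrite /powR gt_eqF ?gamma_gt0 // /p_h -expRD; congr expR; lra.
Qed.

Lemma isq_ge1 : 1 <= p_isq.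
Proof.
rewrite -expR0 ler_expR; have := ln_le0 (ltW phi_lt1); lra.
Qed.

Lemma isqE : p_isq = phi `^ (- 2^-1).
Proof. rewrite /powR gt_eqF // /p_isq; congr expR; lra. Qed.

Lemma th_gt0 : 0 < p_th.
Proof. by rewrite mulr_gt0 ?expR_gt0. Qed.

Lemma thE : p_th = 100 * Num.sqrt (phi / eps).
Proof.
congr (_ * _); rewrite -ln_div ?posrE // -[RHS]powR12_sqrt ?divr_ge0 ?ltW //.
by rewrite /powR gt_eqF ?divr_gt0 // mulrC.
Qed.

Lemma th_sqr : p_th ^+ 2 = 10000 * (phi / eps).
Proof.
rewrite thE exprMn sqr_sqrtr ?divr_ge0 ?ltW //; congr (_ * _).
by rewrite expr2 -natrM.
Qed.

(** The product is [100 / sqrt eps]: dividing by the threshold costs at most [phi^(-1/2) / 100],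
    without [eps]. *)
Lemma th_isq : 100 <= p_th * p_isq.
Proof.
rewrite /p_th /p_isq -mulrA -expRD.
have : 1 <= expR ((ln phi - ln eps) / 2 + (0 - ln phi) / 2).
  by rewrite -[X in X <= _]expR0 ler_expR; have := ln_le0 (ltW eps_lt1); lra.
lra.
Qed.

Lemma inv_th_le : p_th^-1 <= p_isq / 100.
Proof.
rewrite -div1r ler_pdivrMr ?th_gt0 //; have := th_isq; lra.
Qed.

Lemma h_gt0 : 0 < p_h. Proof. exact: expR_gt0. Qed.

Lemma cap_gt0 : 0 < p_cap.
Proof. by rewrite mulr_gt0 // mulr_gt0 ?gamma_gt0 ?h_gt0. Qed.

Lemma cap_ge1 : 1 <= p_cap.
Proof. by rewrite /p_cap; have := mulr_ege1 gamma_ge1 h_ge1; lra. Qed.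

Lemma gamma_le_cap : gamma <= p_cap.
Proof.
rewrite /p_cap mulrA; have : gamma <= gamma * p_h by rewrite ler_peMr ?h_ge1 // ltW ?gamma_gt0.
have := gamma_gt0; lra.
Qed.

Lemma isq_gt0 : 0 < p_isq. Proof. exact: expR_gt0. Qed.

Lemma D_ge1000 : 1000 <= p_D.
Proof.
by rewrite /p_D; have := mulr_ege1 h_ge1 isq_ge1; lra.
Qed.

(** This controls the loss in Markov's inequality for the work. The budget factor [I + 1] absorbs
    the logarithm of the cap, [isq] absorbs [1 / th], and [h] remains as the gain. *)
Lemma cost_aux (h isq th lnc cap b I : R) : 1 <= h -> 1 <= isq -> 0 < th -> th^-1 <= isq / 100 ->
  0 < cap -> 0 <= lnc -> lnc <= I -> cap <= b ->
  cap / (1000 * (h * isq) * (I + 1) * b) * (1 + 8 / th * (2 + lnc)) <= (32 * h)^-1.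
Proof.
move=> h1 i1 th0 ith c0 l0 lI cb.
have h0 : 0 < h by lra.
have i0 : 0 < isq by lra.
have b0 : 0 < b by lra.
have I1 : 0 < I + 1 by lra.
have t0 : 0 <= th^-1 by rewrite invr_ge0 ltW.
have A2 : 1 + 8 / th * (2 + lnc) <= 2 * isq * (I + 1).
  have B1 : 8 * th^-1 * (2 + lnc) <= 8 * (isq / 100) * (2 + I).
    by apply: ler_pM; lra.
  have B3 : 0 <= isq * I by apply: mulr_ge0; lra.
  lra.
have hi := mulr_gt0 h0 i0.
have Dp : 0 < 1000 * (h * isq) by lra.
have DI := mulr_gt0 Dp I1.
have DIb := mulr_gt0 DI b0.
apply: (@le_trans _ _ (cap / (1000 * (h * isq) * (I + 1) * b) * (2 * isq * (I + 1)))).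
  by apply: ler_wpM2l A2; exact: divr_ge0 (ltW c0) (ltW DIb).
have -> : cap / (1000 * (h * isq) * (I + 1) * b) * (2 * isq * (I + 1)) = cap / b * (500 * h)^-1.
  have [n1 n2 n3 n4] := And4 (lt0r_neq0 h0) (lt0r_neq0 i0) (lt0r_neq0 b0) (lt0r_neq0 I1).
  by field; rewrite n1 n2 n3 n4.
have cb1 : cap / b <= 1 by rewrite ler_pdivrMr // mul1r.
have h5 : (500 * h)^-1 <= (32 * h)^-1.
  by rewrite lef_pV2 ?posrE; lra.
have h6 : 0 <= (500 * h)^-1 by rewrite invr_ge0; lra.
apply: le_trans h5; apply: (@le_trans _ _ (1 * (500 * h)^-1)); first exact: ler_wpM2r.
by rewrite mul1r.
Qed.

Lemma cost_term I : p_cap <= (2 ^ I)%:R ->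
  p_cap / (p_D * I.+1%:R * (2 ^ I)%:R) * (1 + 8 / p_th * (2 + ln p_cap)) <= (32 * p_h)^-1.
Proof.
move=> leI; rewrite -natr1 /p_D; apply: (cost_aux _ _ _ _ _ _ _ leI).
- exact: h_ge1.
- exact: isq_ge1.
- exact: th_gt0.
- exact: inv_th_le.
- exact: cap_gt0.
- exact: ln_ge0 cap_ge1.
- exact: ln_pow2_le cap_gt0 leI.
Qed.

Lemma ln8 : ln 8 <= 3 :> R.
Proof.
have e : 8 = (2 ^ 3)%:R :> R by rewrite natrX !exprS expr0; lra.
by rewrite e ln_pow2; have := ln2_le1 R; lra.
Qed.

Lemma ln32 : ln 32 <= 5 :> R.
Proof.
have e : 32 = (2 ^ 5)%:R :> R by rewrite natrX !exprS expr0; lra.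
by rewrite e ln_pow2; have := ln2_le1 R; lra.
Qed.

Lemma ln_h : ln p_h = eps * ln gamma / 2.
Proof. by rewrite /p_h expRK. Qed.

Lemma phi_small : p_th < 1 -> phi <= 1 / 8.
Proof.
move=> th1; have th0 := th_gt0.
have t2 : p_th ^+ 2 < 1 by rewrite expr_lt1 ?ltW.
have : phi <= phi / eps by rewrite ler_pdivlMr // ler_piMr ?ltW.
by rewrite th_sqr in t2; lra.
Qed.

(** As [ln 8 <= 3], an exponent up to [ln h / 3] keeps [8 ^+ k] below [h]; the extra factor 8 on the
    left covers [k = 1] when [h] is small. *)
Lemma pow8_le (h y : R) k : 1 <= h -> k%:R <= Num.max 1 y -> ln h = 3 * y ->
  (0 < k)%N -> (8 * h)^-1 <= 8^-1 ^+ k.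
Proof.
move=> h1 ky lnh k0; have h0 : 0 < h by lra.
have p8 : 0 < 8 :> R by lra.
have pk : 0 < 8 ^+ k :> R by exact: exprn_gt0.
have ph : 0 < 8 * h by exact: mulr_gt0.
rewrite exprVn lef_pV2 ?posrE //.
have [y1|y1] := leP y 1.
  have k1 : k = 1%N.
    by apply/eqP; rewrite eqn_leq k0 andbT -(ler_nat R); rewrite max_l in ky.
  by rewrite k1 expr1; lra.
apply: (@le_trans _ _ h); last by lra.
have l8 := ln8; rewrite -ler_ln ?posrE // lnXn // lnh -[ln 8 *+ k]mulr_natr.
have A : k%:R <= y by rewrite max_r in ky; last exact: ltW.
have : ln 8 * k%:R <= 3 * y by apply: ler_pM => //; apply: ln_ge0; lra.
by [].
Qed.

Lemma survival_aux (X cap h E : R) T : 0 < cap -> 0 < h ->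
  E = T%:R * X -> ln cap / 2 + 5 + ln h <= E ->
  expR (- X) ^+ T * Num.sqrt cap <= (32 * h)^-1.
Proof.
move=> c0 h0 -> le_E; have p32 : 0 < 32 :> R by lra.
have l32 := ln32; have p32h := mulr_gt0 p32 h0.
rewrite -[X in _ <= X]lnK ?posrE ?invr_gt0 // lnV ?posrE // lnM ?posrE //.
rewrite -[Num.sqrt _]lnK ?posrE ?sqrtr_gt0 // -[Num.sqrt _]powR12_sqrt ?(ltW c0) // ln_powR.
by rewrite -expRM_natl -expRD ler_expR; lra.
Qed.

(** Staying in [U] wants a short time [T], halting a long one. With [T * phi] of order
    [max 1 (eps * ln gamma)], the exponent [T * p_th ^+ 2 / 8 = 1250 * T * phi / eps] still
    dominates the logarithms of [p_cap] and [p_h]. *)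
Lemma horizon : p_th < 1 -> exists a j, [/\ 2 * (a.*2)%:R * phi <= 1,
  (8 * p_h)^-1 <= 8^-1 ^+ (2 ^ j) &
  expR (- (p_th ^+ 2 / 8)) ^+ (a.*2 * 2 ^ j) * Num.sqrt p_cap <= (32 * p_h)^-1].
Proof.
move=> th1; have h1 := h_ge1; have h0 := h_gt0; have lg := lng_ge0.
have phi8 := phi_small th1.
(* The largest real time allowed by the escape bound. As [x >= 2], rounding down to [a] loses at
   most half of it. *)
pose x := 1 / (4 * phi).
have x2 : 2 <= x by rewrite /x ler_pdivlMr ?mulr_gt0 //; lra.
pose a := Num.truncn x.
have /andP[ax xa] : a%:R <= x < a.+1%:R by apply: truncn_itv; lra.
have xphi : x * phi = 1 / 4 by rewrite /x; field; rewrite gt_eqF.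
pose y := eps * ln gamma / 6.
have y0 : 0 <= y by rewrite divr_ge0 // mulr_ge0 // ltW.
have [j [jlo jhi]] : exists j, (2 ^ j)%:R <= Num.max 1 y /\ Num.max 1 y < 2 * (2 ^ j)%:R.
  by apply: pow2_between; rewrite le_max lexx.
have m1 : 1 <= Num.max 1 y by rewrite le_max lexx.
have my : y <= Num.max 1 y by rewrite le_max lexx orbT.
exists a, j; split.
- rewrite -muln2 natrM; have : a%:R * phi <= x * phi by rewrite ler_wpM2r // ltW.
  by rewrite xphi; lra.
- by apply: pow8_le jlo _ _; rewrite ?expn_gt0 // ln_h /y; field.
set T := (a.*2 * 2 ^ j)%N.
(* [a] and [2 ^ j] are each at least half of their targets, whence [T * phi >= max 1 y / 8]. *)
have T1 : Num.max 1 y / 16 * 4 * 2 <= T%:R * phi * 4.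
  have A : x / 2 <= a%:R by move: xa; rewrite -natr1; lra.
  have B : Num.max 1 y / 2 <= (2 ^ j)%:R by lra.
  have : x / 2 * (Num.max 1 y / 2) <= a%:R * (2 ^ j)%:R by apply: ler_pM => //; lra.
  move=> /(ler_wpM2r (ltW phi_gt0)).
  have -> : x / 2 * (Num.max 1 y / 2) * phi = x * phi * Num.max 1 y / 4 by field.
  by rewrite xphi /T -muln2 !natrM; lra.
have E1 : 1 <= eps^-1 by rewrite invf_ge1 // ltW.
have T2 : (1 + y) / 4 * eps^-1 <= T%:R * phi * 4 * eps^-1.
  by apply: ler_wpM2r; [lra|move: T1 my m1; clear; lra].
have E3 : y * eps^-1 = ln gamma / 6 by rewrite /y; field; rewrite gt_eqF.
have E5 : eps * ln gamma <= ln gamma by rewrite ler_piMl // ltW.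
apply: survival_aux; [exact: cap_gt0|exact: h_gt0|reflexivity|].
have p32 : 0 < 32 :> R by lra.
rewrite th_sqr /p_cap lnM ?posrE ?(mulr_gt0 gamma_gt0) ?h0 //.
rewrite lnM ?posrE ?gamma_gt0 // ln_h; have l32 := ln32.
have T3 : (eps^-1 + ln gamma / 6) / 4 <= T%:R * phi * 4 * eps^-1.
  by move: T2; rewrite -E3; lra.
by move: T3 E1 E5 l32 lg; clear; lra.
Qed.

End Scalars.

Section Psi.
Variables (R : realType) (n : nat) (G : sgraph n).
Implicit Types (S : {set 'I_n}).

Lemma psi_le capA S : 1 <= capA -> (0 < vol G S)%N -> psi G capA S <= 2 + ln capA :> R.
Proof.
move=> c1 vS; have l0 : 0 <= ln capA := ln_ge0 c1.
have c0 : 0 < capA by lra.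
have mu1 : 1 <= (vol G S)%:R :> R by rewrite ler1n.
have mu0 : 0 < (vol G S)%:R :> R by rewrite ltr0n.
have le_r : capA / (vol G S)%:R <= capA by rewrite ler_pdivrMr // ler_peMr // ltW.
have r0 : 0 < capA / (vol G S)%:R by rewrite divr_gt0.
rewrite /psi /logpot; case: ifPn => [v1|]; last by rewrite -ltNge; lra.
have s0 : 0 < Num.sqrt (capA / (vol G S)%:R) by rewrite sqrtr_gt0.
rewrite -powR12_sqrt ?(ltW r0) // ln_powR.
have : ln (capA / (vol G S)%:R) <= ln capA by rewrite ler_ln ?posrE.
lra.
Qed.

Lemma vol_le_sqr S : (vol G S <= n * n)%N.
Proof.
have deg_le u : (deg G u <= n)%N by rewrite -[X in (_ <= X)%N]card_ord max_card.
apply: leq_trans (_ : \sum_(u in S) n <= _)%N; first exact: leq_sum.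
by rewrite sum_nat_const leq_mul2r -[X in (_ <= X)%N]card_ord max_card orbT.
Qed.

Lemma vol1 u : vol G [set u] = deg G u.
Proof. by rewrite /vol big_set1. Qed.

Lemma le_vol u S : u \in S -> (deg G u <= vol G S)%N.
Proof. by move=> uS; rewrite /vol (bigD1 u) //= leq_addr. Qed.

Lemma deg_lt u : (deg G u < n)%N.
Proof.
have : (deg G u <= #|[set~ u]|)%N.
  apply: subset_leq_card; apply/fintype.subsetP => w; rewrite !inE.
  by apply: contraTneq => ->; rewrite edge_irr.
by rewrite cardsC1 card_ord => /leq_ltn_trans; apply; rewrite ltn_predL (leq_trans _ (ltn_ord u)).
Qed.

End Psi.

Definition i_phi := RGet 0 (NConst 0).
Definition i_gamma := RGet 0 (NConst 1).
Definition i_eps := RGet 0 (NConst 2).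
Definition r_num k := ROfNat (NConst k).

Definition p_init :=
  block [:: RSet 1 (NConst 0) (RMul (r_num 100)
              (RExp (RDiv (RSub (RLn i_phi) (RLn i_eps)) (r_num 2))));
            RSet 1 (NConst 1) (RExp (RDiv (RMul i_eps (RLn i_gamma)) (r_num 2)));
            RSet 1 (NConst 2) (RMul (r_num 1000)
              (RMul r_h (RExp (RDiv (RSub (r_num 0) (RLn i_phi)) (r_num 2)))));
            RSet 1 (NConst 3) (RMul (r_num 32) (RMul i_gamma r_h));
            RSet 1 (NConst 4) r_D;
            RSet 1 (NConst 5) (RSub (r_num 0) (r_num 1));
            assign v_P (NConst 1)].

Definition ParESP := block [:: p_init; p_rounds; p_emit].

Section Init.
Variables (R : realType) (n : nat) (O : oracle) (G : sgraph n).
Variables (P : nat -> config R -> R -> Prop) (v : 'I_n) (phi gamma eps : R).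
Hypothesis clP : step_closed O P.

Lemma ParESP_start x :
  (forall s tm, (tm <= 20)%N ->
     at_round v (p_th phi eps) (p_h gamma eps) (p_D phi gamma eps) (p_cap gamma eps) s 0 ->
     P tm ([:: p_rounds; p_emit], s) x) ->
  P 0 ([:: ParESP], init_state v phi gamma eps) x.
Proof.
move=> Px; apply: (closed_seq clP).
pose Q m s := (m <= 13)%N /\ at_round v (p_th phi eps) (p_h gamma eps) (p_D phi gamma eps)
  (p_cap gamma eps) s 0.
have wt : wp O p_init (init_state v phi gamma eps) Q.
  rewrite /p_init /=; do 6![apply: wp_seq; apply: wp_rset => /=]; wpstep.
  rewrite /Q; split=> //; split; last by split; rewrite /= /upd.
  split=> //; split; split; rewrite /= /upd /=.
  - by [].
  - by move=> a b c; rewrite !inE => /or3P[]/eqP ->.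
  - reflexivity.
  - reflexivity.
  - reflexivity.
  - reflexivity.
  - by rewrite /budget expn0 !mulr1.
  - by rewrite /prev_budget sub0r.
apply: (closed_wp clP wt) => m s [m_le ar]; apply: (closed_seq clP).
by apply: Px ar; lia.
Qed.

End Init.

Section Values.
Variables (R : realFieldType) (N D x i y m B mS c b : R).
Hypotheses (N_ge0 : 0 <= N) (D_ge0 : 0 <= D) (x_ge0 : 0 <= x) (y_ge : 1 / 2 <= y).
Hypotheses (m_ge0 : 0 <= m) (i_le : i <= 1 + 4 * y).

Lemma value_aux : 4000 * N * D * (2 + 4 * y) <=
  4000 * N * D * (2 + 4 * y) + (2 + 4 * y - i) * N * x + m * x.
Proof.
have A1 : 0 <= (2 + 4 * y - i) * N * x.
  by apply: mulr_ge0 => //; apply: mulr_ge0 => //; move: i_le; lra.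
have A2 : 0 <= m * x by rewrite mulr_ge0.
lra.
Qed.

Lemma last_aux : 2000 * N * D <= 4000 * N * D * (2 + 4 * y).
Proof.
have ND : 0 <= N * D by rewrite mulr_ge0.
have NDy : 0 <= N * D * y by rewrite mulr_ge0 //; move: y_ge; lra.
lra.
Qed.

Lemma success_aux : 1 <= mS -> b <= 4 * c + D ->
  2000 * N * b / mS <= 8000 * N * (c / mS) + 2000 * N * D.
Proof.
move=> mS1 b_le; have mS0 : 0 < mS by lra.
rewrite ler_pdivrMr //; have e : c / mS * mS = c by rewrite divfK // gt_eqF.
move: b_le; rewrite -{1}e; set k := c / mS => b_le.
have A1 : N * b <= N * (4 * (k * mS) + D) by rewrite ler_wpM2l.
have A2 : N * D <= N * D * mS by rewrite ler_peMr // mulr_ge0.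
lra.
Qed.

Lemma fallback_aux w : 0 < mS -> w <= 2000 * N * b -> b <= 2 * D * (i + 1) * mS ->
  w / mS <= 4000 * N * D * (2 + 4 * y).
Proof.
move=> mS0 w_le b_le; rewrite ler_pdivrMr //.
have A1 : N * b <= N * (2 * D * (i + 1) * mS) by rewrite ler_wpM2l.
have A2 : N * D * mS * (i + 1) <= N * D * mS * (2 + 4 * y).
  by rewrite ler_wpM2l ?mulr_ge0 ?(ltW mS0) //; move: i_le; lra.
lra.
Qed.

End Values.

Lemma start_slack (R : realFieldType) (N B : R) : 1 <= N -> 1000 <= B -> 20 <= 700 * N * B.
Proof.
move=> N1 B1; have : 1 * 1000 <= N * B by apply: ler_pM; lra.
lra.
Qed.

(** * From value bounds to expectations and probabilities *)

Section Expectation.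
Variables (R : realType) (n : nat) (L : 'I_n -> seq 'I_n) (p : cmd) (v : 'I_n).
Variables (phi gamma eps : R) (f : nat -> {set 'I_n} -> R).

Local Notation g := (fun w out => f w (output_set n out)).
Local Notation start := ([:: p], init_state v phi gamma eps).

Lemma expectation_run_ub b : ub (graph_oracle L) g 0 start b ->
  (expectation_run L p v phi gamma eps f <= b%:E)%E.
Proof. by move=> le_b; apply: ge_ereal_sup => _ [t _ <-]; rewrite lee_fin. Qed.

Lemma expectation_run_lb b : lb (graph_oracle L) g 0 start b ->
  (b%:E <= expectation_run L p v phi gamma eps f)%E.
Proof.
move=> [t le_b]; apply: (@le_trans _ _ (expect_within (graph_oracle L) g t 0 start)%:E).
  by rewrite lee_fin.
by apply: ereal_sup_ubound; exists t.
Qed.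

Lemma expect_within_le1 O (k : nat -> seq nat -> R) t w c :
  (forall w' out, k w' out <= 1) -> expect_within O k t w c <= 1.
Proof.
move=> k1; elim: t w c => [|t IH] w [[|q l] s] //=.
set cs := step _ _; have [/size0nil ->|sz] := posnP (size cs); first by rewrite big_nil mul0r.
rewrite ler_pdivrMr ?mul1r ?ltr0n //.
apply: (@le_trans _ _ (\sum_(c <- cs) 1)); first exact: ler_sum.
by rewrite big_const_seq count_predT iter_addr addr0.
Qed.

End Expectation.

Section Runs.
Variables (R : realType) (n : nat) (G : sgraph n) (L : 'I_n -> seq 'I_n).
Hypothesis adjL : adjacency_lists G L.
Variables (th h D cap : R) (N : nat) (v : 'I_n) (start : config R).
Hypotheses (dv : (0 < deg G v)%N) (th_gt0 : 0 < th) (N_gt0 : (0 < N)%N).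
Hypotheses (hN : forall j, (j%:R <= h) = (j < N)%N) (D_ge : 1000 <= D).

Local Notation O := (graph_oracle L).
Local Notation mu S := ((vol G S)%:R : R).
Local Notation budget := (budget D).
Local Notation accepted := (accepted G th D cap).
Local Notation vbar1 r r0 t := (vbar G (halted G th cap) r r0 t [set v] (deg G v) (mult0 G v)).
Local Notation run f := (fun w out => f w (output_set n out)).

Hypothesis start_spec : forall P x, step_closed O P ->
  (forall s tm, (tm <= 20)%N -> at_round v th h D cap s 0 -> P tm ([:: p_rounds; p_emit], s) x) ->
  P 0 start x.

Lemma run_spec P (dir : R -> R -> Prop) (rew : nat -> {set 'I_n} -> R -> Prop)
    (V : nat -> nat -> R) (rS : nat -> {set 'I_n} -> nat -> R) (fuel : nat -> nat) :
  step_closed O P ->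
  (forall tm c b b', dir b b' -> P tm c b -> P tm c b') ->
  (forall tm s b, rew tm (output_set n (emitted s)) b -> P tm ([::], s) b) ->
  (forall i, budget i < (deg G v + fuel i)%:R) ->
  (forall i m, (m < N)%N -> (forall C, spans G v C -> large G i C) ->
     dir (vbar1 (fun S c => if accepted i S c then rS i S c else V i m) (fun _ _ => V i m)
            (fuel i)) (V i m.+1)) ->
  (forall i, (2 ^ i)%:R < cap -> (forall C, spans G v C -> large G i.+1 C) ->
     dir (V i.+1 N) (V i 0)) ->
  (forall i S c tm, (0 < vol G S)%N -> accepted i S c ->
     tm%:R <= 2000 * N%:R * budget i -> rew tm S (rS i S c)) ->
  (forall i S tm, fallback G cap i S -> tm%:R <= 2000 * N%:R * budget i -> rew tm S (V i 0)) ->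
  P 0 start (V 0 N).
Proof.
move=> clP dirP rewP fuelP V_copy V_next V_success V_fallback.
apply: (start_spec clP) => s tm tm_le ar.
have [M capM] := ub_pow2 cap.
have N1 : 1 <= N%:R :> R by rewrite ler1n.
have B1 := budget_ge1000 D_ge 0.
have time : tm%:R <= 700 * N%:R * budget 0.
  have t20 : tm%:R <= 20 :> R by rewrite ler_nat.
  by apply: le_trans t20 _; exact: start_slack.
have fr0 : forall C, spans G v C -> large G 0 C.
  by move=> C [vC _]; apply: leq_trans dv (le_vol G vC).
exact: (rounds_spec adjL (graph_oracle_answers adjL) clP dirP rewP dv th_gt0 N_gt0
  hN D_ge fuelP V_copy V_next V_success V_fallback capM (leq0n _) (or_introl erefl) ar fr0 time).
Qed.

(** A copy replaces the value [b] of failure by its mixture with 1, so the probabilities of failure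
    of successive copies multiply. *)
Lemma vbar1_acc (r : {set 'I_n} -> nat -> bool) (b : R) t :
  vbar1 (fun S c => if r S c then 1 else b) (fun _ _ => b) t
    = (1 - b) * vbar1 (fun S c => (r S c)%:R) (fun _ _ => 0) t + b.
Proof.
have vS : (0 < vol G [set v])%N by rewrite vol1.
rewrite -vbar_affine //; last exact: valid0.
apply/le_anti/andP; split; apply: vbar_le => //; do ?exact: valid0.
all: by move=> S c _ _; rewrite ?mulr0 ?add0r //; case: (r S c); rewrite ?mulr1 ?mulr0 ?subrK ?add0r.
Qed.

Lemma large_gt0 i S : large G i S -> (0 < vol G S)%N.
Proof. by rewrite /large; case: i => // i' /(leq_ltn_trans (leq0n _)). Qed.

Lemma fuelP i (t : nat) : budget i < (deg G v + maxn t (Num.truncn (budget i)).+1)%:R.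
Proof.
apply: lt_le_trans (truncnS_gt _) _; rewrite ler_nat.
by apply: leq_trans (leq_addl _ _); rewrite leq_maxr.
Qed.

(** All values are 1, so one number of steps suffices for every run: random choices are finite and
    every loop is bounded. *)
Lemma halting : lb O (run (fun _ S => (0 < vol G S)%N%:R)) 0 start 1.
Proof.
pose rew := fun (_ : nat) (S : {set 'I_n}) (b : R) => b <= (0 < vol G S)%N%:R.
apply: (@run_spec _ (fun b b' => b' <= b) rew (fun _ _ => 1) (fun _ _ _ => 1)
  (fun i => maxn 0 (Num.truncn (budget i)).+1)).
- exact: lb_closed.
- by move=> tm c b b'; apply: lb_weaken.
- by move=> tm s b; apply: lb_halt.
- by move=> i; apply: fuelP.
- by move=> i m _ _; rewrite vbar1_acc subrr mul0r add0r.
- by [].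
- by move=> i S c tm vS _ _; rewrite /rew vS.
- by move=> i S tm [_ /large_gt0 vS _ _] _; rewrite /rew vS.
Qed.

Local Notation ell := (ln n%:R : R).

Lemma ell_ge_half : 1 / 2 <= ell.
Proof. by apply: ln_nat_ge_half; apply: leq_ltn_trans (deg_lt G v). Qed.

Lemma large_le i S : large G i S -> i%:R <= 1 + 4 * ell.
Proof.
have l0 := ell_ge_half; case: i => [_|i /= lt_i]; first lra.
have n0 : 0 < n%:R :> R by rewrite ltr0n; apply: leq_ltn_trans (deg_lt G v).
have le_i : (2 ^ i)%:R <= n%:R * n%:R :> R.
  by rewrite -natrM ler_nat; apply: leq_trans (ltnW lt_i) (vol_le_sqr G S).
have := pow2_ln (mulr_gt0 n0 n0) le_i; rewrite lnM ?posrE // -natr1; lra.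
Qed.

Lemma spans_setT : spans G v [set: 'I_n].
Proof. by split=> *; rewrite finset.in_setT. Qed.

(** Consecutive budgets differ by a factor at most 4, and an accepted copy has used more than the
    previous budget; the term [D] is the budget of round 0, which has no lower limit. *)
Lemma budget_accepted i S c : accepted i S c -> budget i <= 4 * c%:R + D.
Proof.
case/and3P => _ lt_c _; have D0 : 0 <= D by move: D_ge; lra.
case: i lt_c => [_|i /= lt_c].
  by rewrite /budget expn0 !mulr1 ler_wpDl // mulr_ge0.
have : budget i.+1 <= 4 * budget i.
  have -> : 4 * budget i = D * (i.+1.*2)%:R * (2 ^ i.+1)%:R.
    rewrite /budget expnS natrM -mul2n natrM; ring.
  rewrite /budget ler_wpM2r // ler_wpM2l // ler_nat; lia.
by move: lt_c D0; lra.
Qed.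

Lemma budget_large i S : large G i S -> budget i <= 2 * D * i.+1%:R * mu S.
Proof.
have D0 : 0 <= D by move: D_ge; lra.
move=> li; have -> : 2 * D * i.+1%:R * mu S = D * i.+1%:R * (2 * mu S) by ring.
rewrite /budget ler_wpM2l ?mulr_ge0 //.
rewrite -natrM ler_nat; case: i li => [|i] /=; first by rewrite expn0; lia.
by rewrite expnS; lia.
Qed.

Definition unit_cost : R := 8000 * N%:R * (1 + 8 / th * (2 + 2 * ell)).
Definition last_cost : R := 4000 * N%:R * D * (2 + 4 * ell).
(* A potential: each copy left in rounds up to [2 + 4 * ell] is worth [unit_cost]. *)
Definition value i m : R := last_cost + (2 + 4 * ell - i%:R) * N%:R * unit_cost + m%:R * unit_cost.

Lemma expected_ratio : ub O (run (fun w S => w%:R / mu S)) 0 start (value 0 N).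
Proof.
pose rew := fun (w : nat) (S : {set 'I_n}) (b : R) => w%:R / mu S <= b.
have f_ge0 w out : 0 <= w%:R / mu (output_set n out) :> R by rewrite divr_ge0.
have N0 : 0 <= N%:R :> R by [].
have D0 : 0 <= D by move: D_ge; lra.
have l0 := ell_ge_half.
have n_gt0 : (0 < n)%N by apply: leq_ltn_trans (deg_lt G v).
have X0 : 0 <= unit_cost.
  have t0 : 0 <= 8 / th * (2 + 2 * ell).
    by rewrite mulr_ge0 ?divr_ge0 ?(ltW th_gt0) //; lra.
  exact: mulr_ge0 (mulr_ge0 (ler0n R 8000) N0) (addr_ge0 ler01 t0).
apply: (@run_spec _ (fun b b' => b <= b') rew value
  (fun i S c => 2000 * N%:R * budget i / mu S) (fun i => maxn 0 (Num.truncn (budget i)).+1)).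
- exact: ub_closed.
- by move=> tm c b b'; apply: ub_weaken.
- by move=> tm s b; apply: ub_halt.
- by move=> i; apply: fuelP.
- move=> i m _ lg; have i_le := large_le (lg _ spans_setT).
  (* The part of the ratio not proportional to [c / mu S] stays below the value of failure, so
     success costs more than failure only in proportion to its own work. *)
  have W_ge : 2000 * N%:R * D <= value i m.
    by apply: le_trans (last_aux N0 D0 l0) _; apply: value_aux.
  have vS : (0 < vol G [set v])%N by rewrite vol1.
  apply: (@le_trans _ _ (vbar1
      (fun S c => 8000 * N%:R * (if success G th cap S then c%:R / mu S else 0) + value i m)
      (fun _ _ => 8000 * N%:R * 0 + value i m) (maxn 0 (Num.truncn (budget i)).+1))).
    apply: vbar_le => //; first exact: valid0; last by move=> S c _ _; rewrite mulr0 add0r.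
    move=> S c vS' _; case: ifPn => [acc|_]; last first.
      by rewrite lerDr; apply: mulr_ge0; [exact: mulr_ge0 (ler0n R 8000) N0|case: ifP => // _; rewrite divr_ge0].
    have mS1 : 1 <= mu S by rewrite ler1n.
    have -> : success G th cap S by case/and3P: acc.
    apply: le_trans (success_aux N0 D0 mS1 (budget_accepted acc)) _.
    by rewrite lerD2l.
  rewrite vbar_affine //; last exact: valid0.
  have -> : value i m.+1 = value i m + unit_cost.
    by rewrite /value -[m.+1%:R]natr1; ring.
  rewrite addrC lerD2l /unit_cost ler_wpM2l ?(mulr_ge0 (ler0n R 8000) N0) //.
  apply: le_trans (@vbar_cost _ _ _ _ _ th_gt0 (n%:R * n%:R) _ _ _ _ _ vS _) _.
  + exact: valid0.
  + by move=> S vS' _; rewrite -natrM ler_nat vol_le_sqr.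
  rewrite vol1 divff ?lerD2l; last by rewrite pnatr_eq0 -lt0n.
  rewrite ler_wpM2l ?divr_ge0 ?(ltW th_gt0) //.
  apply: le_trans (psi_le _ vS) _.
    by rewrite -natrM ler1n muln_gt0 n_gt0.
  by rewrite lnM ?posrE ?ltr0n //; lra.
- move=> i _ _; have -> // : value i.+1 N = value i 0.
  by rewrite /value -[i.+1%:R]natr1; ring.
- move=> i S c tm vS _ le_tm.
  by rewrite /rew ler_wpM2r // invr_ge0.
- move=> i S tm [vS li _ _] le_tm; have i_le := large_le li.
  rewrite /rew /value; apply: (le_trans _ (value_aux D N0 X0 (ler0n R 0) i_le)).
  have := budget_large li; rewrite -[i.+1%:R]natr1 => b_le.
  by apply: (fallback_aux N0 D0 i_le _ le_tm b_le); rewrite ltr0n.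
Qed.

Lemma vbar1_le1 (r : {set 'I_n} -> nat -> bool) t :
  vbar1 (fun S c => (r S c)%:R) (fun _ _ => 0) t <= 1 :> R.
Proof.
have vS : (0 < vol G [set v])%N by rewrite vol1.
have e := vbar1_acc (fun _ _ => true) 1 t; rewrite /= subrr mul0r add0r in e.
rewrite -[X in _ <= X]e.
by apply: vbar_le => //; [exact: valid0|move=> S c _ _; case: (r S c)].
Qed.

Section Success.
Variables (T I : nat) (p : R).
Hypotheses (capI : cap <= (2 ^ I)%:R) (I_min : I = 0%N \/ (2 ^ I.-1)%:R < cap).
Hypothesis p_le : p <= vbar1 (fun S c => (success G th cap S && (c%:R <= budget I))%:R)
                         (fun _ _ => 0) T.

Definition chance i : R := vbar1 (fun S c => (accepted i S c)%:R) (fun _ _ => 0)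
  (maxn T (Num.truncn (budget i)).+1).

Lemma success_bucket S c : success G th cap S -> c%:R <= budget I ->
  exists i : 'I_I.+1, accepted i S c.
Proof.
move=> sS le_c.
have ex : exists i, c%:R <= budget i by exists I.
case: (ex_minnP ex) => i le_i min_i.
have lt_i : (i < I.+1)%N by rewrite ltnS min_i.
exists (Ordinal lt_i); apply/and3P; split=> //=.
case: i le_i min_i lt_i => [|i] le_i min_i lt_i /=; first by have := ler0n R c; lra.
by rewrite ltNge; apply/negP => /min_i; rewrite ltnn.
Qed.

Lemma chance_sum : p <= \sum_(i < I.+1) chance i.
Proof.
have vS : (0 < vol G [set v])%N by rewrite vol1.
apply: le_trans p_le _; apply: (@le_trans _ _ (\sum_(i < I.+1)
    vbar1 (fun S c => (accepted i S c)%:R) (fun _ _ => 0) T)); last first.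
  apply: ler_sum => i _; apply: vbar_fuel => //; first exact: leq_maxl.
  exact: valid0.
rewrite -vbar_sum; apply: vbar_le => //; first exact: valid0.
  move=> S c _ _; have [/andP[sS le_c]|_] := boolP (_ && _); last by rewrite sumr_ge0.
  have [i acc] := success_bucket sS le_c.
  by rewrite (bigD1 i) //= acc lerDl sumr_ge0.
by move=> S c _ _; rewrite sumr_ge0.
Qed.

Definition miss i : R := \prod_(i <= l < I.+1) (1 - chance l) ^+ N.
(* A lower bound for the probability of a good output when [m] copies of round [i]
   are left: rounds after [I] are not counted. *)
Definition hit i m : R := 1 - (1 - chance i) ^+ m * miss i.+1.

Lemma miss_ge0 i : 0 <= miss i.
Proof.
by apply: prodr_ge0 => l _; rewrite exprn_ge0 // subr_ge0 vbar1_le1.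
Qed.

Lemma miss_end i : (I < i)%N -> miss i = 1.
Proof. by move=> lt_i; rewrite /miss big_geq. Qed.

(** By [1 - x <= exp (- x)], the product of all failures is at most the exponential of minus [N]
    times the sum of the chances: splitting the work into windows loses nothing. *)
Lemma hit_ge : 1 - expR (- (N%:R * p)) <= hit 0 N.
Proof.
rewrite /hit lerB // /miss.
have -> : (1 - chance 0) ^+ N * \prod_(1 <= l < I.+1) (1 - chance l) ^+ N =
    \prod_(0 <= l < I.+1) (1 - chance l) ^+ N by rewrite [RHS]big_ltn.
rewrite prodrXl big_mkord; apply: (@le_trans _ _ ((expR (- p)) ^+ N)); last first.
  by rewrite -expRM_natl mulrN.
rewrite lerXn2r ?nnegrE ?expR_ge0 ?prodr_ge0 // => [l _|].
  by rewrite subr_ge0 vbar1_le1.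
apply: (@le_trans _ _ (expR (- \sum_(l < I.+1) chance l))); last first.
  by rewrite ler_expR lerN2 chance_sum.
rewrite -sumrN expR_sum; apply: ler_prod => l _.
by rewrite subr_ge0 vbar1_le1 /=; apply: expR_ge1Dx.
Qed.

Lemma success_probability (A : {set 'I_n} -> bool) :
  (forall S, (0 < vol G S)%N -> success G th cap S -> A S) ->
  (forall S i, boundary G S = 0%N -> i = 0%N \/ (2 ^ i.-1)%:R < cap ->
     (vol G S <= 2 ^ i)%N -> A S) ->
  lb O (run (fun _ S => (A S)%:R)) 0 start (1 - expR (- (N%:R * p))).
Proof.
move=> good good0; apply: lb_weaken hit_ge _.
pose rew := fun (_ : nat) (S : {set 'I_n}) (b : R) => b <= (A S)%:R.
apply: (@run_spec _ (fun b b' => b' <= b) rew hit (fun _ _ _ => 1)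
  (fun i => maxn T (Num.truncn (budget i)).+1)).
- exact: lb_closed.
- by move=> tm c b b'; apply: lb_weaken.
- by move=> tm s b; apply: lb_halt.
- by move=> i; apply: fuelP.
- move=> i m _ _; rewrite vbar1_acc -/(chance i) /hit exprS le_eqVlt; apply/orP; left; apply/eqP.
  ring.
- move=> i lt_cap _; have lt_i : (i < I)%N.
    by rewrite -(@ltn_exp2l 2) // -(ltr_nat R); apply: lt_le_trans lt_cap capI.
  by rewrite /hit expr0 mul1r {1}/miss big_ltn // ltnS.
- by move=> i S c tm vS /and3P[sS _ _] _; rewrite /rew good.
- move=> i S tm [vS _ capi alt] _; rewrite /rew.
  have hit1 : hit i 0 <= 1 by rewrite /hit gerDl oppr_le0 mulr_ge0 ?miss_ge0.
  case: alt => [le_cap|[b0 le_v]]; last by rewrite (good0 S i).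
  (* Stopping by size means [cap <= 2^i], so [i >= I] by minimality of [I]: no counted copy is left,
     and the claimed probability is 0. *)
  have -> : hit i 0 = 0; last by [].
  rewrite /hit miss_end ?expr0 ?mulr1 ?subrr // ltnS.
  case: I_min => [->//|lt_cap]; case: (I) lt_cap => // I' /= lt_cap.
  by rewrite -(@ltn_exp2l 2) // -(ltr_nat R); apply: lt_le_trans lt_cap le_cap.
Qed.

End Success.

End Runs.

(** * Final estimates *)

Section RatioBound.
Variable R : realFieldType.
Implicit Types h N s t l q x y : R.

Lemma main_term h N s l : 0 <= h -> 0 <= s -> N <= 2 * h -> 1 / 2 <= l ->
  N * (h * s) * (2 + 4 * l) <= 32 * (h * h * s * l ^+ 2).
Proof.
move=> h0 s0 Nh l2; have l0 : 0 <= l by lra.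
have A1 : N * (h * s) <= 2 * h * (h * s) by rewrite ler_wpM2r ?mulr_ge0.
have A2 : 2 + 4 * l <= 16 * l ^+ 2.
  have : 1 / 2 * l <= l * l by rewrite ler_wpM2r.
  rewrite expr2; lra.
have A3 : N * (h * s) * (2 + 4 * l) <= 2 * h * (h * s) * (2 + 4 * l).
  by rewrite ler_wpM2r //; lra.
have A4 : h * (h * s) * (2 + 4 * l) <= h * (h * s) * (16 * l ^+ 2).
  by rewrite ler_wpM2l ?mulr_ge0.
lra.
Qed.

Lemma copy_term h N s t l : 0 <= h -> 0 <= N -> 1 <= s -> N <= 2 * h -> 1 / 2 <= l ->
  0 <= t -> t <= s / 100 ->
  N * N * ((3 + 4 * l) * (1 + 8 * t * (2 + 2 * l))) <= 120 * (h * h * s * l ^+ 2).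
Proof.
move=> h0 N0 s1 Nh l2 t0 ts; have l0 : 0 <= l by lra.
have A1 : N * N <= 4 * (h * h).
  by have := ler_pM N0 N0 Nh Nh; lra.
have A2 : 8 * t * (2 + 2 * l) <= 8 * (s / 100) * (6 * l) by apply: ler_pM; lra.
have sl : 1 * l <= s * l by rewrite ler_wpM2r.
have A3 : 1 + 8 * t * (2 + 2 * l) <= 3 * (s * l) by lra.
have tl : 0 <= t * l by rewrite mulr_ge0.
have A4 : (3 + 4 * l) * (1 + 8 * t * (2 + 2 * l)) <= 10 * l * (3 * (s * l)).
  by apply: ler_pM; lra.
have A5 : 0 <= (3 + 4 * l) * (1 + 8 * t * (2 + 2 * l)) by rewrite mulr_ge0; lra.
have := ler_pM (mulr_ge0 N0 N0) A5 A1 A4; rewrite expr2; lra.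
Qed.

Lemma ratio_arith q x y : 0 <= q -> x <= 32 * q -> y <= 120 * q ->
  4000 * (1000 * x) + 8000 * y <= 1000 * (1000 * 1000) * q.
Proof. by move=> *; lra. Qed.

Lemma share_arith (e s u q c : R) : 8^-1 * e <= s -> u <= 32^-1 * e -> q <= 32^-1 * e ->
  c <= 32^-1 * e -> 32^-1 * e <= s - u - q - c.
Proof. by move=> *; lra. Qed.

End RatioBound.

Section Constants.
Variables (R : realType) (n : nat) (G : sgraph n).
Variables (phi gamma eps : R).
Hypotheses (phi_gt0 : 0 < phi) (phi_lt1 : phi < 1) (gamma_ge1 : 1 <= gamma).
Hypotheses (eps_gt0 : 0 < eps) (eps_lt1 : eps < 1).
Variable v : 'I_n.
Hypothesis dv : (0 < deg G v)%N.

Local Notation th := (p_th phi eps).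
Local Notation h := (p_h gamma eps).
Local Notation D := (p_D phi gamma eps).
Local Notation cap := (p_cap gamma eps).
Local Notation mu S := ((vol G S)%:R : R).
Local Notation ell := (ln n%:R : R).

Definition copies : nat := (Num.truncn h).+1.
Local Notation N := copies.

Lemma copiesP j : (j%:R <= h) = (j < N)%N.
Proof. by rewrite /copies ltnS truncn_ge_nat // ltW // h_gt0. Qed.

Lemma h_le_copies : h <= N%:R.
Proof. by rewrite ltW // truncnS_gt. Qed.

Lemma copies_le : N%:R <= 2 * h.
Proof.
have h1 := h_ge1 gamma_ge1 eps_gt0.
have := truncn_le h; rewrite /copies -natr1 (le_trans ler01 h1) => tr.
by move: tr h1; lra.
Qed.

Definition ratio_constant : R := 1000 * (1000 * 1000).

Lemma ratio_constant_gt0 : 0 < ratio_constant. Proof. by rewrite /ratio_constant; lra. Qed.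

(** One logarithm counts the rounds, the other is the initial potential. The power of [gamma] is [h]
    squared: [N] copies per round, each charged for [N] times its work, and in the fallback term [N]
    times the factor [h] of [D]. *)
Lemma value_le :
  value n th D N 0 N <= ratio_constant * (gamma `^ eps * phi `^ (- 2^-1) * ell ^+ 2).
Proof.
rewrite -(h_sqr _ gamma_ge1) -(isqE phi_gt0).
have h0 := ltW (h_gt0 gamma eps); have s1 := isq_ge1 phi_lt1.
have N0 : 0 <= N%:R :> R by [].
have l2 := ell_ge_half R dv.
have t0 : 0 <= th^-1 by rewrite invr_ge0 (ltW (th_gt0 phi eps)).
have s0 : 0 <= p_isq phi := ltW (isq_gt0 phi).
have M1 := main_term h0 s0 copies_le l2.
have M2 := copy_term h0 N0 s1 copies_le l2 t0 (inv_th_le phi eps_lt1).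
have q0 : 0 <= h * h * p_isq phi * ell ^+ 2.
  by apply: mulr_ge0 (sqr_ge0 _); apply: mulr_ge0 s0; apply: mulr_ge0.
apply: le_trans (ratio_arith q0 M1 M2).
rewrite le_eqVlt; apply/orP; left; apply/eqP; rewrite /value /last_cost /unit_cost /p_D.
ring.
Qed.

Local Notation vbar1 r t := (vbar G (halted G th cap) r (fun _ _ => 0) t [set v] (deg G v) (mult0 G v)).

Lemma vol_set1 : (0 < vol G [set v])%N.
Proof. by rewrite vol1. Qed.

Lemma chance_dense (U : {set 'I_n}) T I : cap <= (2 ^ I)%:R -> mu U <= gamma ->
  (8 * h)^-1 <= stay R G U T v ->
  expR (- (th ^+ 2 / 8)) ^+ T * Num.sqrt cap <= (32 * h)^-1 ->
  (32 * h)^-1 <= vbar1 (fun S c => (success G th cap S && (c%:R <= budget D I))%:R) T.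
Proof.
move=> capI leU le_stay surv.
have c0 := cap_gt0 eps gamma_ge1; have h0 := h_gt0 gamma eps; have g0 := gamma_gt0 gamma_ge1.
have D1 := D_ge1000 phi_lt1 gamma_ge1 eps_gt0.
have B0 : 0 < budget D I by have := budget_ge1000 D1 I; lra.
have d0 : 0 < (deg G v)%:R :> R by rewrite ltr0n.
have i8 : (8 * h)^-1 = 8^-1 * h^-1 by rewrite invfM.
have i32 : (32 * h)^-1 = 32^-1 * h^-1 by rewrite invfM.
apply: le_trans (vbar_success (th_gt0 phi eps) U T _ (valid0 dv) vol_set1 c0 B0).
(* The share 1/8 of [1 / h] minus three losses of 1/32: size, horizon and work. *)
rewrite i32; apply: share_arith.
- by rewrite big_set1 vol1 mulrAC divff ?gt_eqF // mul1r -i8.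
- rewrite ler_pdivrMr // /p_cap; apply: le_trans leU _.
  rewrite le_eqVlt; apply/orP; left; apply/eqP; field; exact: lt0r_neq0.
- rewrite -i32; apply: le_trans surv; apply: ler_wpM2l; first by rewrite exprn_ge0 ?expR_ge0.
  rewrite vol1 ler_wsqrtr // ler_pdivrMr // ler_peMr ?(ltW c0) //.
  by rewrite ler1n.
rewrite -i32; apply: le_trans (cost_term phi_lt1 gamma_ge1 eps_gt0 eps_lt1 capI).
rewrite -/(budget D I); apply: ler_wpM2l; first by rewrite divr_ge0 ?(ltW c0) ?(ltW B0).
rewrite vol1 divff ?gt_eqF // lerD2l; apply: ler_wpM2l.
  by rewrite divr_ge0 // (ltW (th_gt0 phi eps)).
exact: psi_le (cap_ge1 gamma_ge1 eps_gt0) vol_set1.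
Qed.

Lemma chance_sparse (U : {set 'I_n}) I : cap <= (2 ^ I)%:R -> mu U <= gamma -> v \in U ->
  1 <= th ->
  (32 * h)^-1 <= vbar1 (fun S c => (success G th cap S && (c%:R <= budget D I))%:R) 0.
Proof.
move=> capI leU vU th1; have D1 := D_ge1000 phi_lt1 gamma_ge1 eps_gt0.
have h1 := h_ge1 gamma_ge1 eps_gt0.
have le_cap : (deg G v)%:R <= cap.
  apply: le_trans (gamma_le_cap gamma_ge1 eps_gt0); apply: le_trans leU.
  by rewrite ler_nat le_vol.
have sp : sparse G th [set v].
  rewrite /sparse; apply: (@le_trans _ _ (mu [set v])).
    by rewrite ler_nat boundary_le_vol.
  by rewrite ler_peMl.
rewrite /= /halted sp /= /success sp vol1 le_cap /=.
have -> : (deg G v)%:R <= budget D I.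
  apply: le_trans le_cap _; apply: le_trans capI _; apply: le_trans (budget_ge D1 I).
  by have := ler0n R (2 ^ I); lra.
by rewrite invf_le1; lra.
Qed.

Definition quality (S : {set 'I_n}) : bool :=
  (conductance R G S <= ratio_constant * Num.sqrt (phi / eps)) && (mu S <= ratio_constant * gamma `^ (1 + eps)).

(** The maximum covers a component found in round [i]: its volume is at most [2^i], which is 1 for
    [i = 0] and below [2 * cap] otherwise. *)
Lemma cap_le_quality x : x <= Num.max 1 (2 * cap) -> x <= ratio_constant * gamma `^ (1 + eps).
Proof.
have h1 := h_ge1 gamma_ge1 eps_gt0; have g0 := gamma_gt0 gamma_ge1.
rewrite powRD; last by rewrite (gt_eqF g0) implybT.
rewrite powRr1 ?(ltW g0) // -(h_sqr _ gamma_ge1) /p_cap /ratio_constant.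
have A1 : gamma * h <= gamma * (h * h) by rewrite ler_pM2l // ler_peMl //; lra.
have A2 : 1 <= gamma * h by apply: mulr_ege1.
by rewrite le_max => /orP[]; lra.
Qed.

Lemma quality_success S : (0 < vol G S)%N -> success G th cap S -> quality S.
Proof.
move=> vS /andP[sp le_cap]; have s0 : 0 <= Num.sqrt (phi / eps) by rewrite sqrtr_ge0.
apply/andP; split.
  rewrite /conductance ler_pdivrMr ?ltr0n //; apply: le_trans sp _.
  rewrite ler_wpM2r // thE // /ratio_constant; lra.
apply: cap_le_quality; rewrite le_max; apply/orP; right.
by have := cap_gt0 eps gamma_ge1; lra.
Qed.

Lemma quality_closed S i : boundary G S = 0%N -> i = 0%N \/ (2 ^ i.-1)%:R < cap ->
  (vol G S <= 2 ^ i)%N -> quality S.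
Proof.
move=> b0 capi le_v; apply/andP; split.
  by rewrite /conductance b0 mul0r; exact: mulr_ge0 (ltW ratio_constant_gt0) (sqrtr_ge0 _).
apply: cap_le_quality; apply: (@le_trans _ _ (2 ^ i)%:R); first by rewrite ler_nat.
case: capi => [->|]; first by rewrite expn0 le_max lexx.
case: i {le_v} => [|i] /= lt_cap; first by rewrite expn0 le_max lexx.
by rewrite le_max expnS natrM ler_pM2l // (ltW lt_cap) orbT.
Qed.

Lemma miss_le : expR (- (N%:R * (32 * h)^-1)) <= expR (- 32^-1) :> R.
Proof.
rewrite ler_expR lerN2; have h0 := h_gt0 gamma eps.
have -> : 32^-1 = h * (32 * h)^-1 :> R by rewrite invfM mulrCA divff ?mulr1 // gt_eqF.
by rewrite ler_wpM2r ?h_le_copies // invr_ge0 mulr_ge0 // ltW.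
Qed.

End Constants.

Section Assembly.
Variables (R : realType) (n : nat) (G : sgraph n) (L : 'I_n -> seq 'I_n).
Hypothesis adjL : adjacency_lists G L.
Variables (phi gamma eps : R).
Hypotheses (phi_gt0 : 0 < phi) (phi_lt1 : phi < 1) (gamma_ge1 : 1 <= gamma).
Hypotheses (eps_gt0 : 0 < eps) (eps_lt1 : eps < 1).
Variable v : 'I_n.
Hypothesis dv : (0 < deg G v)%N.

Lemma ParESP_halts :
  probability_run L ParESP v phi gamma eps (fun S => (0 < vol G S)%N) = 1%:E.
Proof.
apply/le_anti/andP; split.
  by apply: expectation_run_ub => t; apply: expect_within_le1 => w out; case: (_ < _)%N.
apply: expectation_run_lb; apply: (halting adjL dv (th_gt0 phi eps) (ltn0Sn _)
  (copiesP gamma eps) (D_ge1000 phi_lt1 gamma_ge1 eps_gt0)) => P x clP.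
exact: (ParESP_start clP).
Qed.

Lemma ParESP_ratio :
  (expectation_run L ParESP v phi gamma eps (fun W S => W%:R / (vol G S)%:R)%R
     <= (ratio_constant R * (gamma `^ eps * phi `^ (- 2^-1) * ln n%:R ^+ 2))%:E)%E.
Proof.
apply: expectation_run_ub; apply: ub_weaken (value_le phi_gt0 phi_lt1 gamma_ge1 eps_gt0 eps_lt1 dv) _.
apply: (expected_ratio adjL dv (th_gt0 phi eps) (ltn0Sn _)
  (copiesP gamma eps) (D_ge1000 phi_lt1 gamma_ge1 eps_gt0)) => P x clP.
exact: (ParESP_start clP).
Qed.

Lemma ParESP_quality T I : p_cap gamma eps <= (2 ^ I)%:R ->
  I = 0%N \/ (2 ^ I.-1)%:R < p_cap gamma eps ->
  (32 * p_h gamma eps)^-1 <= vbar G (halted G (p_th phi eps) (p_cap gamma eps))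
    (fun S c => (success G (p_th phi eps) (p_cap gamma eps) S
                 && (c%:R <= budget (p_D phi gamma eps) I))%:R)
    (fun _ _ => 0) T [set v] (deg G v) (mult0 G v) ->
  ((1 - expR (- 32^-1))%:E <= probability_run L ParESP v phi gamma eps (quality G phi gamma eps))%E.
Proof.
move=> capI minI p_le; apply: expectation_run_lb.
have := miss_le gamma eps; rewrite -(lerN2 (expR _)) -(lerD2l 1) => le1.
apply: lb_weaken le1 _.
apply: (success_probability adjL dv (th_gt0 phi eps) (ltn0Sn _)
  (copiesP gamma eps) (D_ge1000 phi_lt1 gamma_ge1 eps_gt0) _ capI minI p_le).
- by move=> P x clP; exact: (ParESP_start clP).
- by move=> S; apply: quality_success.
- by move=> S i; apply: quality_closed.
Qed.

End Assembly.

Theorem theorem1p1 (R : realType) :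
  exists (ParESP : cmd) (c0 C : R), 0 < c0 /\ 0 < C /\
  forall (n : nat) (G : sgraph n) (phi gamma eps : R),
    0 < phi -> phi < 1 -> 1 <= gamma -> 0 < eps -> eps < 1 ->
    (forall (L : 'I_n -> seq 'I_n) (v : 'I_n),
       adjacency_lists G L -> (0 < deg G v)%N ->
       probability_run L ParESP v phi gamma eps
         (fun S => (0 < vol G S)%N) = 1%:E /\
       (expectation_run L ParESP v phi gamma eps
          (fun W S => W%:R / (vol G S)%:R)%R
        <= (C * (gamma `^ eps * phi `^ (- 2^-1) * ln n%:R ^+ 2))%:E)%E) /\
    (forall U : {set 'I_n},
       conductance R G U <= phi -> (vol G U)%:R <= gamma ->
       exists U' : {set 'I_n},
         U' \subset U /\ (vol G U)%:R / 2 <= (vol G U')%:R :> R /\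
         forall (L : 'I_n -> seq 'I_n) (v : 'I_n),
           adjacency_lists G L -> (0 < deg G v)%N -> v \in U' ->
           (c0%:E <= probability_run L ParESP v phi gamma eps
              (fun S => (conductance R G S <= C * Num.sqrt (phi / eps))
                 && ((vol G S)%:R <= C * gamma `^ (1 + eps)))%R)%E).
Proof.
(* The number of copies exceeds [h] and the total chance of a copy is at least [1 / (32h)], whence
   the exponent 1/32. *)
exists ParESP, (1 - expR (- 32^-1)), (ratio_constant R); split.
  by rewrite subr_gt0 expR_lt1 oppr_lt0 invr_gt0.
split=> [|n G phi gamma eps phi_gt0 phi_lt1 gamma_ge1 eps_gt0 eps_lt1]; first exact: ratio_constant_gt0.
split=> [L v adjL dv|U condU volU].
  split; first exact: (ParESP_halts adjL).
  exact: (ParESP_ratio adjL).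
have [I [capI minI]] := first_pow2 (p_cap gamma eps).
(* The horizon needs [phi] small, which [p_th < 1] guarantees; otherwise all of [U] qualifies. *)
have [th1|th1] := leP 1 (p_th phi eps).
  exists U; split=> //; split=> [|L v adjL dv vU]; first by have := ler0n R (vol G U); lra.
  apply: (ParESP_quality adjL phi_gt0 phi_lt1 gamma_ge1 eps_gt0 dv capI minI).
  exact: (chance_sparse phi_lt1 gamma_ge1 eps_gt0 capI volU vU th1).
have [a [j [short le_p surv]]] := horizon phi_gt0 gamma_ge1 eps_gt0 eps_lt1 th1.
exists (core G U (a.*2 * 2 ^ j) (8^-1 ^+ (2 ^ j) : R)); split.
  by apply/fintype.subsetP => u; rewrite inE => /andP[].
split=> [|L v adjL dv].
  (* In volume 0 the conductance is [0 / 0 = 0] and carries no information, but the boundary is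
     empty. *)
  apply: vol_core; have [v0|v0] := posnP (vol G U).
    have : (boundary G U <= vol G U)%N := boundary_le_vol G U.
    by rewrite v0 leqn0 => /eqP ->; rewrite mulr0.
  have muU : 0 < (vol G U)%:R :> R by rewrite ltr0n.
  move: condU; rewrite /conductance ler_pdivrMr // => bdU.
  apply: (@le_trans _ _ (2 * (a.*2)%:R * (phi * (vol G U)%:R))).
    by apply: ler_wpM2l bdU; apply: mulr_ge0.
  by rewrite mulrA ler_piMl // ltW.
rewrite inE => /andP[vU stay_v].
apply: (ParESP_quality adjL phi_gt0 phi_lt1 gamma_ge1 eps_gt0 dv capI minI).
exact: (chance_dense phi_lt1 gamma_ge1 eps_gt0 eps_lt1 dv capI volU (le_trans le_p stay_v) surv).
Qed.
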